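(* Let $\mathcal G$ be a compact, connected metric graph with edge set $E$, edge lengths $(\ell_e)_{e\in E}$ and total length $|\mathcal G|$, and let $p\in(1,\infty)$. Let $(\lambda_{n,p}(\mathcal G))_{n\in\mathbb N}$ be the variational eigenvalues of the $p$-Laplacian on $\mathcal G$ with natural vertex conditions, for each $n$ let $\psi_{n,p}$ be an associated eigenfunction, and let $\nu_{n,p}$ be the number of nodal domains of $\psi_{n,p}$. Then $$\operatorname{acc}\left\{\tfrac{\nu_{n,p}}{n}:n\in\mathbb N\right\}\subset\left\{\frac{\sum_{e\in E_0}\ell_e}{|\mathcal G|}:E_0\subset E\text{ is a nonempty set of edges}\right\}.$$ In particular, $\operatorname{acc}\{\tfrac{\nu_{n,p}}{n}:n\in\mathbb N\}$ is a finite set, and $$0<\frac{\ell_{\min}}{|\mathcal G|}\le\liminf_{n\to\infty}\frac{\nu_{n,p}}{n}\le\limsup_{n\to\infty}\frac{\nu_{n,p}}{n}\le1,$$ where $\ell_{\min}:=\min\{\ell_e:e\in E\}$.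
   Context: Metric graph: $\mathcal G$ is obtained from a finite connected combinatorial graph $(V,E)$ (loops and multiple edges allowed) by identifying each edge $e\in E$ with an interval $[0,\ell_e]$ of finite length $\ell_e>0$ and gluing endpoints at the vertices; $|\mathcal G|=\sum_{e}\ell_e$. $W^{1,p}(\mathcal G)$ is the real Sobolev space of continuous functions on $\mathcal G$ that are edgewise $W^{1,p}$. Variational eigenvalues: let $\mathcal S=\{f\in W^{1,p}(\mathcal G):\|f\|_{L^p(\mathcal G)}^p=1\}$. For a closed, symmetric ($\mathcal C=-\mathcal C$), non-empty set $\mathcal C\subset\mathcal S$ let its Krasnosel'skii genus $\gamma(\mathcal C)$ be the smallest $k\in\mathbb N$ for which there is a continuous odd map $\mathcal C\to\mathbb S^k$, where $\mathbb S^k$ denotes the unit sphere in $\mathbb R^k$ (and $\gamma(\mathcal C)=\infty$ if there is none). With $\mathcal F_n$ the family of such sets with $\gamma(\mathcal C)\ge n$, $$\lambda_{n,p}(\mathcal G)=\inf_{\mathcal C\in\mathcal F_n}\sup_{f\in\mathcal C}\int_{\mathcal G}|f'(x)|^p\,dx .$$ An eigenfunction associated with $\lambda=\lambda_{n,p}(\mathcal G)$ is a nonzero real function $u\in W^{1,p}(\mathcal G)$ with $\int_{\mathcal G}|u'|^{p-2}u'\varphi'\,dx=\lambda\int_{\mathcal G}|u|^{p-2}u\varphi\,dx$ for all $\varphi\in W^{1,p}(\mathcal G)$; equivalently, edgewise $u'=|v|^{1/(p-1)}\operatorname{sgn}v$, $v'=-\lambda|u|^{p-1}\operatorname{sgn}u$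 with $u,v$ absolutely continuous, $u$ continuous at the vertices and $v$ satisfying the Kirchhoff condition at the vertices. Such an eigenfunction exists for every $n$. Its nodal domains are the closures in $\mathcal G$ of the connected components of $\{\psi_{n,p}\ne0\}$. For a sequence $(a_n)\subset\mathbb R$, $\operatorname{acc}\{a_n:n\in\mathbb N\}$ is the set of its points of accumulation, i.e. of limits of its convergent subsequences. *)

(* Defs.v *)
From HB Require Import structures.
From mathcomp Require Import all_boot all_order all_algebra generic_quotient finmap.
From mathcomp Require Import all_classical all_reals all_analysis.

Set Implicit Arguments.
Unset Strict Implicit.
Unset Printing Implicit Defensive.

Import Order.TTheory GRing.Theory Num.Theory.
Import numFieldNormedType.Exports.

Local Open Scope classical_set_scope.
Local Open Scope ring_scope.
Local Open Scope quotient_scope.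

Definition adjacent (V E : finType) (s t : E -> V) : rel V :=
  fun u v => [exists e, ((s e == u) && (t e == v)) || ((s e == v) && (t e == u))].

(* The orientation of an edge only serves to fix the identification of the
   edge with [0, len e]; loops and multiple edges are allowed. *)
Record metric_graph (R : realType) := MetricGraph {
  vertex : finType;
  edge : finType;
  src : edge -> vertex;
  tgt : edge -> vertex;
  len : edge -> R;
  len_gt0 : forall e, 0 < len e;
  edge_gt0 : (0 < #|edge|)%N;
  graph_connected : forall u v, connect (adjacent src tgt) u v }.

Section Space.
Context {R : realType} (G : metric_graph R).

Definition total_length : R := \sum_(e : edge G) len e.

Definition some_edge : edge G := enum_val (Ordinal (edge_gt0 G)).

Definition min_length : R := len [arg min_(e < some_edge) len e]%O.

Definition edge_interval (e : edge G) : topologicalType :=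
  set_type `[0, len e].

Definition edge_union : topologicalType := {e : edge G & edge_interval e}.

Definition glue_code (x : edge_union) : vertex G + edge G * R :=
  let e := projT1 x in
  let t : R := \val (projT2 x) in
  if t == 0 then inl (src e)
  else if t == len e then inl (tgt e)
  else inr (e, t).

Definition glue_rel : rel edge_union := fun x y => glue_code x == glue_code y.

Lemma glue_equiv : equiv_class_of glue_rel.
Proof.
split=> [x|x y|y x z]; rewrite /glue_rel; first exact: eqxx.
  by rewrite eq_sym.
by move=> /eqP -> /eqP ->.
Qed.

Canonical glue_equiv_rel := EquivRelPack glue_equiv.

Definition graph_space : topologicalType :=
  quotient_topology {eq_quot glue_equiv_rel}.

Fact edge_origin_subproof (e : edge G) : 0 \in `[0, len e]%classic.
Proof. by rewrite inE /= in_itv /= lexx ltW // len_gt0. Qed.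

Definition edge_origin (e : edge G) : edge_interval e :=
  exist _ 0 (edge_origin_subproof e).

(* Meaningful for x in [0, len e] only; elsewhere it is the origin of e. *)
Definition edge_point (e : edge G) (x : R) : graph_space :=
  \pi_graph_space (existT _ e (insubd (edge_origin e) x)).

End Space.

Section Sobolev.
Context {R : realType} (G : metric_graph R) (p : R).
Implicit Types (f u phi : graph_space G -> R) (C : set (graph_space G -> R)).

Local Notation mu := (@lebesgue_measure R).

(* Test functions are C^1, as in Brezis; smooth ones yield the same weak
   derivatives. *)
Definition test_function (l : R) (eta : R -> R) : Prop :=
  [/\ forall x, derivable eta x 1,
      continuous (derive1 eta),
      compact (closure [set x | eta x != 0]) &
      closure [set x | eta x != 0] `<=` `]0, l[ ].

Definition weak_derivative f (e : edge G) (g : R -> R) : Prop :=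
  [/\ measurable_fun `]0, len e[ g,
      (\int[mu]_(x in `]0%R, len e[) (`|g x| `^ p)%:E < +oo)%E &
      forall eta, test_function (len e) eta ->
        \int[mu]_(x in `]0, len e[) (f (edge_point e x) * derive1 eta x) =
        - \int[mu]_(x in `]0, len e[) (g x * eta x)].

Definition sobolev : set (graph_space G -> R) :=
  [set f | continuous f /\ forall e, exists g, weak_derivative f e g].

(* A chosen weak derivative on the edge e; it is unique almost everywhere. *)
Definition wderiv f (e : edge G) : R -> R :=
  xget (fun=> 0) [set g | weak_derivative f e g].

Definition lp_pow f : \bar R :=
  (\sum_(e : edge G)
    \int[mu]_(x in `]0%R, len e[) (`|f (edge_point e x)| `^ p)%:E)%E.

Definition energy f : \bar R :=
  (\sum_(e : edge G)
    \int[mu]_(x in `]0%R, len e[) (`|wderiv f e x| `^ p)%:E)%E.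

Definition sobolev_norm f : \bar R := ((lp_pow f + energy f) `^ p^-1)%E.

Definition lp_sphere : set (graph_space G -> R) :=
  sobolev `&` [set f | lp_pow f = 1%E].

Definition closed_in_sobolev C : Prop :=
  forall f, sobolev f ->
    (forall eps : R, 0 < eps ->
      exists2 g, C g & (sobolev_norm (g - f)%R < eps%:E)%E) ->
    C f.

Definition symmetric_set C : Prop := forall f, C f -> C (- f).

Definition unit_sphere (k : nat) : set 'rV[R]_k :=
  [set x | \sum_(i < k) x 0 i ^+ 2 = 1].

Definition continuous_odd_map C (k : nat)
    (h : (graph_space G -> R) -> 'rV[R]_k) : Prop :=
  [/\ forall f, C f -> unit_sphere (h f),
      forall f, C f -> h (- f) = - h f &
      forall f, C f -> forall eps : R, 0 < eps ->
        exists2 delta : R, 0 < delta &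
          forall g, C g -> (sobolev_norm (g - f)%R < delta%:E)%E ->
            `|h g - h f| < eps].

(* The infimum of the empty set is +oo. *)
Definition genus C : \bar R :=
  ereal_inf [set (k%:R)%:E | k in
    [set k : nat | exists h : (graph_space G -> R) -> 'rV[R]_k,
                     continuous_odd_map C h]].

Definition genus_family (n : nat) : set (set (graph_space G -> R)) :=
  [set C | [/\ C `<=` lp_sphere, closed_in_sobolev C, symmetric_set C,
               C !=set0 & (n%:R%:E <= genus C)%E]].

Definition variational_eigenvalue (n : nat) : \bar R :=
  ereal_inf [set ereal_sup [set energy f | f in C] | C in genus_family n].

(* For 1 < p < 2 the integrands vanish where the function does, as
   |0| `^ (p - 2) * 0 = 0. *)
Definition is_eigenfunction (lambda : R) u : Prop :=
  [/\ sobolev u, exists x, u x != 0 &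
      forall phi, sobolev phi ->
        \sum_(e : edge G) \int[mu]_(x in `]0, len e[)
           (`|wderiv u e x| `^ (p - 2) * wderiv u e x * wderiv phi e x) =
        lambda * \sum_(e : edge G) \int[mu]_(x in `]0, len e[)
           (`|u (edge_point e x)| `^ (p - 2) * u (edge_point e x)
              * phi (edge_point e x))].

End Sobolev.

Section Nodal.
Context {R : realType} (G : metric_graph R).

Definition nodal_domains (u : graph_space G -> R) : set (set (graph_space G)) :=
  let N := [set x | u x != 0] in
  [set closure (connected_component N x) | x in N].

(* fset_set is empty on infinite sets, so infinitely many nodal domains would
   count as 0, which is never the number for a nonzero function. *)
Definition nodal_count (u : graph_space G -> R) : nat :=
  #|` fset_set (nodal_domains u)|%fset.

End Nodal.

Definition acc {R : realType} (a : nat -> R) : set R :=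
  [set x | exists2 s : nat -> nat, {homo s : m n / (m < n)%N} &
             a (s k) @[k --> \oo] --> x].

(* Main.v *)
Require Import Defs.
From HB Require Import structures.
From mathcomp Require Import all_boot all_order all_algebra generic_quotient finmap.
From mathcomp Require Import all_classical all_reals all_analysis.
From mathcomp Require Import measurable_realfun lra ring.

(* Let Lam be the infimum of the quotient of int |f'|^p by int |f|^p over the
   functions on [0, 1] vanishing at both ends, and put T = (Lam / lambda)^(1/p).
   On an edge on which an eigenfunction u is not identically zero, consecutive
   interior zeros are exactly T apart: u restricted to a nodal interval is a test
   function for the Rayleigh quotient, and conversely Picone's inequality bounds that
   quotient below by lambda. Since u cannot vanish on a subinterval only, a nodal
   count differs from (total length of the edges carrying u) / T by at most a
   constant. Comparing with point evaluations, respectively with spans of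
   disjoint bumps and the Borsuk-Ulam theorem, gives Weyl's law: n differs from
   |G| / T by at most a constant. Hence nu_n / n is within O(1 / n) of one of
   the finitely many ratios. The value of Lam, classically expressed through
   generalized sine functions, cancels. *)

(** Since [Lam] is an infimum that is not shown to be attained, nothing is proved at the critical
    length T itself. Each comparison is made at a length strictly below or strictly above T, and T
    enters only in the final real inequalities, by choosing a length close enough to it. Every
    function built on the graph vanishes at the vertices, so that each edge is treated as an
    interval of its own. The price is a bounded number of points per edge, which is where the errors
    of order [#|edge G|] come from. The energy uses a chosen weak derivative, known only almost
    everywhere. The analysis is therefore carried out with pairs (f, g) where f is a primitive of g,
    and the du Bois-Reymond lemma translates between the two. The two halves of Weyl's law use the
    genus differently. Bounding a genus from above only takes an odd map without zeros, normalised
    to a sphere; bounding the genus of a sphere of bump combinations from below is the Borsuk-Ulam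
    theorem. *)

Set Implicit Arguments.
Unset Strict Implicit.
Unset Printing Implicit Defensive.
Import Order.TTheory GRing.Theory Num.Theory.
Import numFieldNormedType.Exports.
Local Open Scope classical_set_scope.
Local Open Scope ring_scope.

(** * The Borsuk-Ulam theorem, by mod 2 chains *)

Section ModTwoChains.
Context {T : Type}.
Implicit Types (a : seq T -> bool) (s : seq T) (c : seq (seq T)).

(** A list of vertex sequences stands for a chain mod 2, a predicate on sequences for a cochain.
    Equalities of chains are stated only through this pairing, which makes cancellation mod 2
    automatic. *)
Definition chain_eval a c := \big[addb/false]_(s <- c) a s.

(** The sum of a over the faces of s, in the augmented complex: the empty sequence is the face of a
    single vertex. *)
Fixpoint coboundary a s : bool :=
  if s is x :: s' then a s' (+) coboundary (a \o cons x) s' else false.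

(** The prism operator of a homotopy from f0 to f1: the simplices f0 x_0, ..., f0 x_i, f1 x_i, ...,
    f1 x_n. *)
Fixpoint prism (f0 f1 : T -> T) s : seq (seq T) :=
  if s is x :: s' then
    [:: f0 x, f1 x & map f1 s'] :: map (cons (f0 x)) (prism f0 f1 s')
  else [::].

(** The cup product of the coboundaries of the vertex functions in [os]; the empty product is the
    constant 1 on vertices. *)
Fixpoint cup (os : seq (T -> bool)) s : bool :=
  match os, s with
  | [::], [:: _] => true
  | o :: os', x :: (y :: _) as s' => (o x (+) o y) && cup os' s'
  | _, _ => false
  end.

Lemma eq_chain_eval a b c : a =1 b -> chain_eval a c = chain_eval b c.
Proof. by move=> ab; apply: eq_bigr => s _; exact: ab. Qed.

Lemma chain_eval_cat a c1 c2 :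
  chain_eval a (c1 ++ c2) = chain_eval a c1 (+) chain_eval a c2.
Proof. by rewrite /chain_eval big_cat. Qed.

Lemma chain_eval_map a (F : seq T -> seq T) c :
  chain_eval a (map F c) = chain_eval (a \o F) c.
Proof. by rewrite /chain_eval big_map. Qed.

Lemma chain_eval_cons a s c : chain_eval a (s :: c) = a s (+) chain_eval a c.
Proof. by rewrite /chain_eval big_cons. Qed.

Lemma chain_eval_addb a b c :
  chain_eval (fun s => a s (+) b s) c = chain_eval a c (+) chain_eval b c.
Proof. by rewrite /chain_eval big_split. Qed.

Lemma eq_coboundary a b s : a =1 b -> coboundary a s = coboundary b s.
Proof.
elim: s a b => [//|x s IH] a b ab /=; rewrite ab; congr (_ (+) _).
by apply: IH => t /=; exact: ab.
Qed.

Lemma coboundary_addb a b s :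
  coboundary (fun s => a s (+) b s) s = coboundary a s (+) coboundary b s.
Proof.
elim: s a b => [//|x s IH] a b /=.
have := IH (a \o cons x) (b \o cons x); rewrite /comp => ->.
by rewrite addbACA.
Qed.

Lemma coboundary_andb (o : bool) a s :
  coboundary (fun s => o && a s) s = o && coboundary a s.
Proof.
case: o => //=.
by elim: s.
Qed.

Lemma coboundary_map a (F : T -> T) s :
  coboundary (fun t => a (map F t)) s = coboundary a (map F s).
Proof. by elim: s a => [//|x s IH] a /=; congr (_ (+) _); rewrite -IH. Qed.

(** The chain homotopy formula in dual form: the boundary of a prism consists of its top, its bottom
    and the prism over the boundary. The induction peels off the first vertex and uses the
    hypothesis for the cochain with f0 x prepended. *)
Lemma prism_homotopy f0 f1 a s :
  chain_eval (coboundary a) (prism f0 f1 s)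
    (+) coboundary (fun t => chain_eval a (prism f0 f1 t)) s
  = a (map f1 s) (+) a (map f0 s).
Proof.
elim: s a => [|x s IH] a; first by rewrite /chain_eval big_nil /= addbb.
have IHx := IH (a \o cons (f0 x)).
rewrite [prism _ _ _]/= chain_eval_cons chain_eval_map.
have -> : coboundary (fun t => chain_eval a (prism f0 f1 t)) (x :: s)
  = chain_eval a (prism f0 f1 s)
    (+) (coboundary (a \o cons (f0 x) \o cons (f1 x)) (map f1 s)
         (+) coboundary (fun t => chain_eval (a \o cons (f0 x)) (prism f0 f1 t)) s).
  rewrite /=; congr (_ (+) _); rewrite -coboundary_map -coboundary_addb.
  apply: eq_coboundary => t /=.
  by rewrite chain_eval_cons chain_eval_map.
have -> : chain_eval (coboundary a \o cons (f0 x)) (prism f0 f1 s)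
  = chain_eval a (prism f0 f1 s)
    (+) chain_eval (coboundary (a \o cons (f0 x))) (prism f0 f1 s).
  by rewrite -chain_eval_addb.
move: IHx => /=.
set u1 := chain_eval a _; set u2 := chain_eval (coboundary _) _.
set u3 := coboundary (fun t => chain_eval _ _) s.
set u4 := coboundary _ (map f1 s).
clearbody u1 u2 u3 u4.
move: (a (f1 x :: _)) (a (f0 x :: map f1 s)) (a (f0 x :: map f0 s)).
by case: u1 u2 u3 u4 => -[] [] [] [] [] [].
Qed.

(** Every factor is a coboundary, hence closed, and a product of closed cochains is closed. *)
Lemma coboundary_cup os s :
  size s = (size os).+2 -> coboundary (cup os) s = false.
Proof.
elim: os s => [|o os IH] [|x [|y s]] //.
  by case: s.
case: s => [//|z s] [ss].
have IHy := IH [:: y, z & s]; rewrite /= ss in IHy; have {}IHy := IHy erefl.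
move: IHy => /=.
set A := cup os (z :: s); set B := (_ (+) coboundary _ s) => E.
have {E}AB : A = B by move: E; case: A; case: B.
have -> : coboundary (cup (o :: os) \o cons x \o cons y \o cons z) s
   = (o x (+) o y) && coboundary (cup os \o cons y \o cons z) s.
  by rewrite -coboundary_andb; exact: eq_coboundary.
rewrite -/A.
have -> : cup os (y :: s) = B (+) coboundary (cup os \o cons y \o cons z) s.
  by rewrite /B /= -addbA addbb addbF.
rewrite -AB; clearbody A; move: (coboundary _ _) => C {AB}.
by case: A; case: C; case: (o x); case: (o y); case: (o z).
Qed.

(** The Leibniz rule, the factor [cup os] being closed. The primitive o times [cup os] is not
    invariant under an antipode that flips o, and [cup_hemisphere] lives on this defect. *)
Lemma coboundary_ocup o os x s : size s = (size os).+1 ->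
  coboundary (fun t => if t is y :: _ then o y && cup os t else false) (x :: s)
  = cup (o :: os) (x :: s).
Proof.
case: s => [//|y s] [ss] /=.
have := @coboundary_cup os [:: x, y & s]; rewrite /= ss => /(_ erefl).
have -> : coboundary ((fun t => if t is y0 :: _ then o y0 && cup os t else false)
    \o cons x \o cons y) s = o x && coboundary (cup os \o cons x \o cons y) s.
  by rewrite -coboundary_andb; exact: eq_coboundary.
move: (cup os (y :: s)) (cup os (x :: s)) (coboundary _ s) => A B C.
by case: A; case: B; case: C; case: (o x); case: (o y).
Qed.


Lemma coboundary1 a x : coboundary a [:: x] = a [::].
Proof. by rewrite /= addbF. Qed.
End ModTwoChains.

Lemma cup_const (T : eqType) (os : seq (T -> bool)) (o : T -> bool) (b : bool)
    (i : nat) s :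
  nth o os i = o -> (i < size os)%N -> {in s, forall x, o x = b} ->
  cup os s = false.
Proof.
elim: os i s => [//|o' os IH] i [|x [|y s]] //= oi ios ob.
case: i oi ios => [/= ->|i oi ios].
  by move=> _; rewrite (ob x) ?inE ?eqxx// (ob y) ?inE ?eqxx ?orbT// addbb.
rewrite (IH i) ?andbF// => z zs; apply: ob; by rewrite inE zs orbT.
Qed.

Section BorsukUlam.
Context {R : realType}.

Lemma compact_uniform_continuity (V W : normedModType R) (K : set V)
    (H : V -> W) (e : R) :
  compact K ->
  (forall x, K x -> forall eps : R, 0 < eps -> exists2 d : R, 0 < d &
     forall y, K y -> `|y - x| < d -> `|H y - H x| < eps) ->
  0 < e -> exists2 d : R, 0 < d &
     forall x y, K x -> K y -> `|y - x| < d -> `|H y - H x| < e.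
Proof.
move=> /compact_near_coveringP cK cH e0.
have e20 : 0 < e / 2 by rewrite divr_gt0.
pose P (d : R) x := K x -> forall y, K y -> `|y - x| < d -> `|H y - H x| < e.
have /cK : forall x, K x -> \forall x' \near x & i \near 0^'+, P i x'.
  move=> x Kx; have [d d0 Hd] := cH x Kx _ e20.
  exists (ball x (d / 2), [set i | i < d / 2]) => /=.
    split; first by apply: nbhsx_ballx; rewrite divr_gt0.
    by apply: nbhs_right_lt; rewrite divr_gt0.
  move=> [x' i] /= [xx' id] Kx' y Ky yx'.
  move: xx'; rewrite -ball_normE /ball_/= => xx'.
  have -> : H y - H x' = (H y - H x) - (H x' - H x).
    by rewrite opprB addrA subrK.
  apply: (le_lt_trans (ler_normB _ _)); rewrite (splitr e) ltrD// Hd//.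
    have -> : y - x = (y - x') - (x - x') by rewrite opprB addrA subrK.
    by apply: (le_lt_trans (ler_normB _ _)); rewrite (splitr d) ltrD// (lt_trans yx').
  by rewrite distrC (lt_trans xx')// ltr_pdivrMr// ltr_pMr// ltr1n.
move=> KP.
have : \forall i \near 0^'+, 0 < i /\ K `<=` P i.
  by near=> i; split; near: i => //; exact: nbhs_right_gt.
move=> /filter_ex[d [d0 Pd]]; exists d => // x y Kx Ky; exact: Pd.
Unshelve. all: by end_near. Qed.


Lemma mx_norm_leP n (x : 'rV[R]_n) (c : R) : 0 <= c ->
  reflect (forall k, `|x 0 k| <= c) (`|x| <= c).
Proof.
move=> c0; rewrite [ `|x| ]mx_normrE; apply: (iffP (bigmax_leP _ _ _ _)).
  by move=> [_ h] k; exact: (h (0, k)).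
by move=> h; split=> // -[i k] _ /=; rewrite ord1.
Qed.

Lemma mx_norm_coord n (x : 'rV[R]_n) k : `|x 0 k| <= `|x|.
Proof. by have /mx_norm_leP := lexx `|x|; apply. Qed.

Section Hemispheres.
Variables (n N : nat).
Hypothesis N0 : (0 < N)%N.
Local Notation V := 'rV[R]_n.+1.

Definition pole (i : nat) : V := delta_mx 0 (inord i).

(** During the first N steps the pole component grows while x is kept, during the last N steps x
    shrinks. One of the two coefficients is thus always 1, which keeps the sup norm equal to 1. *)
Definition shrinkc (j : nat) : R := Num.min 1 (2 - j%:R / N%:R).
Definition raisec (j : nat) : R := Num.min 1 (j%:R / N%:R).

(* Runs from the identity at [j = 0] to the constant map [pole i] at
   [j = 2 N], inside the unit sphere of the sup norm. *)
Definition to_pole (i j : nat) (x : V) : V :=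
  shrinkc j *: x + raisec j *: pole i.

Definition with_antipode (c : seq (seq V)) := c ++ map (map -%R) c.

(** A chain of dimension i whose boundary is the previous hemisphere together with its antipode
    ([boundary_hemisphere]): this cycle is swept to a new pole through N + N layers of prisms. *)
Fixpoint hemisphere (i : nat) : seq (seq V) :=
  if i is i'.+1 then
    flatten [seq flatten [seq prism (to_pole i j) (to_pole i j.+1) s
                         | s <- with_antipode (hemisphere i')]
            | j <- iota 0 (N + N)]
  else [:: [:: pole 0]].

Lemma shrinkc_bound j : (j <= N + N)%N -> 0 <= shrinkc j <= 1.
Proof.
move=> jN; rewrite /shrinkc ge_min lexx /= le_min ler01 /= subr_ge0.
rewrite ler_pdivrMr ?ltr0n//.
by rewrite mulr_natl mulr2n -natrD ler_nat andbT.
Qed.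

Lemma raisec_bound j : 0 <= raisec j <= 1.
Proof. by rewrite /raisec ge_min lexx /= le_min ler01 /= divr_ge0. Qed.

Lemma shrinkc_step j : `|shrinkc j.+1 - shrinkc j| <= N%:R^-1.
Proof.
have NR : 0 < N%:R^-1 :> R by rewrite invr_gt0 ltr0n.
rewrite /shrinkc -[j.+1%:R]natr1 mulrDl mul1r; move: (j%:R / _) NR => t NR.
by rewrite ler_norml /Num.min; case: ifP; case: ifP; lra.
Qed.

Lemma raisec_step j : `|raisec j.+1 - raisec j| <= N%:R^-1.
Proof.
have NR : 0 < N%:R^-1 :> R by rewrite invr_gt0 ltr0n.
rewrite /raisec -[j.+1%:R]natr1 mulrDl mul1r; move: (j%:R / _) NR => t NR.
by rewrite ler_norml /Num.min; case: ifP; case: ifP; lra.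
Qed.

Lemma shrinkc_raisec j : shrinkc j = 1 \/ raisec j = 1.
Proof.
rewrite /shrinkc /raisec; have [tl|tg] := leP (j%:R / N%:R : R) 1.
  by left; rewrite min_l//; lra.
by right; rewrite ?min_l// ltW.
Qed.

(** Describes the whole i-sphere of the sup norm, so that it is stable under the antipode. *)
Definition in_hemisphere i (x : V) := `|x| = 1 /\ forall k : 'I_n.+1, (i < k)%N -> x 0 k = 0.

Lemma in_hemisphereN i x : in_hemisphere i x -> in_hemisphere i (- x).
Proof. by move=> [x1 xk]; split=> [|k ik]; rewrite ?normrN// mxE xk// oppr0. Qed.

Lemma poleE i (k : 'I_n.+1) : pole i 0 k = (k == inord i)%:R.
Proof. by rewrite /pole mxE eqxx. Qed.

Lemma in_hemisphere_pole : in_hemisphere 0 (pole 0).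
Proof.
split=> [|k k0]; last first.
  rewrite poleE (_ : k == _ = false)//.
  by apply/negbTE/eqP => /(congr1 val); rewrite /= inordK// => k00; rewrite k00 in k0.
apply/eqP; rewrite eq_le; apply/andP; split.
  by apply/mx_norm_leP => // k; rewrite poleE; case: eqP; rewrite ?normr1 ?normr0.
by apply: le_trans (mx_norm_coord _ (inord 0)); rewrite poleE eqxx normr1.
Qed.

Lemma to_poleE i j x (k : 'I_n.+1) : in_hemisphere i x -> (i < n)%N ->
  to_pole i.+1 j x 0 k = if k == inord i.+1 then raisec j else shrinkc j * x 0 k.
Proof.
move=> [_ xk] i_n; rewrite /to_pole !mxE eqxx /=; case: eqP => [->|_].
  by rewrite xk ?inordK ?ltnS// mulr0 add0r mulr1.
by rewrite mulr0 addr0.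
Qed.

Lemma in_hemisphere_to_pole i j x : (i < n)%N -> (j <= N + N)%N ->
  in_hemisphere i x -> in_hemisphere i.+1 (to_pole i.+1 j x).
Proof.
move=> i_n jN xi; have [x1 xk] := xi.
have /andP[s0 s1] := shrinkc_bound jN; have /andP[r0 r1] := raisec_bound j.
split; last first.
  move=> k ik; rewrite to_poleE// xk ?mulr0 ?(ltn_trans _ ik)//.
  case: eqP => // kE; move: ik; rewrite kE inordK ?ltnn//.
have le1 : `|to_pole i.+1 j x| <= 1.
  apply/mx_norm_leP => // k; rewrite to_poleE//; case: eqP => _.
    by rewrite ger0_norm.
  by rewrite normrM (ger0_norm s0) mulr_ile1// -x1 mx_norm_coord.
apply/eqP; rewrite eq_le le1 /=.
have [sE|rE] := shrinkc_raisec j; last first.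
  by apply: le_trans (mx_norm_coord _ (inord i.+1)); rewrite to_poleE// eqxx rE normr1.
rewrite -[leLHS]x1; apply/mx_norm_leP => // k.
have [kE|kE] := eqVneq k (inord i.+1).
  by rewrite kE xk ?normr0// inordK.
by apply: le_trans (mx_norm_coord _ k); rewrite to_poleE// (negbTE kE) sE mul1r.
Qed.

(** The indices are those of the two sides of one layer. The coefficient of x is at most 1, so
    distances do not grow, and one step moves a point by at most 1 / N. *)
Lemma to_pole_dist i j1 j2 x y d : (i < n)%N ->
  (j1 <= N + N)%N -> (j2 <= N + N)%N ->
  [|| j1 == j2, j1 == j2.+1 | j2 == j1.+1] ->
  in_hemisphere i x -> in_hemisphere i y -> `|x - y| <= d ->
  `|to_pole i.+1 j1 x - to_pole i.+1 j2 y| <= d + N%:R^-1.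
Proof.
move=> i_n j1N j2N j12 xi yi xyd.
have d0 : 0 <= d by apply: le_trans xyd.
have NR : 0 <= N%:R^-1 :> R by rewrite invr_ge0.
have /andP[s0 s1] := shrinkc_bound j1N.
have hs : `|shrinkc j1 - shrinkc j2| <= N%:R^-1.
  by case/or3P: j12 => /eqP->; rewrite ?subrr ?normr0// ?shrinkc_step// distrC shrinkc_step.
have hr : `|raisec j1 - raisec j2| <= N%:R^-1.
  by case/or3P: j12 => /eqP->; rewrite ?subrr ?normr0// ?raisec_step// distrC raisec_step.
apply/mx_norm_leP => [|k]; first by rewrite addr_ge0.
rewrite [X in `|X|]mxE [X in _ + X]mxE !to_poleE//; case: eqP => _.
  by rewrite (le_trans hr)// lerDr.
rewrite (_ : _ - _ = shrinkc j1 * (x 0 k - y 0 k) + (shrinkc j1 - shrinkc j2) * y 0 k); last by lra.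
apply: (le_trans (ler_normD _ _)); apply: lerD.
  rewrite normrM (ger0_norm s0) -[leRHS]mul1r ler_pM//.
  have := mx_norm_coord (x - y) k; rewrite !mxE => /le_trans; exact.
rewrite normrM -[leRHS]mulr1 ler_pM//.
by rewrite -yi.1 mx_norm_coord.
Qed.

Lemma size_prism (T : eqType) (f0 f1 : T -> T) s t :
  t \in prism f0 f1 s -> size t = (size s).+1.
Proof.
elim: s t => [//|x s IH] t /=; rewrite inE => /orP[/eqP->/=|].
  by rewrite size_map.
by move=> /mapP[u /IH us ->] /=; rewrite us.
Qed.

Lemma mem_prism (T : eqType) (f0 f1 : T -> T) s t : t \in prism f0 f1 s ->
  forall x, x \in t -> exists2 y, y \in s & x = f0 y \/ x = f1 y.
Proof.
elim: s t => [//|x s IH] t /=; rewrite inE => /orP[/eqP-> y|].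
  rewrite !inE => /or3P[/eqP->|/eqP->|/mapP[z zs ->]].
  - by exists x; [rewrite inE eqxx|left].
  - by exists x; [rewrite inE eqxx|right].
  - by exists z; [rewrite inE zs orbT|right].
move=> /mapP[u us ->] y; rewrite inE => /orP[/eqP->|yu].
  by exists x; [rewrite inE eqxx|left].
have [z zs zE] := IH u us y yu; exists z => //; by rewrite inE zs orbT.
Qed.

Lemma hemisphereP i s : s \in hemisphere i.+1 ->
  exists2 j, (j < N + N)%N & exists2 s',
    s' \in hemisphere i \/ (exists2 s'', s'' \in hemisphere i & s' = map -%R s'') &
    s \in prism (to_pole i.+1 j) (to_pole i.+1 j.+1) s'.
Proof.
move=> /= /flattenP[c /mapP[j]]; rewrite mem_iota add0n => jN -> {c}.
move=> /flattenP[c /mapP[s' s'i ->]] ss'; exists j => //; exists s' => //.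
by move: s'i; rewrite mem_cat => /orP[|/mapP[s'' s''i ->]]; [left|right; exists s''].
Qed.

Lemma size_hemisphere i s : s \in hemisphere i -> size s = i.+1.
Proof.
elim: i s => [|i IH] s; first by rewrite inE => /eqP->.
move=> /hemisphereP[j _ [s' s'i /size_prism->]].
by case: s'i => [/IH->//|[s'' /IH s''i ->]]; rewrite size_map s''i.
Qed.

(** Each of the i sweeps adds at most 1 / N to the diameter of a simplex. *)
Lemma hemisphere_mesh i s : (i <= n)%N -> s \in hemisphere i ->
  {in s, forall x, in_hemisphere i x} /\
  {in s &, forall x y, `|x - y| <= i%:R / N%:R}.
Proof.
elim: i s => [|i IH] s i_n.
  rewrite inE => /eqP->; split=> [x|x y]; rewrite !inE => /eqP->.
    exact: in_hemisphere_pole.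
  by move=> /eqP->; rewrite subrr normr0 mul0r.
move=> /hemisphereP[j jN [s' s'i ss']].
have {s'i}[h1 h2] : {in s', forall x, in_hemisphere i x} /\
    {in s' &, forall x y, `|x - y| <= i%:R / N%:R}.
  case: s'i => [/IH|[s'' /IH]]; first by apply; exact: ltnW.
  move=> /(_ (ltnW i_n))[h1 h2 ->]; split.
    by move=> _ /mapP[x xs ->]; apply: in_hemisphereN; exact: h1.
  move=> _ _ /mapP[x xs ->] /mapP[y ys ->].
  by rewrite -opprD normrN; exact: h2.
split=> [x xs|x y xs ys].
  have [x' x's [] ->] := mem_prism ss' xs; apply: in_hemisphere_to_pole => //.
  - exact: ltnW.
  - exact: h1.
  - exact: h1.
have [x' x's xE] := mem_prism ss' xs; have [y' y's yE] := mem_prism ss' ys.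
rewrite -[i.+1%:R]natr1 mulrDl mul1r.
by case: xE => ->; case: yE => ->; apply: to_pole_dist; rewrite ?eqxx ?orbT//;
  do ?[exact: h1|exact: h2|exact: ltnW].
Qed.

Lemma to_pole0 i x : to_pole i 0 x = x.
Proof.
rewrite /to_pole /shrinkc /raisec mul0r subr0 [Num.min 1 0]min_r// min_l ?ler1n//.
by rewrite scale1r scale0r addr0.
Qed.

Lemma to_pole_end i x : to_pole i (N + N) x = pole i.
Proof.
have e : (N + N)%:R / N%:R = 2 :> R.
  by rewrite natrD mulrDl divff// pnatr_eq0 -lt0n.
rewrite /to_pole /shrinkc /raisec e subrr [Num.min 1 0]min_r// min_l ?ler1n//.
by rewrite scale0r scale1r add0r.
Qed.

Lemma chain_eval_flatten (T : Type) (a : seq T -> bool) (cs : seq (seq (seq T))) :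
  chain_eval a (flatten cs) = \big[addb/false]_(c <- cs) chain_eval a c.
Proof.
elim: cs => [|c cs IH] /=; first by rewrite /chain_eval !big_nil.
by rewrite chain_eval_cat IH big_cons.
Qed.

Lemma telescope_addb (b : nat -> bool) m :
  \big[addb/false]_(j <- iota 0 m) (b j.+1 (+) b j) = b m (+) b 0%N.
Proof.
rewrite -[m in iota 0 m]subn0 -/(index_iota 0 m); elim: m => [|m IH].
  by rewrite big_geq// addbb.
rewrite big_nat_recr//= IH.
by case: (b m); case: (b m.+1); case: (b 0%N).
Qed.

Lemma with_antipode_eval a c : chain_eval a (with_antipode c) =
  chain_eval a c (+) chain_eval (a \o map -%R) c.
Proof. by rewrite /with_antipode chain_eval_cat chain_eval_map. Qed.

Lemma with_antipode_cycle a c :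
  chain_eval (coboundary a) (with_antipode c) =
  chain_eval (coboundary (fun t => a t (+) a (map -%R t))) c.
Proof.
rewrite with_antipode_eval -chain_eval_addb; apply: eq_chain_eval => s /=.
by rewrite coboundary_addb coboundary_map.
Qed.

(** The boundary of a layer of prisms over a cycle is its top plus its bottom, so the layers
    telescope. At the last step all points sit at the pole and the images of s and of its antipode
    cancel mod 2; at step 0 the map is the identity. *)
Lemma boundary_sweep i a :
  (forall b, chain_eval (coboundary b) (with_antipode (hemisphere i)) = false) ->
  chain_eval (coboundary a) (hemisphere i.+1) =
  chain_eval a (with_antipode (hemisphere i)).
Proof.
move=> cycle; rewrite [hemisphere i.+1]/= chain_eval_flatten big_map.
set z := with_antipode _ in cycle *.
pose b j := chain_eval (a \o map (to_pole i.+1 j)) z.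
have bE j : chain_eval (coboundary a)
    (flatten [seq prism (to_pole i.+1 j) (to_pole i.+1 j.+1) s | s <- z])
    = b j.+1 (+) b j.
  rewrite chain_eval_flatten big_map /b -chain_eval_addb.
  (* Adds the prism over the boundary of z, which is zero because z is a cycle, so that
     [prism_homotopy] applies simplex by simplex. *)
  rewrite -[LHS]addbF -[X in _ (+) X](cycle (fun t =>
    chain_eval a (prism (to_pole i.+1 j) (to_pole i.+1 j.+1) t))).
  rewrite -[X in X (+) _]/(chain_eval (fun s => chain_eval (coboundary a)
    (prism (to_pole i.+1 j) (to_pole i.+1 j.+1) s)) z) -chain_eval_addb.
  by apply: eq_chain_eval => s; exact: prism_homotopy.
under eq_bigr do rewrite bE.
rewrite telescope_addb {bE} /b.
have -> : chain_eval (a \o map (to_pole i.+1 (N + N))) z = false.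
  rewrite /z with_antipode_eval -chain_eval_addb /chain_eval big1// => s _ /=.
  rewrite -map_comp.
  rewrite (eq_map (g := to_pole i.+1 (N + N))) ?addbb// => x /=.
  by rewrite !to_pole_end.
apply: eq_chain_eval => s /=; congr (a _); rewrite -[RHS]map_id.
by apply: eq_map => x; rewrite to_pole0.
Qed.

(** The cycle condition of [boundary_sweep] comes by induction: the boundary of a hemisphere is
    invariant under the antipode, so the antipodal copy cancels it. In dimension 0 two points have
    augmented boundary 1 + 1 = 0. *)
Lemma boundary_hemisphere i a :
  chain_eval (coboundary a) (hemisphere i.+1) =
  chain_eval a (with_antipode (hemisphere i)).
Proof.
elim: i a => [|i IH] a; apply: boundary_sweep => b.
  by rewrite with_antipode_cycle /chain_eval big_seq1 coboundary1 /= addbb.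
rewrite with_antipode_cycle IH with_antipode_eval -chain_eval_addb.
rewrite /chain_eval big1// => s _ /=; rewrite mapK; last exact: opprK.
by rewrite [X in _ (+) X]addbC addbb.
Qed.

Definition odd_on_sphere (o : V -> bool) :=
  forall x, `|x| = 1 -> o (- x) = ~~ o x.

Lemma cup_antipode os s :
  (forall o, List.In o os -> odd_on_sphere o) -> {in s, forall x, `|x| = 1} ->
  cup os (map -%R s) = cup os s.
Proof.
elim: os s => [|o os IH] [|x [|y s]] //= oos s1.
have oo : odd_on_sphere o by apply: oos; left.
rewrite oo; last by apply: s1; rewrite inE eqxx.
rewrite oo; last by apply: s1; rewrite !inE eqxx orbT.
rewrite -(IH (y :: s)) /=; first by case: (o x); case: (o y).
  by move=> o' o'os; apply: oos; right.
by move=> z zs; apply: s1; rewrite inE zs orbT.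
Qed.

(** By Stokes and [coboundary_ocup] the value is that of o times [cup os] on a smaller hemisphere
    plus its antipode. There [cup os] is invariant while o is negated, so exactly one of each pair
    of terms survives and leaves [cup os] on the smaller hemisphere. *)
Lemma cup_hemisphere os : (size os <= n)%N ->
  (forall o, List.In o os -> odd_on_sphere o) ->
  chain_eval (cup os) (hemisphere (size os)) = true.
Proof.
elim: os => [|o os IH] osn oos; first by rewrite /chain_eval big_seq1.
have oos' o' : List.In o' os -> odd_on_sphere o' by move=> ?; apply: oos; right.
rewrite -(IH (ltnW osn) oos') [size _]/=.
pose A (t : seq V) := if t is y :: _ then o y && cup os t else false.
transitivity (chain_eval (coboundary A) (hemisphere (size os).+1)).
  rewrite /chain_eval big_seq [RHS]big_seq; apply: eq_bigr => s /size_hemisphere.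
  by case: s => [//|x s] [ss]; rewrite (coboundary_ocup o x ss).
rewrite boundary_hemisphere with_antipode_eval -chain_eval_addb.
rewrite /chain_eval big_seq [RHS]big_seq; apply: eq_bigr => s si.
have := size_hemisphere si; case: s si => [//|x s] si _.
have [s1 _] := hemisphere_mesh (ltnW osn) si.
have s1' : {in x :: s, forall y, `|y| = 1} by move=> y /s1[].
have /= cupN := cup_antipode oos' s1'.
rewrite /A /= cupN oos ?s1' ?inE ?eqxx//; last by left.
by case: (o x); case: (cup _ _).
Qed.

End Hemispheres.

(** The value of [choose] depends only on the pair x, - x, so it singles out one point of each
    antipodal pair. *)
Lemma odd_selector n : exists o : 'rV[R]_n.+1 -> bool, odd_on_sphere o.
Proof.
pose P (x : 'rV[R]_n.+1) := [pred y | (y == x) || (y == - x)].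
exists (fun x => choose (P x) x == x) => x x1.
have PN : P (- x) =1 P x by move=> y /=; rewrite opprK orbC.
have xx : x != - x.
  apply/eqP => xN; have /eqP : x + x = 0 by rewrite {2}xN subrr.
  rewrite -mulr2n -scaler_nat scaler_eq0 pnatr_eq0 /= => /eqP x0.
  by move: x1; rewrite x0 normr0 => /esym/eqP; rewrite oner_eq0.
rewrite (eq_choose PN) (@choose_id _ (P x) (- x) x) /= ?eqxx ?orbT//.
have := @chooseP _ (P x) x; rewrite /= eqxx => /(_ isT) /orP[/eqP->|/eqP->].
  by rewrite eqxx (negbTE xx).
by rewrite eqxx eq_sym xx.
Qed.

(** If H had no zero, the signs of its coordinates would give k odd functions, whose cup product is
    1 on a hemisphere of dimension k. But on a simplex that is small for the modulus of continuity
    of H some coordinate keeps its sign, so every summand is 0. *)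
Theorem borsuk_ulam (n k : nat) (H : 'rV[R]_n -> 'rV[R]_k) : (k < n)%N ->
  (forall x, `|x| = 1 -> H (- x) = - H x) ->
  (forall x, `|x| = 1 -> forall eps : R, 0 < eps -> exists2 d : R, 0 < d &
     forall y, `|y| = 1 -> `|y - x| < d -> `|H y - H x| < eps) ->
  exists2 x, `|x| = 1 & H x = 0.
Proof.
case: n H => [//|n] H kn Hodd cH; apply: contrapT => noz.
have Hne x : `|x| = 1 -> 0 < `|H x|.
  by move=> x1; rewrite normr_gt0; apply/eqP => Hx; apply: noz; exists x.
pose K := [set x : 'rV[R]_n.+1 | `|x| = 1].
have cK : compact K.
  apply: bounded_closed_compact.
    by exists 1; split => // M M1 x /= ->; exact: ltW.
  rewrite (_ : K = (fun x : 'rV[R]_n.+1 => `|x|) @^-1` [set 1])//.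
  by apply: closed_comp => // x _; exact: norm_continuous.
have [e e0 eH] : exists2 e : R, 0 < e & forall x, `|x| = 1 -> e <= `|H x|.
  have /compact_near_coveringP cK' := cK.
  have {}cK' : \forall e \near 0^'+, K `<=` (fun x => K x -> e <= `|H x|).
    apply: (cK' _ _ (fun e x => K x -> e <= `|H x|)) => x Kx.
    have H20 : 0 < `|H x| / 2 by rewrite divr_gt0// Hne.
    have [d d0 Hd] := cH x Kx _ H20.
    exists (ball x d, [set i | i < `|H x| / 2]) => /=.
      by split; [exact: nbhsx_ballx|exact: nbhs_right_lt].
    move=> [y i] /= [xy iH] Ky.
    move: xy; rewrite -ball_normE /ball_/= distrC => xy.
    have := Hd y Ky xy; have := lerB_normD (H x) (H y - H x).
    rewrite (addrC (H x)) subrK; lra.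
  have : \forall e \near 0^'+, 0 < e /\ K `<=` (fun x => K x -> e <= `|H x|).
    by near=> e; split; near: e => //; exact: nbhs_right_gt.
  by move=> /filter_ex[e [e0 Ke]]; exists e => // x Kx; exact: Ke.
have e20 : 0 < e / 2 by rewrite divr_gt0.
have [d d0 Hd] := compact_uniform_continuity cK cH e20.
have [N N0 Nd] : exists2 N : nat, (0 < N)%N & k%:R / N%:R < d.
  exists (Num.truncn (k%:R / d)).+1 => //.
  rewrite ltr_pdivrMr ?ltr0n// mulrC -ltr_pdivrMr//.
  exact: truncnS_gt.
have [sel selodd] := odd_selector n.
(* Where the coordinate is too small, possibly 0, its sign need not be odd; [sel] keeps [om j] odd
   there. *)
pose om (j : 'I_k) x := if e / 2 <= `|H x 0 j| then 0 < H x 0 j else sel x.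
pose os := [seq om j | j <- enum 'I_k].
have sos : size os = k by rewrite size_map size_enum_ord.
have oos o' : List.In o' os -> odd_on_sphere o'.
  rewrite /os; elim: (enum 'I_k) => [//|j js IH] /= [<-|/IH//] x x1.
  rewrite /om Hodd// mxE normrN; case: ifP => [He|_]; last exact: selodd.
  rewrite oppr_gt0 -leNgt le_eqVlt orbC; case: ltgtP => //= Hx0.
  by move: He; rewrite Hx0 normr0 leNgt e20.
have := @cup_hemisphere n N N0 os; rewrite sos => /(_ kn oos).
rewrite /chain_eval big_seq big1// => s si.
have [s1 sd] := hemisphere_mesh N0 (kn : (k <= n)%N) si.
have ssz := size_hemisphere si.
case: s ssz si s1 sd => [//|x s] _ _ s1 sd.
(* A coordinate of size at least e at one vertex stays of size at least e / 2, with the same sign,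
   at all vertices. *)
have xs : x \in x :: s by rewrite inE eqxx.
have [x1 _] := s1 x xs.
have [j Hj] : exists j, e <= `|H x 0 j|.
  have Hx0 : mx_norm (H x) != 0 by rewrite gt_eqF//; exact: Hne.
  have [[i j] /= ij] := mx_norm_neq0 Hx0; exists j.
  by rewrite -(ord1 i) -ij; exact: eH.
apply: (@cup_const _ os (om j) (0 < H x 0 j) j).
- by rewrite (nth_map j) ?size_enum_ord// nth_ord_enum.
- by rewrite sos.
move=> y ys; have [y1 _] := s1 y ys.
have yx : `|H y - H x| < e / 2.
  by apply: Hd => //; exact: le_lt_trans (sd _ _ ys xs) Nd.
have := mx_norm_coord (H y - H x) j; rewrite !mxE => yxj.
have {yxj yx} := le_lt_trans yxj yx.
rewrite /om; move: (H x 0 j) (H y 0 j) Hj => a b.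
rewrite ler_normr ltr_norml => /orP[aE|aE] /andP[h1 h2].
  rewrite ifT; last by rewrite ler_normr; apply/orP; left; lra.
  have a0 : 0 < a by lra.
  have b0 : 0 < b by lra.
  by rewrite a0 b0.
rewrite ifT; last by rewrite ler_normr; apply/orP; right; lra.
have a0 : a <= 0 by lra.
have b0 : b <= 0 by lra.
by rewrite !ltNge a0 b0.
Unshelve. all: by end_near. Qed.

End BorsukUlam.

(** * Absolutely continuous functions on an interval *)

Section IntervalIntegral.
Context {R : realType}.
Implicit Types (a b c x y : R) (f g h : R -> R).

Local Notation mu := (@lebesgue_measure R).

Definition itg a b f := mu.-integrable `]a, b[ (EFin \o f).
(** Locked to keep unification and simplification from unfolding the Lebesgue integral. *)
Definition II a b f : R := locked (\int[mu]_(x in `]a, b[) f x).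

Lemma IIE a b f : II a b f = \int[mu]_(x in `]a, b[) f x.
Proof. by rewrite /II -lock. Qed.

Lemma itg_meas a b f : itg a b f -> measurable_fun `]a, b[ f.
Proof. by move=> /(measurable_int mu)/measurable_EFinP. Qed.

Lemma itg_sub a b c d f : a <= c -> d <= b -> itg a b f -> itg c d f.
Proof.
move=> ac db; apply: integrableS => // x /=; rewrite !in_itv /= => /andP[cx xd].
by rewrite (le_lt_trans ac cx) (lt_le_trans xd db).
Qed.

Lemma eq_itg a b f g : (forall x, a < x < b -> f x = g x) -> itg a b f -> itg a b g.
Proof.
move=> fg; apply: eq_integrable => // x; rewrite inE /= in_itv /= => xab.
by rewrite fg.
Qed.

Lemma eq_II a b f g : (forall x, a < x < b -> f x = g x) -> II a b f = II a b g.
Proof.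
by move=> fg; rewrite !IIE; apply: eq_Rintegral => x; rewrite inE /= in_itv /= => /fg.
Qed.

Lemma itg_le a b f g : measurable_fun `]a, b[ f ->
  (forall x, a < x < b -> `|f x| <= g x) -> itg a b g -> itg a b f.
Proof.
move=> mf fg ig; apply: le_integrable ig => //.
  exact/measurable_EFinP.
move=> x /=; rewrite in_itv /= => /fg h; rewrite lee_fin.
exact: le_trans h (ler_norm _).
Qed.

Lemma itgD a b f g : itg a b f -> itg a b g -> itg a b (fun x => f x + g x).
Proof. by move=> fi gi; have := integrableD _ fi gi; apply. Qed.

Lemma itgN a b f : itg a b f -> itg a b (fun x => - f x).
Proof. by move=> fi; exact: (integrableN fi). Qed.

Lemma itgB a b f g : itg a b f -> itg a b g -> itg a b (fun x => f x - g x).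
Proof. by move=> fi gi; apply: itgD => //; exact: itgN. Qed.

Lemma itgZ a b k f : itg a b f -> itg a b (fun x => k * f x).
Proof. by move=> fi; have := integrableZl _ k fi; apply. Qed.

Lemma itg_norm a b f : itg a b f -> itg a b (fun x => `|f x|).
Proof. by move=> fi; exact: integrable_norm. Qed.

Lemma itg_cst a b k : itg a b (fun=> k).
Proof.
apply: measurable_bounded_integrable => //.
  by rewrite /= lebesgue_measure_itv /=; case: ifP => _; rewrite ?ltry//.
by exists `|k|; split => // M kM x _ /=; exact: ltW.
Qed.

Lemma itgM a b f h M : measurable_fun `]a, b[ h ->
  (forall x, a < x < b -> `|h x| <= M) -> itg a b f -> itg a b (fun x => h x * f x).
Proof.
move=> mh hM fi; apply: (itg_le (g := fun x => M * `|f x|)).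
- by apply: measurable_funM => //; exact: itg_meas.
- by move=> x xab; rewrite normrM ler_wpM2r// hM.
- by apply: itgZ; exact: itg_norm.
Qed.

Lemma IID a b f g : itg a b f -> itg a b g ->
  II a b (fun x => f x + g x) = II a b f + II a b g.
Proof. by move=> fi gi; rewrite !IIE RintegralD. Qed.

Lemma IIB a b f g : itg a b f -> itg a b g ->
  II a b (fun x => f x - g x) = II a b f - II a b g.
Proof. by move=> fi gi; rewrite !IIE RintegralB. Qed.

Lemma IIZ a b k f : itg a b f -> II a b (fun x => k * f x) = k * II a b f.
Proof. by move=> fi; rewrite !IIE RintegralZl. Qed.

Lemma IIN a b f : itg a b f -> II a b (fun x => - f x) = - II a b f.
Proof.
by move=> fi; rewrite -mulN1r -IIZ//; apply: eq_II => x _; rewrite mulN1r.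
Qed.

Lemma II_le a b f g : itg a b f -> itg a b g ->
  (forall x, a < x < b -> f x <= g x) -> II a b f <= II a b g.
Proof.
by move=> fi gi fg; rewrite !IIE; apply: le_Rintegral => // x /=; rewrite in_itv /= => /fg.
Qed.

Lemma II_ge0 a b f : (forall x, a < x < b -> 0 <= f x) -> 0 <= II a b f.
Proof. by move=> f0; rewrite IIE; apply: Rintegral_ge0 => x /=; rewrite in_itv /= => /f0. Qed.

Lemma II_norm a b f : itg a b f -> `|II a b f| <= II a b (fun x => `|f x|).
Proof. by move=> fi; rewrite !IIE; exact: le_normr_Rintegral. Qed.

Lemma II_cst a b k : a <= b -> II a b (fun=> k) = k * (b - a).
Proof.
move=> ab; rewrite !IIE Rintegral_cst//= lebesgue_measure_itv /=.
case: ltP => [_|]; first by [].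
by rewrite lee_fin => ba; rewrite [in RHS](_ : b = a) ?subrr// ; apply/eqP; rewrite eq_le ba ab.
Qed.

Lemma II_geq a b f : b <= a -> II a b f = 0.
Proof. by move=> ba; rewrite !IIE set_itv_ge ?Rintegral_set0//= bnd_simp -leNgt. Qed.

Lemma II_split a b c f : a <= b -> b <= c -> itg a c f ->
  II a c f = II a b f + II b c f.
Proof.
move=> ab bc fi.
move: ab; rewrite le_eqVlt => /predU1P[<-|ab]; first by rewrite [X in X + _]II_geq ?add0r.
move: bc fi; rewrite le_eqVlt => /predU1P[<-|bc] fi; first by rewrite [X in _ + X]II_geq ?addr0.
have := @Rintegral_itvB _ f (BRight a) (BLeft c) b fi.
rewrite !bnd_simp => /(_ (ltW ab)).
rewrite !IIE => /(_ bc) <-; rewrite -Rintegral_itv_bndo_bndc; last first.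
  by apply: itg_sub fi => //; exact: ltW.
by rewrite addrC subrK.
Qed.

Lemma itg_cat a b c f : a <= b -> b <= c -> itg a b f -> itg b c f -> itg a c f.
Proof.
move=> ab bc fab fbc.
have [->|ab'] := eqVneq a b; first by [].
have [<-|bc'] := eqVneq b c; first by [].
have {}ab : a < b by rewrite lt_neqAle ab' ab.
have {}bc : b < c by rewrite lt_neqAle bc' bc.
have mab := itg_meas fab; have mbc := itg_meas fbc.
have mab' : measurable_fun `]a, b] f by apply/measurable_fun_itv_bndo_bndcP.
have E : `]a, c[%classic = `]a, b] `|` `]b, c[ :> set R.
  apply/seteqP; split=> x /=; rewrite !in_itv /=; have := ltP b x; case=> bx.
  - by move=> /andP[_ ->]; right.
  - by move=> /andP[-> _]; left.
  - by move=> [/andP[_ //]|/andP[_ ->]]; rewrite (lt_trans ab bx).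
  - by move=> [/andP[-> _]|//]; rewrite (le_lt_trans bx bc).
have mac : measurable_fun `]a, c[ f by rewrite E; apply/measurable_funU => //; split.
apply/integrableP; split; first exact/measurable_EFinP.
rewrite E ge0_integral_setU//=.
- rewrite lte_add_pinfty//; last by case/integrableP : fbc.
  rewrite -integral_itv_bndo_bndc; first by case/integrableP : fab.
  by apply/measurable_EFinP; exact: measurableT_comp.
- by rewrite -E; apply/measurable_EFinP; exact: measurableT_comp.
- by apply: lt_disjoint => x y; rewrite !in_itv /= => /andP[_ xb] /andP[/(le_lt_trans xb)].
Qed.

(** Lebesgue's differentiation theorem: the extension of f by zero has a vanishing primitive, whose
    derivative is that extension almost everywhere. *)
Lemma II_ae0 a b f : itg a b f -> (forall x y, a <= x -> x <= y -> y <= b -> II x y f = 0) ->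
  {ae mu, forall x, a < x < b -> f x = 0}.
Proof.
move=> fi f0; pose F := f \_ `]a, b[.
have iF : mu.-integrable setT (EFin \o F).
  by move: fi; rewrite /itg integrable_mkcond// restrict_EFin.
have /FTC1Ny : forall y, mu.-integrable `]-oo, y] (EFin \o F).
  by move=> y; apply: integrableS iF.
have locF : locally_integrable [set: R] F by apply: open_integrable_locally; [exact: openT|].
move=> /(_ locF).
have G0 : (fun x => \int[mu]_(t in `]-oo, x]) F t) = cst 0.
  apply/funext => x; rewrite /F /=.
  rewrite -Rintegral_mkcondr.
  have [xa|ax] := leP x a.
    rewrite (_ : _ `&` _ = set0) ?Rintegral_set0// -subset0 => y /=.
    by rewrite !in_itv /= => -[yx /andP[ay _]]; have := lt_le_trans ay yx; rewrite ltNge xa.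
  have [bx|xb] := leP b x.
    rewrite (_ : _ `&` _ = `]a, b[%classic); first rewrite -IIE.
      have [ab|ba] := leP a b; first exact: f0.
      by apply: II_geq; exact: ltW.
    apply/seteqP; split => y /=; rewrite !in_itv /=; first by case.
    by move=> yab; split => //; case/andP: yab => _ /ltW/le_trans; apply.
  rewrite (_ : _ `&` _ = `]a, x]%classic).
    rewrite -Rintegral_itv_bndo_bndc; first by rewrite -IIE; apply: f0 => //; exact: ltW.
    by apply: itg_sub fi => //; exact: ltW.
  apply/seteqP; split => y /=; rewrite !in_itv /=; first by move=> [-> /andP[->]].
  by move=> /andP[-> yx]; rewrite yx (le_lt_trans yx xb).
rewrite G0; apply: (@filterS _ _ (ae_filter_ringOfSetsType mu)) => x [_]; rewrite derive1_cst => F0 xab.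
by move: F0 => /esym; rewrite /F patchE mem_set//= in_itv.
Qed.

Lemma II_ae a b f g : measurable_fun `]a, b[ f -> measurable_fun `]a, b[ g ->
  {ae mu, forall x, a < x < b -> f x = g x} -> II a b f = II a b g.
Proof.
move=> mf mg fg; rewrite !IIE /Rintegral; congr fine; apply: ae_eq_integral => //.
- exact/measurable_EFinP.
- exact/measurable_EFinP.
by apply: (@filterS _ _ (ae_filter_ringOfSetsType mu)) fg => x fg; rewrite /= in_itv /= => /fg ->.
Qed.

Lemma ae_II0 a b f : itg a b f -> (forall x, a < x < b -> 0 <= f x) ->
  II a b f <= 0 -> {ae mu, forall x, a < x < b -> f x = 0}.
Proof.
move=> fi f0 If; apply: II_ae0 => // x y ax xy yb.
have fx : itg a x f by apply: itg_sub fi; rewrite ?(le_trans xy).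
have fy : itg x b f by apply: itg_sub fi.
have h1 : 0 <= II a x f.
  by apply: II_ge0 => z /andP[az zx]; rewrite f0// az (lt_le_trans zx)// (le_trans xy).
have h2 : 0 <= II x y f.
  by apply: II_ge0 => z /andP[xz zy]; rewrite f0// (le_lt_trans ax xz) (lt_le_trans zy yb).
have h3 : 0 <= II y b f.
  by apply: II_ge0 => z /andP[yz zb]; rewrite f0// zb andbT (le_lt_trans _ yz)// (le_trans ax).
have := II_split ax (le_trans xy yb) fi; have := II_split xy yb fy; lra.
Qed.


(** The bound on short steps adds up to the same bound on [a, b], where eps is arbitrary. Through
    [AC_local] it gives the product and chain rules without differentiating almost everywhere. *)
Lemma vanishing_increments a b (D G : R -> R) : a <= b ->
  (forall eps : R, 0 < eps -> exists2 d : R, 0 < d &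
     forall x y, a <= x -> x <= y -> y <= b -> y - x < d ->
       `|D y - D x| <= eps * (G y - G x)) ->
  D b = D a.
Proof.
move=> ab h.
have key eps : 0 < eps -> `|D b - D a| <= eps * (G b - G a).
  move=> e0; have [d d0 hd] := h _ e0.
  have d20 : 0 < d / 2 by rewrite divr_gt0.
  suff H (k : nat) y : a <= y -> y <= b -> y - a <= k%:R * (d / 2) ->
      `|D y - D a| <= eps * (G y - G a).
    apply: (H (Num.truncn ((b - a) / (d / 2))).+1) => //.
    by rewrite -ler_pdivrMr// ltW// truncnS_gt.
  elim: k y => [|k IH] y ay yb.
    rewrite mul0r => yle0; have -> : y = a by lra.
    by rewrite !subrr normr0 mulr0.
  rewrite -[k.+1%:R]natr1 mulrDl mul1r => yk.
  have [ya|ya] := leP (y - d / 2) a; first by apply: hd => //; lra.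
  have h1 : `|D (y - d / 2) - D a| <= eps * (G (y - d / 2) - G a) by apply: IH; lra.
  have h2 : `|D y - D (y - d / 2)| <= eps * (G y - G (y - d / 2)) by apply: hd; lra.
  rewrite (_ : D y - D a = (D y - D (y - d / 2)) + (D (y - d / 2) - D a)); last lra.
  apply: (le_trans (ler_normD _ _)); apply: (le_trans (lerD h2 h1)); lra.
apply/eqP; rewrite -subr_eq0 -normr_le0 leNgt; apply/negP => D0.
have G0 : 0 < G b - G a.
  by have := key 1 ltr01; rewrite mul1r; exact: lt_le_trans.
(* For this eps the bound is half of [|D b - D a|]. *)
have := key (`|D b - D a| / (G b - G a) / 2).
rewrite !divr_gt0// => /(_ isT).
rewrite mulrAC divfK ?gt_eqF//; lra.
Qed.

End IntervalIntegral.

Section AbsolutelyContinuous.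
Context {R : realType}.
Implicit Types (a b c x y : R) (f g h : R -> R).
Local Notation mu := (@lebesgue_measure R).

Lemma itg_closed a b f : itg a b f -> mu.-integrable `[a, b] (EFin \o f).
Proof.
move=> fi; have mf := itg_meas fi.
have mf1 : measurable_fun `]a, b] f by apply/measurable_fun_itv_bndo_bndcP.
have mf2 : measurable_fun `[a, b] f by apply/measurable_fun_itv_obnd_cbndP.
apply/integrableP; split; first exact/measurable_EFinP.
rewrite -integral_itv_obnd_cbnd; last first.
  by apply: measurableT_comp => //; exact/measurable_EFinP.
rewrite -integral_itv_bndo_bndc; first by case/integrableP : fi.
by apply: measurableT_comp => //; exact/measurable_EFinP.
Qed.

Definition cts a b f := {within `[a, b], continuous f}.

Lemma ctsP a b f : cts a b f <->
  (forall x, a <= x <= b -> forall eps, 0 < eps -> exists2 d : R, 0 < d &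
     forall y, a <= y <= b -> `|y - x| < d -> `|f y - f x| < eps).
Proof.
split=> [/subspace_continuousP cf x xab eps e0|H].
  have : (`[a, b]%classic : set R) x by rewrite /= in_itv.
  move=> /cf /cvgrPdist_lt /(_ _ e0); rewrite /within /= => /nbhs_ballP[d d0 dH].
  exists d => // y yab yx; rewrite distrC; apply: dH; last by rewrite in_itv.
  by rewrite -ball_normE /ball_ /= distrC.
apply/subspace_continuousP => x; rewrite /= in_itv /= => xab.
apply/cvgrPdist_lt => eps e0; have [d d0 dH] := H x xab eps e0.
apply/nbhs_ballP; exists d => // y; rewrite -ball_normE /ball_ /= in_itv /= => xy yab.
by rewrite distrC dH// distrC.
Qed.

Lemma cts_sub a b c d f : a <= c -> d <= b -> cts a b f -> cts c d f.
Proof.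
move=> ac db /ctsP H; apply/ctsP => x /andP[cx xd] eps e0.
have [|dl dl0 dH] := H x _ eps e0; first by rewrite (le_trans ac)// (le_trans xd).
by exists dl => // y /andP[cy yd]; apply: dH; rewrite (le_trans ac)// (le_trans yd).
Qed.

Lemma cts_uniform a b f eps : cts a b f -> 0 < eps -> exists2 d : R, 0 < d &
  forall x y, a <= x <= b -> a <= y <= b -> `|y - x| < d -> `|f y - f x| < eps.
Proof.
move=> /ctsP H e0.
have H' x : `[a, b]%classic x -> forall eps, 0 < eps -> exists2 d : R, 0 < d &
     forall y, `[a, b]%classic y -> `|y - x| < d -> `|f y - f x| < eps.
  rewrite /= in_itv /= => xab e e00; have [d d0 dH] := H x xab e e00.
  by exists d => // y; rewrite /= in_itv /=; exact: dH.
have [d d0 dH] := compact_uniform_continuity (@segment_compact _ a b) H' e0.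
by exists d => // x y xab yab; apply: dH; rewrite /= in_itv.
Qed.

Lemma cts_bounded a b f : cts a b f -> exists2 M : R, 0 <= M &
  forall x, a <= x <= b -> `|f x| <= M.
Proof.
move=> cf; have [ab|ba] := leP a b; last first.
  by exists 0 => // x /andP[ax xb]; have := le_trans ax xb; rewrite leNgt ba.
have := EVT_max ab (f := fun x => `|f x|) _; case.
  apply/ctsP => x xab e e0; have /ctsP/(_ x xab e e0)[d d0 dH] := cf.
  exists d => // y yab yx; apply: le_lt_trans (dH y yab yx).
  exact: ler_dist_dist.
move=> c _ cM; exists `|f c| => // x xab; apply: cM; by rewrite in_itv.
Qed.

Lemma cts_measurable a b f : cts a b f -> measurable_fun `]a, b[ f.
Proof.
move=> cf; apply: (@measurable_funS _ _ _ _ `[a, b]) => //.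
  by move=> x /=; rewrite !in_itv /= => /andP[/ltW-> /ltW->].
exact: subspace_continuous_measurable_fun.
Qed.

Lemma itgM_cts a b f h : cts a b h -> itg a b f -> itg a b (fun x => h x * f x).
Proof.
move=> ch fi; have [M M0 hM] := cts_bounded ch.
apply: (itgM (M := M)) => //; first exact: cts_measurable.
by move=> x /andP[ax xb]; apply: hM; rewrite !ltW.
Qed.

Lemma itg_cts a b f : cts a b f -> itg a b f.
Proof.
move=> cf; have := itgM_cts cf (itg_cst a b 1); apply: eq_itg => x _.
by rewrite mulr1.
Qed.

(** Absolute continuity in integrated form; g is determined only almost everywhere. *)
Definition AC a b f g := itg a b g /\
  forall x y, a <= x -> x <= y -> y <= b -> f y - f x = II x y g.

Lemma AC_sub a b c d f g : a <= c -> d <= b -> AC a b f g -> AC c d f g.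
Proof.
move=> ac db [gi fg]; split; first exact: itg_sub gi.
by move=> x y cx xy yd; apply: fg => //; [exact: le_trans ac cx|exact: le_trans yd db].
Qed.

Lemma AC_cts a b f g : AC a b f g -> cts a b f.
Proof.
move=> [gi fg].
have [ab|ba] := leP a b; last first.
  apply/ctsP => x /andP[ax xb]; have := le_trans ax xb; by rewrite leNgt ba.
have /ctsP H := parameterized_integral_continuous ab (itg_closed gi).
apply/ctsP => x xab e e0; have [d d0 dH] := H x xab e e0.
exists d => // y yab yx; have := dH y yab yx; rewrite /parameterized_integral /=.
have E z : a <= z <= b -> \int[mu]_(t in `[a, z]) g t = f z - f a.
  move=> /andP[az zb]; rewrite fg// IIE Rintegral_itv_bndo_bndc; last first.
    exact: itg_sub gi.
  rewrite Rintegral_itv_obnd_cbnd//; apply: integrableS (itg_closed gi) => // t /=.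
  by rewrite !in_itv /= => /andP[/ltW-> tz]; exact: le_trans tz zb.
by rewrite !E//; rewrite (_ : _ - _ - (_ - _) = f y - f x)//; ring.
Qed.

(** The error f minus the integral of g is additive over subintervals, so [vanishing_increments]
    applies to it. *)
Lemma AC_local a b f g G : itg a b g ->
  (forall eps : R, 0 < eps -> exists2 d : R, 0 < d &
     forall x y, a <= x -> x <= y -> y <= b -> y - x < d ->
       `|f y - f x - II x y g| <= eps * II x y G) ->
  itg a b G -> AC a b f g.
Proof.
move=> gi H Gi; split => // x y ax xy yb.
pose D z := f z - II x z g.
suff : D y = D x by rewrite /D (II_geq g (lexx x)); lra.
apply: (@vanishing_increments _ _ _ _ (fun z => II x z G)) => // e e0.
have [d d0 dH] := H e e0; exists d => // z t xz zt ty tz.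
have := dH z t (le_trans ax xz) zt (le_trans ty yb) tz.
rewrite /D (II_split xz zt) ?(II_split (f := G) xz zt).
- by rewrite [X in `|X| <= _ -> _](_ : _ = f t - (II x z g + II z t g) - (f z - II x z g)); [rewrite [in X in _ <= X -> _](_ : II z t G = II x z G + II z t G - II x z G)//; ring|ring].
- by apply: itg_sub Gi => //; exact: le_trans yb.
- by apply: itg_sub gi => //; exact: le_trans yb.
Qed.

Lemma II_mul_le a b h g eps : itg a b (fun x => h x * g x) -> itg a b g ->
  (forall x, a < x < b -> `|h x| <= eps) ->
  `|II a b (fun x => h x * g x)| <= eps * II a b (fun x => `|g x|).
Proof.
move=> hgi gi hM; apply: (le_trans (II_norm hgi)).
rewrite -IIZ; last exact: itg_norm.
apply: II_le; first exact: itg_norm.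
  by apply: itgZ; exact: itg_norm.
by move=> x xab; rewrite normrM ler_wpM2r// hM.
Qed.

Lemma itg_mulr a b g k : itg a b g -> itg a b (fun x => g x * k).
Proof. by move=> /(itgZ k); apply: eq_itg => x _; rewrite mulrC. Qed.

Lemma AC_mul a b f1 g1 f2 g2 : AC a b f1 g1 -> AC a b f2 g2 ->
  AC a b (fun x => f1 x * f2 x) (fun x => f1 x * g2 x + f2 x * g1 x).
Proof.
move=> A1 A2; have c1 := AC_cts A1; have c2 := AC_cts A2.
have [i1 d1] := A1; have [i2 d2] := A2.
have i12 : itg a b (fun x => f1 x * g2 x) by exact: itgM_cts.
have i21 : itg a b (fun x => f2 x * g1 x) by exact: itgM_cts.
apply: (@AC_local _ _ _ _ (fun x => `|g1 x| + `|g2 x|)).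
- exact: itgD.
- move=> e e0.
  have [e1 e10 H1] := cts_uniform c1 e0.
  have [e2 e20 H2] := cts_uniform c2 e0.
  exists (Num.min e1 e2); first by rewrite lt_min e10.
  move=> x y ax xy yb; rewrite lt_min => /andP[yx1 yx2].
  have sub f : itg a b f -> itg x y f by apply: itg_sub.
  have xab : a <= x <= b by rewrite ax (le_trans xy).
  have yab : a <= y <= b by rewrite yb (le_trans ax).
  have h1 : `|II x y (fun t => (f1 y - f1 t) * g2 t)| <= e * II x y (fun t => `|g2 t|).
    apply: II_mul_le; [|exact: sub|].
      apply: (eq_itg (f := fun t => f1 y * g2 t - f1 t * g2 t)).
        by move=> t _; rewrite mulrBl.
      by apply: sub; apply: itgB => //; exact: itgZ.
    move=> t /andP[xt ty]; apply: ltW; apply: H1 => //.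
      by rewrite (le_trans ax (ltW xt)) (le_trans (ltW ty) yb).
    by apply: le_lt_trans yx1; rewrite ger0_norm; lra.
  have h2 : `|II x y (fun t => (f2 x - f2 t) * g1 t)| <= e * II x y (fun t => `|g1 t|).
    apply: II_mul_le; [|exact: sub|].
      apply: (eq_itg (f := fun t => f2 x * g1 t - f2 t * g1 t)).
        by move=> t _; rewrite mulrBl.
      by apply: sub; apply: itgB => //; exact: itgZ.
    move=> t /andP[xt ty]; apply: ltW; apply: H2 => //.
      by rewrite (le_trans ax (ltW xt)) (le_trans (ltW ty) yb).
    by apply: le_lt_trans yx2; rewrite distrC ger0_norm; lra.
  rewrite [X in e * X]IID; [|exact/itg_norm/sub|exact/itg_norm/sub].
  rewrite mulrDr [X in _ <= X]addrC; apply: (le_trans _ (lerD h1 h2)).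
  apply: (le_trans _ (ler_normD _ _)).
  rewrite le_eqVlt; apply/orP; left; apply/eqP; congr `|_|.
  rewrite IID; [|exact: sub|exact: sub].
  have -> : II x y (fun t => (f1 y - f1 t) * g2 t) = f1 y * II x y g2 - II x y (fun t => f1 t * g2 t).
    rewrite -IIZ -?IIB; [|exact/itgZ/sub|exact: sub|exact: sub].
    by apply: eq_II => t _; rewrite mulrBl.
  have -> : II x y (fun t => (f2 x - f2 t) * g1 t) = f2 x * II x y g1 - II x y (fun t => f2 t * g1 t).
    rewrite -IIZ -?IIB; [|exact/itgZ/sub|exact: sub|exact: sub].
    by apply: eq_II => t _; rewrite mulrBl.
  rewrite -d1// -d2//; ring.
- by apply: itgD; exact: itg_norm.
Qed.

Lemma cts_itv_image a b f x y : cts a b f -> a <= x -> x <= y -> y <= b ->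
  forall v, Num.min (f x) (f y) <= v <= Num.max (f x) (f y) ->
  exists2 z, x <= z <= y & f z = v.
Proof.
move=> cf ax xy yb v vxy; have cf' : cts x y f by apply: cts_sub cf.
have [z] := IVT xy cf' vxy; rewrite in_itv /= => zxy fz; by exists z.
Qed.

(* By the mean value theorem the increment of [F \o f] on a short interval is
   [F' (f xi)] times that of [f], and [F' \o f] is nearly constant there. *)
Lemma AC_comp a b f g (F F' : R -> R) c d : AC a b f g ->
  (forall x, a <= x <= b -> c < f x < d) ->
  (forall t, c < t < d -> is_derive t 1 F (F' t)) ->
  (forall t, c < t < d -> {for t, continuous F'}) ->
  AC a b (fun x => F (f x)) (fun x => F' (f x) * g x).
Proof.
move=> A fcd dF cF; have cf := AC_cts A; have [gi fg] := A.
have cF'f : cts a b (fun x => F' (f x)).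
  apply/ctsP => x xab e e0.
  have /cvgrPdist_lt/(_ _ e0) := cF _ (fcd x xab); rewrite nearE => /nbhs_ballP[d1 d10 H1].
  have /ctsP/(_ x xab d1 d10)[d2 d20 H2] := cf.
  exists d2 => // y yab yx; rewrite distrC; apply: H1.
  by rewrite -ball_normE /ball_ /= distrC; exact: H2.
have i1 : itg a b (fun x => F' (f x) * g x) by exact: itgM_cts.
apply: (@AC_local _ _ _ _ (fun x => `|g x|)) => //; last exact: itg_norm.
move=> e e0; have [dl dl0 H] := cts_uniform cF'f e0.
exists dl => // x y ax xy yb yx.
have sub h : itg a b h -> itg x y h by apply: itg_sub.
have xab : a <= x <= b by rewrite ax (le_trans xy).
have yab : a <= y <= b by rewrite yb (le_trans ax).
have [z zxy zE] : exists2 z, x <= z <= y & F (f y) - F (f x) = F' (f z) * (f y - f x).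
  have mvt u v : u < v -> c < u -> v < d -> exists2 w, u <= w <= v & F v - F u = F' w * (v - u).
    move=> uv cu vd.
    have [||w] := @MVT R F F' u v uv.
    - move=> w; rewrite in_itv /= => /andP[uw wv].
      by apply: dF; rewrite (lt_trans cu uw) (lt_trans wv).
    - apply/subspace_continuousP => w'; rewrite /= in_itv /= => /andP[uw wv].
      apply: cvg_within_filter.
      have /dF[dw _] : c < w' < d by rewrite (lt_le_trans cu uw) (le_lt_trans wv).
      by apply: differentiable_continuous; apply/derivable1_diffP.
    - rewrite in_itv /= => /andP[uw wv] wE; exists w => //.
      by rewrite (ltW uw) (ltW wv).
  have /andP[cx xd] := fcd x xab; have /andP[cy yd] := fcd y yab.
  have [fxy|fyx|fxy] := ltgtP (f x) (f y).
  - have [w wxy wE] := mvt _ _ fxy cx yd.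
    have [|z zxy fz] := cts_itv_image cf ax xy yb (v := w).
      by rewrite min_l ?max_r// ltW.
    by exists z => //; rewrite fz.
  - have [w wxy wE] := mvt _ _ fyx cy xd.
    have [|z zxy fz] := cts_itv_image cf ax xy yb (v := w).
      by rewrite min_r ?max_l// ltW.
    by exists z => //; rewrite fz -[LHS]opprB wE; ring.
  - by exists x; rewrite ?lexx// fxy !subrr mulr0.
rewrite zE fg// -IIZ -?IIB; [|exact/itgZ/sub|exact: sub|exact: sub].
rewrite (@eq_II _ _ _ _ (fun t => (F' (f z) - F' (f t)) * g t)); last first.
  by move=> t _; rewrite mulrBl.
apply: II_mul_le; [|exact: sub|].
  apply: (eq_itg (f := fun t => F' (f z) * g t - F' (f t) * g t)).
    by move=> t _; rewrite mulrBl.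
  by apply: sub; apply: itgB => //; exact: itgZ.
move/andP : zxy => [xz zy] t /andP[xt ty]; apply: ltW; apply: H.
- by rewrite (le_trans ax (ltW xt)) (le_trans (ltW ty) yb).
- by rewrite (le_trans ax xz) (le_trans zy yb).
- rewrite ltr_norml; lra.
Qed.

Lemma eq_AC a b f g f' g' : (forall x, a <= x <= b -> f x = f' x) ->
  (forall x, a < x < b -> g x = g' x) -> AC a b f g -> AC a b f' g'.
Proof.
move=> ff gg [gi fg]; split; first exact: eq_itg gi.
move=> x y ax xy yb.
rewrite -(ff x) ?ax ?(le_trans xy)// -(ff y) ?yb ?(le_trans ax)//.
rewrite fg//; apply: eq_II => t /andP[xt ty]; apply: gg.
by rewrite (le_lt_trans ax xt) (lt_le_trans ty yb).
Qed.

Lemma AC_cat a b c f g : a <= b -> b <= c -> AC a b f g -> AC b c f g -> AC a c f g.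
Proof.
move=> ab bc A1 A2; have [g1 f1] := A1; have [g2 f2] := A2.
have gi := itg_cat ab bc g1 g2; split => // x y ax xy yc.
have [yb|/ltW by_] := leP y b; first exact: f1.
have [bx|/ltW xb] := leP b x; first exact: f2.
rewrite (II_split xb by_); last exact: itg_sub gi.
rewrite -f1// -f2//; ring.
Qed.

Lemma AC_lin a b k f1 g1 f2 g2 : AC a b f1 g1 -> AC a b f2 g2 ->
  AC a b (fun x => k * f1 x + f2 x) (fun x => k * g1 x + g2 x).
Proof.
move=> [i1 d1] [i2 d2]; split=> [|x y ax xy yb]; first by apply: itgD => //; exact: itgZ.
have j1 : itg x y g1 by exact: itg_sub i1.
have j2 : itg x y g2 by exact: itg_sub i2.
rewrite IID//; last exact: itgZ.
rewrite IIZ// -d1// -d2//; ring.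
Qed.

Lemma AC_affine a b k m : AC a b (fun x => k * x + m) (fun=> k).
Proof.
split=> [|x y ax xy yb]; first exact: itg_cst.
rewrite II_cst//; ring.
Qed.

Lemma AC_FTC a b f g : (forall x, is_derive x 1 f (g x)) -> continuous g ->
  AC a b f g.
Proof.
move=> df cg; have [ab|ba] := leP a b; last first.
  split; first by rewrite /itg set_itv_ge ?integrable_set0//= bnd_simp -leNgt ltW.
  by move=> x y ax xy yb; have := le_trans ax (le_trans xy yb); rewrite leNgt ba.
have := @AC_comp a b (fun x => 1 * x + 0) (fun=> 1) f g (a - 1) (b + 1) (AC_affine _ _ _ _).
move=> /(_ _ _ _)/wrap[].
- by move=> x /andP[ax xb]; lra.
- by move=> t _; exact: cg.
by apply: eq_AC => x _; rewrite ?mul1r ?addr0 ?mulr1.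
Qed.

End AbsolutelyContinuous.

(** * L^p functions and Sobolev functions on an interval *)

Section PowerIntegrability.
Context {R : realType} (p : R).
Hypothesis p1 : 1 < p.
Implicit Types (a b c x y : R) (f g h : R -> R).
Local Notation mu := (@lebesgue_measure R).

Let p0 : 0 < p. Proof. by apply: lt_trans p1. Qed.

(** The nonlinearity of the p-Laplacian, and up to the factor p the derivative of |x|^p. *)
Definition flux x : R := `|x| `^ (p - 2) * x.

Lemma flux0 : flux 0 = 0.
Proof. exact: mulr0. Qed.

Lemma flux_ge0 x : 0 <= x -> 0 <= flux x.
Proof. by move=> x0; rewrite mulr_ge0 ?powR_ge0. Qed.

Lemma norm_flux x : `|flux x| = `|x| `^ (p - 1).
Proof.
rewrite /flux normrM (ger0_norm (powR_ge0 _ _)).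
have [->|x0] := eqVneq x 0; first by rewrite normr0 mulr0 powR0// subr_eq0 gt_eqF.
rewrite -[X in _ * X]powRr1// -powRD ?normr_eq0 ?x0 ?implybT//.
by congr (_ `^ _); lra.
Qed.

Lemma fluxN x : flux (- x) = - flux x.
Proof. by rewrite /flux normrN mulrN. Qed.

Lemma flux_mul x : flux x * x = `|x| `^ p.
Proof.
rewrite /flux -mulrA -expr2 -real_normK ?num_real// expr2.
have [->|x0] := eqVneq x 0; first by rewrite normr0 !mulr0 powR0// gt_eqF.
rewrite -[X in _ * (X * X)]powRr1// -!powRD ?normr_eq0 ?x0 ?implybT//.
by congr (_ `^ _); lra.
Qed.

Lemma flux_gt0 x : 0 < x -> flux x = x `^ (p - 1).
Proof.
move=> x0; rewrite -(gtr0_norm (_ : 0 < flux x)) ?norm_flux ?gtr0_norm//.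
by rewrite /flux mulr_gt0// powR_gt0// normr_gt0 gt_eqF.
Qed.

Lemma measurable_flux : measurable_fun [set: R] flux.
Proof.
apply: measurable_funM => //.
by apply: (measurableT_comp (measurable_powR _)).
Qed.

Lemma ler_powp x y : 0 <= x -> x <= y -> x `^ p <= y `^ p.
Proof.
move=> x0 xy; apply: ge0_ler_powR; rewrite ?nnegrE//; first exact: ltW.
exact: le_trans xy.
Qed.

Lemma le_powR_split x : 0 <= x -> x <= 1 + x `^ p.
Proof.
move=> x0; have [x1|/ltW x1] := leP x 1.
  by have := powR_ge0 x p; lra.
by have := le1r_powR x1 (ltW p1); lra.
Qed.

Lemma powRD_le x y : 0 <= x -> 0 <= y -> (x + y) `^ p <= 2 `^ p * (x `^ p + y `^ p).
Proof.
move=> x0 y0; wlog xy : x y x0 y0 / x <= y.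
  by move=> H; have [/H->//|/ltW/H] := leP x y; rewrite addrC [X in _ * X]addrC; apply.
apply: (@le_trans _ _ ((2 * y) `^ p)).
  by apply: ler_powp; [exact: addr_ge0|lra].
by rewrite powRM// ler_wpM2l ?powR_ge0// lerDr powR_ge0.
Qed.

(** The larger of |x| and |y| dominates both factors; the crude constant suffices for
    integrability. *)
Lemma young_flux x y : `|x| `^ (p - 1) * `|y| <= `|x| `^ p + `|y| `^ p.
Proof.
have [xy|/ltW yx] := leP `|x| `|y|.
  apply: (@le_trans _ _ (`|y| `^ p)); last by rewrite lerDr powR_ge0.
  rewrite -[leRHS]mulr_powRB1// mulrC ler_wpM2l//.
  by apply: ge0_ler_powR; rewrite ?nnegrE// subr_ge0 ltW.
apply: (@le_trans _ _ (`|x| `^ p)); last by rewrite lerDl powR_ge0.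
by rewrite -[leRHS]mulr_powRB1// mulrC ler_wpM2r// powR_ge0.
Qed.

Definition Lp a b g := measurable_fun `]a, b[ g /\ itg a b (fun x => `|g x| `^ p).

Lemma measurable_normp a b g : measurable_fun `]a, b[ g ->
  measurable_fun `]a, b[ (fun x => `|g x| `^ p).
Proof.
move=> mg; apply: (measurableT_comp (measurable_powR _)).
exact: measurableT_comp.
Qed.

Lemma Lp_itg a b g : Lp a b g -> itg a b g.
Proof.
move=> [mg gp]; apply: (itg_le (g := fun x => 1 + `|g x| `^ p)) => //.
  by move=> x _; exact: le_powR_split.
by apply: itgD => //; exact: itg_cst.
Qed.

Lemma eq_Lp a b g h : (forall x, a < x < b -> g x = h x) -> Lp a b g -> Lp a b h.
Proof.
move=> gh [mg gp]; split; last by apply: eq_itg gp => x /gh ->.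
apply: eq_measurable_fun mg => x; rewrite inE /= in_itv /= => /gh; exact.
Qed.

Lemma Lp_sub a b c d g : a <= c -> d <= b -> Lp a b g -> Lp c d g.
Proof.
move=> ac db [mg gp]; split; last exact: itg_sub gp.
apply: measurable_funS mg => // x /=; rewrite !in_itv /= => /andP[cx xd].
by rewrite (le_lt_trans ac cx) (lt_le_trans xd db).
Qed.

Lemma LpD a b g h : Lp a b g -> Lp a b h -> Lp a b (fun x => g x + h x).
Proof.
move=> [mg gp] [mh hp]; split; first exact: measurable_funD.
apply: (itg_le (g := fun x => 2 `^ p * (`|g x| `^ p + `|h x| `^ p))).
- by apply: measurable_normp; exact: measurable_funD.
- move=> x _; rewrite ger0_norm ?powR_ge0//; apply: le_trans (powRD_le _ _) => //.
  by apply: ler_powp => //; exact: ler_normD.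
- by apply: itgZ; exact: itgD.
Qed.

Lemma LpM a b g h M : measurable_fun `]a, b[ h ->
  (forall x, a < x < b -> `|h x| <= M) -> Lp a b g -> Lp a b (fun x => h x * g x).
Proof.
move=> mh hM [mg gp]; split; first exact: measurable_funM.
apply: (itg_le (g := fun x => M `^ p * `|g x| `^ p)).
- by apply: measurable_normp; exact: measurable_funM.
- move=> x xab; rewrite ger0_norm ?powR_ge0// normrM powRM// ler_wpM2r ?powR_ge0//.
  have := hM _ xab => hx.
  exact: ler_powp.
- exact: itgZ.
Qed.

Lemma LpM_cts a b g h : cts a b h -> Lp a b g -> Lp a b (fun x => h x * g x).
Proof.
move=> ch; have [M M0 hM] := cts_bounded ch.
apply: (LpM (M := M)); first exact: cts_measurable.
by move=> x /andP[ax xb]; apply: hM; rewrite !ltW.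
Qed.

Lemma LpZ a b k g : Lp a b g -> Lp a b (fun x => k * g x).
Proof. by apply: (LpM (M := `|k|)) => //; exact: measurable_cst. Qed.

Lemma Lp_cst a b k : Lp a b (fun=> k).
Proof. by split; [exact: measurable_cst|exact: itg_cst]. Qed.

Lemma Lp_cat a b c g : a <= b -> b <= c -> Lp a b g -> Lp b c g -> Lp a c g.
Proof.
move=> ab bc G1 G2; split.
  by apply: itg_meas; apply: itg_cat ab bc _ _; exact: Lp_itg.
by case: G1 => _ G1; case: G2 => _ G2; exact: itg_cat ab bc G1 G2.
Qed.

Lemma itg_flux a b g h : Lp a b g -> Lp a b h -> itg a b (fun x => flux (g x) * h x).
Proof.
move=> [mg gp] [mh hp].
apply: (itg_le (g := fun x => `|g x| `^ p + `|h x| `^ p)).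
- apply: measurable_funM => //; exact: (measurableT_comp measurable_flux).
- by move=> x _; rewrite normrM norm_flux; exact: young_flux.
- exact: itgD.
Qed.

Lemma cts_Lp a b f : cts a b f -> Lp a b f.
Proof.
move=> cf; have := LpM_cts cf (Lp_cst a b 1); apply: eq_Lp => x _; exact: mulr1.
Qed.

(** The pair stands for an element f of W^{1,p} with its derivative g. *)
Definition W a b f g := Lp a b g /\ AC a b f g.

Lemma W_cts a b f g : W a b f g -> cts a b f.
Proof. by move=> [_ /AC_cts]. Qed.

Lemma W_sub a b c d f g : a <= c -> d <= b -> W a b f g -> W c d f g.
Proof. by move=> ac db [gp A]; split; [exact: Lp_sub gp|exact: AC_sub A]. Qed.

Lemma W_cat a b c f g : a <= b -> b <= c -> W a b f g -> W b c f g -> W a c f g.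
Proof.
move=> ab bc [G1 A1] [G2 A2]; split; [exact: Lp_cat G1 G2|exact: AC_cat A1 A2].
Qed.

Lemma eq_W a b f g f' g' : (forall x, a <= x <= b -> f x = f' x) ->
  (forall x, a < x < b -> g x = g' x) -> W a b f g -> W a b f' g'.
Proof. by move=> ff gg [G A]; split; [exact: eq_Lp G|exact: eq_AC A]. Qed.

Lemma W_lin a b k f1 g1 f2 g2 : W a b f1 g1 -> W a b f2 g2 ->
  W a b (fun x => k * f1 x + f2 x) (fun x => k * g1 x + g2 x).
Proof.
move=> [G1 A1] [G2 A2]; split; last exact: AC_lin.
by apply: LpD => //; exact: LpZ.
Qed.

Lemma W_affine a b k m : W a b (fun x => k * x + m) (fun=> k).
Proof. by split; [exact: Lp_cst|exact: AC_affine]. Qed.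

Lemma W_zero a b : W a b (fun=> 0) (fun=> 0).
Proof. by apply: eq_W (W_affine a b 0 0) => x _; rewrite ?mul0r ?addr0. Qed.

Lemma W_mul a b f1 g1 f2 g2 : W a b f1 g1 -> W a b f2 g2 ->
  W a b (fun x => f1 x * f2 x) (fun x => f1 x * g2 x + f2 x * g1 x).
Proof.
move=> [G1 A1] [G2 A2]; split; last exact: AC_mul.
by apply: LpD; apply: LpM_cts => //; [exact: AC_cts A1|exact: AC_cts A2].
Qed.

Lemma cts_comp a b f (F : R -> R) : cts a b f ->
  (forall x, a <= x <= b -> {for f x, continuous F}) -> cts a b (fun x => F (f x)).
Proof.
move=> cf cF; apply/ctsP => x xab e e0.
have /cvgrPdist_lt/(_ _ e0) := cF _ xab; rewrite nearE => /nbhs_ballP[d1 d10 H1].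
have /ctsP/(_ x xab d1 d10)[d2 d20 H2] := cf.
exists d2 => // y yab yx; rewrite distrC; apply: H1.
by rewrite -ball_normE /ball_ /= distrC; exact: H2.
Qed.

Lemma W_comp a b f g (F F' : R -> R) c d : W a b f g ->
  (forall x, a <= x <= b -> c < f x < d) ->
  (forall t, c < t < d -> is_derive t 1 F (F' t)) ->
  (forall t, c < t < d -> {for t, continuous F'}) ->
  W a b (fun x => F (f x)) (fun x => F' (f x) * g x).
Proof.
move=> [G A] fcd dF cF; split; last exact: AC_comp A fcd dF cF.
apply: LpM_cts => //; apply: cts_comp; first exact: AC_cts A.
by move=> x /fcd; exact: cF.
Qed.

Lemma W_extend a b c d f g : a <= c -> c <= d -> d <= b -> W c d f g ->
  f c = 0 -> f d = 0 ->
  W a b (fun x => if (c <= x <= d) then f x else 0) (fun x => if c < x < d then g x else 0).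
Proof.
move=> ac cd db Wf fc fd.
apply: (W_cat (b := d)) => //; first exact: le_trans ac cd.
  apply: (W_cat (b := c)) => //.
    apply: eq_W (W_zero a c) => x /andP[ax xc].
      have [cx|//] := leP c x; have -> : x = c by apply/eqP; rewrite eq_le cx xc.
      by rewrite cd fc.
    by rewrite ltNge (ltW xc).
  by apply: eq_W Wf => x ->.
apply: eq_W (W_zero d b) => x /andP[dx xb].
  have [xd|] := leP x d; last by rewrite andbF.
  have -> : x = d by apply/eqP; rewrite eq_le xd dx.
  by rewrite cd fd.
by rewrite [x < d]ltNge (ltW dx) andbF.
Qed.

Lemma flux_continuous : continuous flux.
Proof.
move=> x; have [->|x0] := eqVneq x 0.
  apply/cvgrPdist_lt => e e0.
  have ep : 0 < e `^ (p - 1)^-1 by rewrite powR_gt0.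
  apply/nbhs_ballP; exists (e `^ (p - 1)^-1) => // y.
  rewrite /ball /= sub0r normrN => ye.
  rewrite {1}/flux mulr0 sub0r normrN norm_flux.
  have pp : 0 < p - 1 by rewrite subr_gt0.
  have := gt0_ltr_powR pp; move=> /(_ `|y| (e `^ (p - 1)^-1)).
  rewrite !nnegrE normr_ge0 powR_ge0 => /(_ isT isT ye).
  by rewrite -powRrM mulVf ?gt_eqF// powRr1// ltW.
apply: (@continuousM _ _ (fun y => `|y| `^ (p - 2)) id); last exact: cvg_id.
apply: (@continuous_comp _ _ _ (fun x => `|x|) (fun y => y `^ (p - 2))).
  exact: norm_continuous.
have : derivable (fun y => y `^ (p - 2)) `|x| 1.
  by apply: derivable_powR; rewrite in_itv /= andbT normr_gt0.
by move=> /derivable1_diffP/differentiable_continuous.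
Qed.

(** Away from 0 this is the power rule and symmetry. At 0 the difference quotient is [flux h], which
    tends to 0 because p > 1. *)
Lemma is_derive_normp x : is_derive x 1 (fun y => `|y| `^ p) (p * flux x).
Proof.
have pos y : 0 < y -> is_derive y 1 (fun y => `|y| `^ p) (p * flux y).
  move=> y0; rewrite flux_gt0//.
  apply: (@near_eq_is_derive _ _ _ (fun z => z `^ p)).
    near=> z; rewrite ger0_norm//; apply: ltW; near: z; exact: lt_nbhsr.
  exact: is_derive1_powR.
have [x0|x0|->] := ltgtP x 0; last 1 first.
- have dcvg : h^-1 *: ((fun y => `|y| `^ p) (h *: (1 : R) + 0) - (fun y => `|y| `^ p) (0 : R))
      @[h --> (0 : R)^'] --> p * flux 0.
    rewrite /flux mulr0 mulr0.
    apply/cvgrPdist_lt => e e0.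
    have /cvgrPdist_lt/(_ _ e0) := flux_continuous (x := 0).
    rewrite [in flux 0]/flux mulr0 => fl.
    apply: (@nbhs_dnbhs _ (0 : R)); near=> h.
    rewrite normr0 powR0 ?gt_eqF// subr0 addr0 sub0r normrN.
    rewrite [h *: 1]mulr1 -flux_mul /GRing.scale /=.
    have [->|h0] := eqVneq h 0; first by rewrite mulr0 mulr0 normr0.
    rewrite mulrCA mulVf// mulr1.
    by have : `|0 - flux h| < e; [near: h|rewrite sub0r normrN].
  apply: DeriveDef; first by apply/cvg_ex; exists (p * flux 0).
  exact: cvg_lim dcvg.
- have -> : (fun y : R => `|y| `^ p) = (fun y => `|y| `^ p) \o -%R.
    by apply/funext => y /=; rewrite normrN.
  have -> : p * flux x = (p * flux (- x)) * -1 by rewrite fluxN; ring.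
  by apply: is_derive1_comp; apply: pos; rewrite oppr_gt0.
- exact: pos.
Unshelve. all: by end_near. Qed.

Lemma W_normp a b f g : W a b f g ->
  W a b (fun x => `|f x| `^ p) (fun x => p * flux (f x) * g x).
Proof.
move=> Wf; have [M M0 hM] := cts_bounded (W_cts Wf).
apply: (@W_comp _ _ _ _ (fun y => `|y| `^ p) (fun y => p * flux y) (- (M + 1)) (M + 1)) => //.
- by move=> x /hM; rewrite ler_norml => /andP[]; lra.
- by move=> t _; exact: is_derive_normp.
- move=> t _; apply: (@continuousM _ _ (cst p) flux); first exact: cst_continuous.
  exact: flux_continuous.
Qed.

Lemma W_powR a b f g q : W a b f g -> (forall x, a <= x <= b -> 0 < f x) ->
  W a b (fun x => f x `^ q) (fun x => q * f x `^ (q - 1) * g x).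
Proof.
move=> Wf f0; have [M M0 hM] := cts_bounded (W_cts Wf).
apply: (@W_comp _ _ _ _ (fun y => y `^ q) (fun y => q * y `^ (q - 1)) 0 (M + 1)) => //.
- move=> x xab; have fx0 := f0 _ xab; have := hM _ xab; rewrite gtr0_norm// fx0 /=; lra.
- by move=> t /andP[t0 _]; exact: is_derive1_powR.
- move=> t /andP[t0 _]; apply: (@continuousM _ _ (cst q) (fun y => y `^ (q - 1))).
    exact: cst_continuous.
  have : derivable (fun y => y `^ (q - 1)) t 1.
    by apply: derivable_powR; rewrite in_itv /= andbT.
  by move=> /derivable1_diffP/differentiable_continuous.
Qed.

End PowerIntegrability.

(** * Weak derivatives *)

Section DuBoisReymond.
Context {R : realType}.
Implicit Types (a b c x y l r : R).
Local Notation mu := (@lebesgue_measure R).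

Definition tent r c x : R := Num.max 0 (r - `|x - c|).

Lemma tent_ge0 r c x : 0 <= tent r c x.
Proof. by rewrite /tent le_max lexx. Qed.

Lemma tent_out r c x : r <= `|x - c| -> tent r c x = 0.
Proof. by move=> h; rewrite /tent max_l// subr_le0. Qed.

Lemma tent_continuous r c : continuous (tent r c).
Proof.
move=> x; apply: (@continuous_max _ _ (cst 0) (fun x => r - `|x - c|)).
  exact: cst_continuous.
apply: continuousB; first exact: cst_continuous.
apply: (@continuous_comp _ _ _ (fun x => x - c) (fun y => `|y|)).
  by apply: continuousB; [exact: cvg_id|exact: cst_continuous].
exact: norm_continuous.
Qed.

Lemma continuous_cts a b (f : R -> R) : continuous f -> cts a b f.
Proof. by move=> cf; exact: continuous_subspaceT. Qed.

Lemma II_tent_gt0 r c a b : 0 < r -> a <= c - r -> c + r <= b -> 0 < II a b (tent r c).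
Proof.
move=> r0 ac cb; have ti u v : itg u v (tent r c).
  by apply: itg_cts; apply: continuous_cts; exact: tent_continuous.
rewrite (@II_split _ a (c - r / 2) b)//; [|lra|lra].
rewrite (@II_split _ (c - r / 2) (c + r / 2) b)//; [|lra|lra].
have h1 : 0 <= II a (c - r / 2) (tent r c) by apply: II_ge0 => x _; exact: tent_ge0.
have h2 : 0 <= II (c + r / 2) b (tent r c) by apply: II_ge0 => x _; exact: tent_ge0.
have : II (c - r / 2) (c + r / 2) (fun=> r / 2) <= II (c - r / 2) (c + r / 2) (tent r c).
  apply: II_le => //; first exact: itg_cst.
  move=> x /andP[x1 x2]; rewrite /tent le_max; apply/orP; right.
  have : `|x - c| <= r / 2 by rewrite ler_norml; apply/andP; split; lra.
  by lra.
rewrite II_cst; last by lra.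
have : 0 < r / 2 * (c + r / 2 - (c - r / 2)) by apply: mulr_gt0; lra.
by lra.
Qed.

Lemma tent_average r c a b e (w : R -> R) : 0 < r -> a <= c - r -> c + r <= b ->
  cts a b w -> (forall x, a <= x <= b -> `|x - c| < r -> `|w x - w c| <= e) ->
  `|II a b (fun x => w x * (tent r c x / II a b (tent r c))) - w c| <= e.
Proof.
move=> r0 ac cb cw we; have I0 := II_tent_gt0 r0 ac cb.
set I := II a b (tent r c) in I0 *.
have ct : cts a b (tent r c) by apply: continuous_cts; exact: tent_continuous.
have ti : itg a b (tent r c) by exact: itg_cts.
have wti : itg a b (fun x => w x * tent r c x) by exact: itgM_cts.
have -> : II a b (fun x => w x * (tent r c x / I)) = I^-1 * II a b (fun x => w x * tent r c x).
  by rewrite -IIZ//; apply: eq_II => x _; rewrite mulrA mulrC.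
have -> : w c = I^-1 * II a b (fun x => w c * tent r c x).
  by rewrite IIZ// -/I mulrCA mulVf ?mulr1// gt_eqF.
rewrite -mulrBr -IIB//; last exact: itgZ.
rewrite normrM gtr0_norm ?invr_gt0// ler_pdivrMl// mulrC -IIZ//.
have di : itg a b (fun x => w x * tent r c x - w c * tent r c x).
  by apply: itgB => //; exact: itgZ.
apply: (le_trans (II_norm di)); apply: II_le; [exact: itg_norm|exact: itgZ|].
move=> x /andP[ax xb]; rewrite -mulrBl normrM (ger0_norm (tent_ge0 _ _ _)).
have [xc|xc] := ltP `|x - c| r; last by rewrite tent_out// !mulr0.
by rewrite ler_wpM2r ?tent_ge0// we// !ltW.
Qed.

(** The derivative of eta is taken to be the difference of two narrow normalised tents at b and a.
    As these have equal mass, eta vanishes near both ends, and the integral of w against its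
    derivative is close to w b - w a. *)
Lemma du_bois_reymond l (w : R -> R) : 0 < l -> cts 0 l w ->
  (forall eta, test_function l eta -> II 0 l (fun x => w x * derive1 eta x) = 0) ->
  forall a b, 0 <= a <= l -> 0 <= b <= l -> w a = w b.
Proof.
move=> l0 cw H.
have inner a b : 0 < a -> a < b -> b < l -> w a = w b.
  move=> a0 ab bl; apply/eqP; rewrite -subr_eq0 -normr_le0 leNgt; apply/negP => s0.
  set e := `|w a - w b| / 4; have e0 : 0 < e by rewrite divr_gt0.
  have [d d0 Hd] := cts_uniform cw e0.
  (* The bounds by a / 2 and (l - b) / 2 keep the support of eta inside the open interval; the bound
     by d keeps w within e of its values at a and b. *)
  pose r := Num.min (Num.min d (a / 2)) (Num.min ((l - b) / 2) ((b - a) / 2)).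
  have r0 : 0 < r by rewrite /r !lt_min; lra.
  have [rd ra rb rab] : [/\ r <= d, r <= a / 2, r <= (l - b) / 2 & r <= (b - a) / 2].
    by rewrite /r !ge_min !lexx ?orbT; split.
  pose Ia := II 0 l (tent r a); pose Ib := II 0 l (tent r b).
  have ha : `|II 0 l (fun x => w x * (tent r a x / Ia)) - w a| <= e.
    apply: tent_average => //; [lra|lra|] => x xl xa.
    by apply: ltW; apply: Hd => //; [lra|exact: lt_le_trans rd].
  have hb : `|II 0 l (fun x => w x * (tent r b x / Ib)) - w b| <= e.
    apply: tent_average => //; [lra|lra|] => x xl xb.
    by apply: ltW; apply: Hd => //; [lra|exact: lt_le_trans rd].
  have Ia0 : 0 < Ia by apply: II_tent_gt0 => //; lra.
  have Ib0 : 0 < Ib by apply: II_tent_gt0 => //; lra.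
  pose ta x := tent r a x / Ia; pose tb x := tent r b x / Ib.
  pose zeta x := tb x - ta x.
  have cta : continuous ta.
    move=> x; apply: continuousM; [exact: tent_continuous|exact: cst_continuous].
  have ctb : continuous tb.
    move=> x; apply: continuousM; [exact: tent_continuous|exact: cst_continuous].
  have cz : continuous zeta by move=> x; apply: continuousB; [exact: ctb|exact: cta].
  have zout x : x <= a - r \/ b + r <= x -> zeta x = 0.
    move=> xab; rewrite /zeta /ta /tb !tent_out ?mul0r ?subrr//.
      by rewrite ler_normr; apply/orP; case: xab => ?; [right|left]; lra.
    by rewrite ler_normr; apply/orP; case: xab => ?; [right|left]; lra.
  have zi : mu.-integrable setT (EFin \o zeta).
    have : mu.-integrable `[0, l] (EFin \o zeta).
      by apply: itg_closed; apply: itg_cts; exact: continuous_cts.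
    rewrite integrable_mkcond// restrict_EFin (_ : zeta \_ _ = zeta)//.
    apply/funext => x; rewrite patchE; case: ifPn => //; rewrite notin_setE /= in_itv /=.
    move=> xl; apply/esym/zout; have [x0|x0] := ltP x 0; [left; lra|right].
    have [xl'|xl'] := leP x l; last by lra.
    by case: xl; rewrite x0.
  pose eta x := \int[mu]_(t in `]-oo, x]) zeta t.
  have deta x : derivable eta x 1 /\ derive1 eta x = zeta x.
    apply: (@continuous_FTC1 _ zeta -oo%O x (x + 1)).
    - by rewrite ltrDl.
    - exact: integrableS zi.
    - by rewrite ltNyr.
    - exact: cz.
  have eta_low x : x <= a - r -> eta x = 0.
    move=> xa; rewrite /eta (@eq_Rintegral _ _ _ _ _ (cst 0)).
      by rewrite Rintegral_cst// mul0r.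
    move=> t; rewrite inE /= in_itv /= => tx; apply: zout; left; exact: le_trans xa.
  have eta_II x : 0 <= x -> eta x = II 0 x zeta.
    move=> x0; have := @Rintegral_itvB _ zeta -oo%O (BRight x) 0.
    rewrite -/(eta x) -/(eta 0) (eta_low 0); last by lra.
    rewrite subr0 => E; rewrite E; [|exact: integrableS zi|by []|by rewrite ?bnd_simp].
    rewrite IIE -Rintegral_itv_bndo_bndc//; exact: integrableS zi.
  have zl : II 0 l zeta = 0.
    have ita : itg 0 l (tent r a) := itg_cts (continuous_cts (@tent_continuous r a)).
    have itb : itg 0 l (tent r b) := itg_cts (continuous_cts (@tent_continuous r b)).
    rewrite IIB; [|exact: itg_mulr|exact: itg_mulr].
    have sc c I : itg 0 l (tent r c) -> II 0 l (fun x => tent r c x / I) = I^-1 * II 0 l (tent r c).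
      by move=> ?; rewrite -IIZ//; apply: eq_II => x _; rewrite mulrC.
    by rewrite !sc// !mulVf ?subrr// gt_eqF.
  have zitg u v : itg u v zeta by apply: itg_cts; exact: continuous_cts.
  have z0 u v : b + r <= u -> II u v zeta = 0.
    move=> bu; have [uv|vu] := leP u v; last by apply: II_geq; exact: ltW.
    rewrite (@eq_II _ _ _ _ (fun=> 0)) ?II_cst ?mul0r// => x /andP[ux _].
    by apply: zout; right; exact: le_trans (ltW ux).
  have eta_high x : b + r <= x -> eta x = 0.
    move=> bx; rewrite eta_II; last by lra.
    have [xl|/ltW lx] := leP x l.
      have x0 : 0 <= x by lra.
      by have := II_split x0 xl (zitg _ _); rewrite zl (z0 x l bx) addr0 => <-.
    rewrite (II_split (ltW l0) lx (zitg _ _)) zl (z0 l x) ?addr0//; lra.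
  have supp : [set x | eta x != 0] `<=` `[a - r, b + r].
    move=> x /= ex; rewrite in_itv /=; apply/andP; split; rewrite leNgt; apply/negP => h.
      by move: ex; rewrite eta_low ?eqxx// ltW.
    by move: ex; rewrite eta_high ?eqxx// ltW.
  have csupp : closure [set x | eta x != 0] `<=` `[a - r, b + r].
    have /closure_id -> : closed `[a - r, b + r]%classic by exact: itv_closed.
    exact: closure_subset.
  have teta : test_function l eta.
    split.
    - by move=> x; case: (deta x).
    - by rewrite (_ : derive1 eta = zeta)//; apply/funext => x; case: (deta x).
    - apply: (subclosed_compact _ (@segment_compact _ (a - r) (b + r))) => //.
      exact: closed_closure.
    - move=> x /csupp; rewrite /= !in_itv /= => /andP[h1 h2]; apply/andP; split; lra.
  have := H _ teta; rewrite (_ : derive1 eta = zeta); last first.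
    by apply/funext => x; case: (deta x).
  have wta : itg 0 l (fun x => w x * ta x).
    by apply: itgM_cts => //; apply: itg_cts; exact: continuous_cts.
  have wtb : itg 0 l (fun x => w x * tb x).
    by apply: itgM_cts => //; apply: itg_cts; exact: continuous_cts.
  rewrite (@eq_II _ _ _ _ (fun x => w x * tb x - w x * ta x)); last first.
    by move=> x _; rewrite /zeta mulrBr.
  rewrite IIB// => hab; move: ha hb.
  rewrite -/ta -/tb; move: (II 0 l _) (II 0 l _) hab => A B hab.
  rewrite !ler_norml => /andP[a1 a2] /andP[b1 b2].
  have : `|w a - w b| <= 2 * e by rewrite ler_norml; apply/andP; split; lra.
  by rewrite /e; lra.
(* Continuity extends the equality to the end points, through an interior point y close to x. *)
have mid x : 0 <= x <= l -> w x = w (l / 2).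
  move=> xl; apply/eqP; rewrite -subr_eq0 -normr_le0 leNgt; apply/negP => s0.
  have [d d0 Hd] := cts_uniform cw s0.
  have [y yl yx] : exists2 y, 0 < y < l & `|y - x| < d.
    pose t := Num.min (d / 2) (l / 4).
    have t0 : 0 < t by rewrite lt_min; lra.
    have [td tl] : t <= d / 2 /\ t <= l / 4 by rewrite /t !ge_min !lexx orbT.
    have [xm|xm] := leP x (l / 2).
      by exists (x + t); [lra|rewrite addrAC subrr add0r gtr0_norm//; lra].
    exists (x - t); first lra.
    by rewrite addrAC subrr add0r normrN gtr0_norm//; lra.
  have yE : w y = w (l / 2).
    have /andP[y0 y1] := yl; have [ym|ym|->//] := ltgtP y (l / 2).
      by apply: inner => //; lra.
    by apply/esym/inner => //; lra.
  have yl' : 0 <= y <= l by lra.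
  by have := Hd x y xl yl' yx; rewrite yE distrC ltxx.
by move=> a b /mid-> /mid->.
Qed.

End DuBoisReymond.

Section WeakDerivative.
Context {R : realType} (G : metric_graph R) (p : R).
Hypothesis p1 : 1 < p.
Local Notation mu := (@lebesgue_measure R).

Lemma itg_lty (a b : R) (f : R -> R) : measurable_fun `]a, b[ f -> (forall x, 0 <= f x) ->
  itg a b f <-> (\int[mu]_(x in `]a, b[) (f x)%:E < +oo)%E.
Proof.
move=> mf f0; split=> [/integrable_lty|fy]; first by apply.
apply/integrableP; split; first exact/measurable_EFinP.
by under eq_integral do rewrite /= ger0_norm//.
Qed.

(** From right to left this is integration by parts. Conversely F minus the primitive of g
    integrates to zero against every derivative of a test function, hence is constant. *)
Lemma weak_derivative_W (f : graph_space G -> R) (e : edge G) (g F : R -> R) :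
  (forall x, 0 <= x <= len e -> f (edge_point e x) = F x) -> cts 0 (len e) F ->
  weak_derivative p f e g <-> W p 0 (len e) F g.
Proof.
move=> fF cF; have l0 := len_gt0 e.
have test_ends eta : test_function (len e) eta -> eta 0 = 0 /\ eta (len e) = 0.
  move=> [_ _ _ supp]; split; apply/eqP/negPn/negP => e0.
    have /supp : closure [set x | eta x != 0] 0 by exact: subset_closure.
    by rewrite /= in_itv /= ltxx.
  have /supp : closure [set x | eta x != 0] (len e) by exact: subset_closure.
  by rewrite /= in_itv /= ltxx andbF.
have test_W eta : test_function (len e) eta -> AC 0 (len e) eta (derive1 eta).
  move=> [de ce _ _]; apply: AC_FTC => //.
  by move=> x; apply: DeriveDef => //; rewrite derive1E.
have byparts F1 g1 eta : AC 0 (len e) F1 g1 -> test_function (len e) eta ->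
    II 0 (len e) (fun x => F1 x * derive1 eta x) = - II 0 (len e) (fun x => g1 x * eta x).
  move=> A1 te; have A2 := test_W _ te; have [e0 el] := test_ends _ te.
  have [_ /(_ 0 (len e) (lexx _) (ltW l0) (lexx _))] := AC_mul A1 A2.
  rewrite e0 el !mulr0 subrr => /esym/eqP; rewrite IID.
  - rewrite addr_eq0 => /eqP ->; congr (- _); apply: eq_II => x _; exact: mulrC.
  - by apply: itgM_cts; [exact: AC_cts A1|case: A2].
  - by apply: itgM_cts; [exact: AC_cts A2|case: A1].
have wE h : II 0 (len e) (fun x => f (edge_point e x) * h x) = II 0 (len e) (fun x => F x * h x).
  by apply: eq_II => x /andP[x0 xl]; rewrite fF// !ltW.
split=> [[mg gp Hg]|[[mg gp] A]]; last first.
  split => //; first by move: gp; rewrite itg_lty//; exact: measurable_normp.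
  move=> eta te; have := byparts _ _ _ A te; rewrite -wE !IIE; exact.
have gL : Lp p 0 (len e) g.
  by split => //; rewrite itg_lty//; exact: measurable_normp.
have gi := Lp_itg p1 gL.
pose G0 x := II 0 x g.
have AG : AC 0 (len e) G0 g.
  split; first exact: gi.
  move=> x y x0 xy yl; have gy : itg 0 y g by exact: itg_sub gi.
  by rewrite /G0 (II_split x0 xy gy) addrAC subrr add0r.
pose w x := F x - G0 x.
have cw : cts 0 (len e) w.
  by apply: within_continuousB; [exact: cF|exact: AC_cts AG].
have wc := du_bois_reymond l0 cw.
split => //; split => // x y x0 xy yl.
have : w y = w x.
  apply: wc; [|lra|lra] => eta te.
  have A2 := test_W _ te.
  have i1 : itg 0 (len e) (fun x => F x * derive1 eta x) by apply: itgM_cts => //; case: A2.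
  have i2 : itg 0 (len e) (fun x => G0 x * derive1 eta x).
    by apply: itgM_cts; [exact: AC_cts AG|case: A2].
  rewrite (@eq_II _ _ _ _ (fun x => F x * derive1 eta x - G0 x * derive1 eta x)); last first.
    by move=> z _; rewrite /w mulrBl.
  by rewrite IIB// (byparts _ _ _ AG te) -wE !IIE Hg// subrr.
have [_ /(_ x y x0 xy yl)] := AG; rewrite /w; lra.
Qed.

Lemma W_unique (a b : R) (f g h : R -> R) : W p a b f g -> W p a b f h ->
  {ae mu, forall x, a < x < b -> g x = h x}.
Proof.
move=> [G1 [i1 A1]] [G2 [i2 A2]].
have : {ae mu, forall x, a < x < b -> g x - h x = 0}.
  apply: II_ae0; first exact: itgB.
  move=> x y ax xy yb; rewrite IIB; [|exact: itg_sub i1|exact: itg_sub i2].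
  by rewrite -A1// -A2// subrr.
apply: (@filterS _ _ (ae_filter_ringOfSetsType mu)) => x H /H /eqP.
by rewrite subr_eq0 => /eqP.
Qed.

End WeakDerivative.

(** * Affine changes of variable *)

Section AffineChange.
Context {R : realType}.
Implicit Types (a b c d h x y : R).
Local Notation mu := (@lebesgue_measure R).

Definition aff h a x : R := h * x + a.

Lemma measurable_aff h a : measurable_fun [set: R] (aff h a).
Proof. by apply: measurable_funD => //; exact: measurable_funM. Qed.

Lemma preimage_aff h a x y : h != 0 ->
  mu (aff h a @^-1` `]x, y]) = (`|h|^-1%:E * mu `]x, y])%E.
Proof.
move=> h0; rewrite lebesgue_measure_itv /=.
have [hp|hn] : 0 < h \/ h < 0 by apply/orP; rewrite orbC -neq_lt.
- have -> : aff h a @^-1` `]x, y] = `]((x - a) / h), ((y - a) / h)]%classic.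
    apply/seteqP; split => t; rewrite /aff /= !in_itv /= ltr_pdivrMr// ler_pdivlMr//;
      by rewrite ltrBlDr lerBrDr (mulrC t).
  rewrite lebesgue_measure_itv /= !lte_fin ltr_pM2r ?invr_gt0// ltrD2r gtr0_norm//.
  case: ifP => _; last by rewrite mule0.
  by rewrite -!EFinB -EFinM; congr (_%:E); field; rewrite gt_eqF.
- have -> : aff h a @^-1` `]x, y] = `[((y - a) / h), ((x - a) / h)[%classic.
    apply/seteqP; split => t; rewrite /aff /= !in_itv /= ltr_ndivlMr// ler_ndivrMr//;
      by rewrite ltrBlDr lerBrDr (mulrC t) andbC.
  rewrite lebesgue_measure_itv /= !lte_fin ltr_nM2r ?invr_lt0// ltrD2r ltr0_norm//.
  case: ifP => _; last by rewrite mule0.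
  by rewrite -!EFinB -EFinM; congr (_%:E); field; rewrite lt_eqF.
Qed.

(** The image measure scaled by |h| agrees with Lebesgue measure on half-open intervals, hence on
    all measurable sets by uniqueness. *)
Lemma lebesgue_measure_aff h a (A : set (measurableTypeR R)) : h != 0 -> measurable A ->
  (`|h|%:E * mu (aff h a @^-1` A) = mu A)%E.
Proof.
move=> h0 mA; apply/esym.
pose nh := NngNum (normr_ge0 h).
pose phi : measurableTypeR R -> measurableTypeR R := aff h a.
have mphi : measurable_fun setT phi := measurable_aff h a.
pose phif : {mfun measurableTypeR R >-> measurableTypeR R} := HB.pack phi (isMeasurableFun.Build _ _ _ _ _ mphi).
have := @lebesgue_measure_unique R (mscale nh (pushforward mu phif)).
move=> ->//= X [[x y] _ <-] /=.
rewrite /mscale /pushforward /=.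
rewrite [X in (_ * X)%E](_ : _ = (`|h|^-1%:E * mu `]x, y])%E); last exact: preimage_aff.
by rewrite muleA -EFinM divff ?mul1e// normr_eq0.
Qed.

Lemma ge0_integral_aff h a (D : set (measurableTypeR R)) (f : measurableTypeR R -> \bar R) : h != 0 ->
  measurable D -> measurable_fun D f -> (forall x, D x -> 0 <= f x)%E ->
  (\int[mu]_(x in D) f x = `|h|%:E * \int[mu]_(x in aff h a @^-1` D) f (aff h a x))%E.
Proof.
move=> h0 mD mf f0.
pose nh := NngNum (normr_ge0 h).
pose phi : measurableTypeR R -> measurableTypeR R := aff h a.
have mphi : measurable_fun setT phi := measurable_aff h a.
have f0' : {in D, forall y, 0 <= f y}%E by move=> x; rewrite inE; exact: f0.
rewrite -(ge0_integral_pushforward mphi mu mD mf f0').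
apply: (eq_trans _ (ge0_integral_mscale _ mD nh mf f0)).
apply: eq_measure_integral => A mA _; rewrite /= /mscale /pushforward /=.
by rewrite -(lebesgue_measure_aff a h0 mA).
Qed.

Lemma preimage_aff_oo h a x y : 0 < h ->
  aff h a @^-1` `](aff h a x), (aff h a y)[ = `]x, y[%classic.
Proof.
move=> h0; apply/seteqP; split => t; rewrite /aff /= !in_itv /=;
  by rewrite !ltrD2r !ltr_pM2l.
Qed.

Lemma preimage_affN_oo h a x y : h < 0 ->
  aff h a @^-1` `](aff h a y), (aff h a x)[ = `]x, y[%classic.
Proof.
move=> h0; apply/seteqP; split => t; rewrite /aff /= !in_itv /=;
  by rewrite !ltrD2r !ltr_nM2l// andbC.
Qed.

Lemma itg_comp_aff (D D' : set (measurableTypeR R)) h a (f : measurableTypeR R -> R) : h != 0 ->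
  measurable D -> measurable D' -> aff h a @^-1` D = D' ->
  mu.-integrable D (EFin \o f) ->
  mu.-integrable D' (EFin \o (f \o aff h a)) /\
  \int[mu]_(x in D) f x = `|h| * \int[mu]_(x in D') f (aff h a x).
Proof.
move=> h0 mD mD' DD' fi.
have mf := measurable_int mu fi.
have mfa : measurable_fun D' (f \o aff h a).
  rewrite -DD'; apply: (measurable_comp (F := D)) => //.
  - by move=> _ [x Dx <-].
  - exact/measurable_EFinP.
  - by apply: measurable_funTS; exact: measurable_aff.
have fi' : mu.-integrable D' (EFin \o (f \o aff h a)).
  apply/integrableP; split; first exact/measurable_EFinP.
  case/integrableP : fi => _; rewrite (ge0_integral_aff a h0)//; last first.
    exact: measurableT_comp.
  rewrite DD' => fy; rewrite ltNge; apply/negP; rewrite leye_eq => /eqP E.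
  by move: fy; rewrite E gt0_muley ?ltxx// lte_fin normr_gt0.
split => //; rewrite /Rintegral.
have Ep : (\int[mu]_(x in D) (EFin \o f)^\+ x =
    `|h|%:E * \int[mu]_(x in D') (EFin \o (f \o aff h a))^\+ x)%E.
  have := ge0_integral_aff a h0 mD (measurable_funepos mf) (fun x _ => funepos_ge0 _ x).
  by rewrite DD' => ->; congr (_ * _)%E; apply: eq_integral => x _; rewrite !funeposE.
have En : (\int[mu]_(x in D) (EFin \o f)^\- x =
    `|h|%:E * \int[mu]_(x in D') (EFin \o (f \o aff h a))^\- x)%E.
  have := ge0_integral_aff a h0 mD (measurable_funeneg mf) (fun x _ => funeneg_ge0 _ x).
  by rewrite DD' => ->; congr (_ * _)%E; apply: eq_integral => x _; rewrite !funenegE.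
have -> : (\int[mu]_(x in D) (f x)%:E = `|h|%:E * \int[mu]_(x in D') (f (aff h a x))%:E)%E.
  rewrite [LHS]integralE [X in (_ = _ * X)%E]integralE Ep En.
  by apply/esym/muleBr => //; exact: (integrable_add_def _ fi').
by rewrite fineM//; exact: (integrable_fin_num _ fi').
Qed.

Lemma itg_aff h a x y (f : R -> R) : 0 < h ->
  itg (aff h a x) (aff h a y) f -> itg x y (f \o aff h a).
Proof.
move=> h0 fi; have h0' : h != 0 by rewrite gt_eqF.
by have [] := itg_comp_aff h0' _ _ (preimage_aff_oo a x y h0) fi.
Qed.

Lemma II_aff h a x y (f : R -> R) : 0 < h -> itg (aff h a x) (aff h a y) f ->
  II (aff h a x) (aff h a y) f = h * II x y (f \o aff h a).
Proof.
move=> h0 fi; have h0' : h != 0 by rewrite gt_eqF.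
have [] := itg_comp_aff h0' _ _ (preimage_aff_oo a x y h0) fi => //.
by rewrite gtr0_norm// !IIE.
Qed.

Lemma itg_affN h a x y (f : R -> R) : h < 0 ->
  itg (aff h a y) (aff h a x) f -> itg x y (f \o aff h a).
Proof.
move=> h0 fi; have h0' : h != 0 by rewrite lt_eqF.
by have [] := itg_comp_aff h0' _ _ (preimage_affN_oo a x y h0) fi.
Qed.

Lemma II_affN h a x y (f : R -> R) : h < 0 -> itg (aff h a y) (aff h a x) f ->
  II (aff h a y) (aff h a x) f = - h * II x y (f \o aff h a).
Proof.
move=> h0 fi; have h0' : h != 0 by rewrite lt_eqF.
have [] := itg_comp_aff h0' _ _ (preimage_affN_oo a x y h0) fi => //.
by rewrite ltr0_norm// !IIE.
Qed.

Lemma measurable_comp_aff h a x y (g : R -> R) : 0 < h ->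
  measurable_fun `](aff h a x), (aff h a y)[ g -> measurable_fun `]x, y[ (g \o aff h a).
Proof.
move=> h0 mg; rewrite -(preimage_aff_oo a x y h0).
apply: (measurable_comp (F := `](aff h a x), (aff h a y)[%classic)) => //.
- by move=> _ [t Dt <-].
- by apply: measurable_funTS; exact: measurable_aff.
Qed.

Lemma measurable_comp_affN h a x y (g : R -> R) : h < 0 ->
  measurable_fun `](aff h a y), (aff h a x)[ g -> measurable_fun `]x, y[ (g \o aff h a).
Proof.
move=> h0 mg; rewrite -(preimage_affN_oo a x y h0).
apply: (measurable_comp (F := `](aff h a y), (aff h a x)[%classic)) => //.
- by move=> _ [t Dt <-].
- by apply: measurable_funTS; exact: measurable_aff.
Qed.

Lemma W_aff p h a x y (f g : R -> R) : 1 < p -> 0 < h ->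
  W p (aff h a x) (aff h a y) f g ->
  W p x y (f \o aff h a) (fun t => h * g (aff h a t)).
Proof.
move=> p1 h0 [[mg gp] [gi fg]].
have G : Lp p x y (g \o aff h a).
  by split; [exact: measurable_comp_aff|exact: itg_aff gp].
split; first exact: LpZ.
split=> [|s t xs st ty]; first by apply: itgZ; exact: itg_aff.
have mono u v : u <= v -> aff h a u <= aff h a v by move=> uv; rewrite lerD2r ler_pM2l.
rewrite /= fg ?mono// II_aff//; last by apply: itg_sub gi; exact: mono.
by rewrite -IIZ//; apply: itg_sub xs ty _; exact: itg_aff.
Qed.

(** Serves to reverse an edge, with slope -1. *)
Lemma W_affN p h a x y (f g : R -> R) : 1 < p -> h < 0 ->
  W p (aff h a y) (aff h a x) f g ->
  W p x y (f \o aff h a) (fun t => h * g (aff h a t)).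
Proof.
move=> p1 h0 [[mg gp] [gi fg]].
have G : Lp p x y (g \o aff h a).
  by split; [exact: measurable_comp_affN|exact: itg_affN gp].
split; first exact: LpZ.
split=> [|s t xs st ty]; first by apply: itgZ; exact: itg_affN.
have mono u v : u <= v -> aff h a v <= aff h a u by move=> uv; rewrite lerD2r ler_nM2l.
rewrite /= -opprB fg ?mono// II_affN//; last by apply: itg_sub gi; exact: mono.
rewrite mulNr opprK -IIZ//; apply: itg_sub xs ty _; exact: itg_affN.
Qed.

End AffineChange.

(** * Nodal intervals on one edge *)

Section DirichletConstant.
Context {R : realType} (p : R).
Hypothesis p1 : 1 < p.
Implicit Types (a b c d l x y : R) (f g u w : R -> R).

Let p0 : 0 < p. Proof. exact: lt_trans p1. Qed.

(** The p-th power of the L^p norm. *)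
Definition Pow a b f : R := II a b (fun x => `|f x| `^ p).

Lemma Pow_ge0 a b f : 0 <= Pow a b f.
Proof. by apply: II_ge0 => x _; exact: powR_ge0. Qed.

Lemma cts_Lp_itg a b f : cts a b f -> itg a b (fun x => `|f x| `^ p).
Proof. by move=> /(cts_Lp p1) []. Qed.

Lemma Pow_gt0 a b f x : cts a b f -> a < b -> a <= x <= b -> f x != 0 -> 0 < Pow a b f.
Proof.
move=> cf ab /andP[ax xb] fx0; set s := `|f x|.
have s0 : 0 < s / 2 by rewrite divr_gt0// normr_gt0.
have [d d0 Hd] := cts_uniform cf s0.
pose al := Num.max a (x - d / 2); pose be := Num.min b (x + d / 2).
have [aal [xal alx]] : a <= al /\ x - d / 2 <= al /\ al <= x.
  by rewrite /al !le_max !lexx orbT ge_max ax; split => //; split => //; lra.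
have [bbe [xbe bex]] : be <= b /\ be <= x + d / 2 /\ x <= be.
  by rewrite /be !ge_min !lexx orbT le_min xb; split => //; split => //; lra.
have albe : al < be by rewrite /al /be lt_min !gt_max ab /=; apply/andP; split; lra.
have fi := cts_Lp_itg cf.
have f2 : itg al b (fun x => `|f x| `^ p) by exact: itg_sub fi.
rewrite /Pow (II_split aal (le_trans (ltW albe) bbe) fi) (II_split (ltW albe) bbe f2).
have h1 : 0 <= II a al (fun x => `|f x| `^ p) by apply: II_ge0 => z _; exact: powR_ge0.
have h2 : 0 <= II be b (fun x => `|f x| `^ p) by apply: II_ge0 => z _; exact: powR_ge0.
have h3 : II al be (fun=> (s / 2) `^ p) <= II al be (fun x => `|f x| `^ p).
  apply: II_le; [exact: itg_cst|exact: itg_sub f2|].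
  move=> z /andP[z1 z2]; apply: ler_powp => //; first exact: ltW.
  have : `|f z - f x| < s / 2.
    apply: Hd; [by rewrite ax xb|apply/andP; split; lra|].
    by rewrite ltr_norml; apply/andP; split; lra.
  have := lerB_normD (f x) (f z - f x); rewrite (addrC (f x)) subrK -/s; lra.
rewrite II_cst in h3; last exact: ltW.
have : 0 < (s / 2) `^ p * (be - al) by rewrite mulr_gt0 ?powR_gt0// subr_gt0.
lra.
Qed.

Definition dirichlet_pair a b f g :=
  [/\ W p a b f g, f a = 0, f b = 0 & 0 < Pow a b f].

Definition Lam : R :=
  inf [set r | exists f g, dirichlet_pair 0 1 f g /\ r = Pow 0 1 g / Pow 0 1 f].

Lemma abs_le_II a b f g x : W p a b f g -> f a = 0 -> a <= x <= b ->
  `|f x| <= II a b (fun x => `|g x|).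
Proof.
move=> [_ [gi fg]] fa /andP[ax xb].
have -> : f x = II a x g by rewrite -fg// fa subr0.
have gx : itg a x g by exact: itg_sub gi.
apply: (le_trans (II_norm gx)).
rewrite (II_split ax xb (itg_norm gi)) lerDl.
by apply: II_ge0.
Qed.

(** Bounds the Rayleigh quotients away from 0, so that [Lam] is a positive infimum. The L^1 norm M
    of g dominates f; choosing e = M / 2 below allows half of M to be absorbed, which is the origin
    of the constant 2^p. *)
Lemma poincare f g : W p 0 1 f g -> f 0 = 0 -> Pow 0 1 f <= 2 `^ p * Pow 0 1 g.
Proof.
move=> Wf f0; set M := II 0 1 (fun x => `|g x|).
have M0 : 0 <= M by apply: II_ge0.
have fM x : 0 < x < 1 -> `|f x| `^ p <= M `^ p.
  move=> /andP[x0 x1]; apply: ler_powp => //.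
  by apply: (abs_le_II Wf f0); rewrite !ltW.
have [[mg gp] [gi _]] := Wf.
have PM : Pow 0 1 f <= M `^ p.
  have -> : M `^ p = II 0 1 (fun=> M `^ p) by rewrite II_cst// subr0 mulr1.
  by apply: II_le => //; [exact: (cts_Lp_itg (W_cts Wf))|exact: itg_cst].
apply: (le_trans PM).
move: M0; rewrite le_eqVlt => /predU1P[<-|M0].
  by rewrite powR0 ?gt_eqF// mulr_ge0 ?powR_ge0 ?Pow_ge0.
have e0 : 0 < M / 2 by rewrite divr_gt0.
(* [|t| <= e + e^(1-p) |t|^p] *)
have key : M <= M / 2 + (M / 2) `^ (1 - p) * Pow 0 1 g.
  rewrite {1}/M.
  have -> : M / 2 + (M / 2) `^ (1 - p) * Pow 0 1 g =
    II 0 1 (fun x => M / 2 + (M / 2) `^ (1 - p) * `|g x| `^ p).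
    rewrite IID; [|exact: itg_cst|exact: itgZ].
    by rewrite II_cst// subr0 mulr1 IIZ.
  apply: II_le; [exact: itg_norm|by apply: itgD; [exact: itg_cst|exact: itgZ]|].
  move=> x _; have [ge|eg] := leP `|g x| (M / 2).
    by rewrite (le_trans ge)// lerDl mulr_ge0// powR_ge0.
  apply: (@le_trans _ _ ((M / 2) `^ (1 - p) * `|g x| `^ p)); last by rewrite lerDr ltW.
  have gx0 : 0 < `|g x| by exact: lt_trans eg.
  rewrite -(@mulr_powRB1 _ `|g x| p)// mulrCA ler_peMr//.
  rewrite -opprB powRN ler_pdivlMl ?powR_gt0// mulr1.
  by apply: ge0_ler_powR; rewrite ?nnegrE ?subr_ge0 ?ltW.
have : M / 2 <= (M / 2) `^ (1 - p) * Pow 0 1 g by lra.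
rewrite -opprB powRN ler_pdivlMl ?powR_gt0// mulrC mulr_powRB1//; last exact: ltW.
rewrite powRM ?invr_ge0//; last exact: ltW.
move=> h.
have e : 2^-1 `^ p * 2 `^ p = 1 :> R by rewrite -powRM// mulVf// powR1.
have -> : M `^ p = 2 `^ p * (M `^ p * 2^-1 `^ p).
  by rewrite mulrCA [2 `^ p * _]mulrC e mulr1.
by rewrite ler_pM2l ?powR_gt0.
Qed.

Lemma dirichlet_pair_exists : exists f g, dirichlet_pair 0 1 f g.
Proof.
have W1 := W_affine p 0 1 1 0; have W2 := W_affine p 0 1 (-1) 1.
have W12 := W_mul p1 W1 W2.
eexists; eexists; split; first exact: W12.
- by rewrite /=; ring.
- by rewrite /=; ring.
apply: (Pow_gt0 (x := 2^-1)) => //; first exact: W_cts W12.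
- by apply/andP; split; lra.
- by rewrite mulf_neq0//; apply/eqP; lra.
Qed.

Let rayleigh := [set r | exists f g, dirichlet_pair 0 1 f g /\ r = Pow 0 1 g / Pow 0 1 f].

Let rayleigh_lbound : lbound rayleigh ((2 `^ p)^-1).
Proof.
move=> r [f [g [[Wf f0 f1 Pf] ->]]]; rewrite (ler_pdivlMr _ _ Pf) ler_pdivrMl.
  exact: poincare.
by rewrite powR_gt0.
Qed.

Lemma Lam_gt0 : 0 < Lam.
Proof.
apply: (@lt_le_trans _ _ ((2 `^ p)^-1)); first by rewrite invr_gt0 powR_gt0.
apply: lb_le_inf; last exact: rayleigh_lbound.
have [f [g fg]] := dirichlet_pair_exists.
by exists (Pow 0 1 g / Pow 0 1 f); exists f, g.
Qed.

Lemma Pow_aff h a x y f : 0 < h -> itg (aff h a x) (aff h a y) (fun x => `|f x| `^ p) ->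
  Pow (aff h a x) (aff h a y) f = h * Pow x y (f \o aff h a).
Proof. by move=> h0 fi; rewrite /Pow II_aff. Qed.

Lemma Pow_scale a b k f : itg a b (fun x => `|f x| `^ p) ->
  Pow a b (fun x => k * f x) = `|k| `^ p * Pow a b f.
Proof.
move=> fi; rewrite /Pow -IIZ//; apply: eq_II => x _.
by rewrite normrM powRM.
Qed.

(** The Rayleigh quotient scales like the length to the power - p. *)
Lemma Lam_le a b f g : W p a b f g -> a < b -> f a = 0 -> f b = 0 ->
  Lam * Pow a b f <= (b - a) `^ p * Pow a b g.
Proof.
move=> Wf ab fa fb; have [Pf|Pf] := leP (Pow a b f) 0.
  have -> : Pow a b f = 0 by apply/eqP; rewrite eq_le Pf Pow_ge0.
  by rewrite mulr0 mulr_ge0 ?powR_ge0 ?Pow_ge0.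
have h0 : 0 < b - a by rewrite subr_gt0.
have ea : aff (b - a) a 0 = a by rewrite /aff mulr0 add0r.
have eb : aff (b - a) a 1 = b by rewrite /aff mulr1 subrK.
have Wf' : W p (aff (b - a) a 0) (aff (b - a) a 1) f g by rewrite ea eb.
have fi := cts_Lp_itg (W_cts Wf').
have gi : itg (aff (b - a) a 0) (aff (b - a) a 1) (fun x => `|g x| `^ p) by case: Wf' => -[].
have WF := W_aff p1 h0 Wf'.
have Ef := Pow_aff h0 fi; have Eg := Pow_aff h0 gi.
rewrite ea eb in Ef Eg.
have EG : Pow 0 1 (fun t => (b - a) * g (aff (b - a) a t)) = (b - a) `^ p * Pow 0 1 (g \o aff (b - a) a).
  by rewrite (Pow_scale _ (itg_aff h0 gi)) (gtr0_norm h0).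
have PF : 0 < Pow 0 1 (f \o aff (b - a) a) by rewrite Ef pmulr_rgt0 in Pf.
have : Lam <= Pow 0 1 (fun t => (b - a) * g (aff (b - a) a t)) / Pow 0 1 (f \o aff (b - a) a).
  apply: ge_inf; first by exists ((2 `^ p)^-1); exact: rayleigh_lbound.
  exists (f \o aff (b - a) a), (fun t => (b - a) * g (aff (b - a) a t)); split => //.
  by split; rewrite //= ?ea ?eb.
rewrite (ler_pdivlMr _ _ PF) EG Ef Eg => h.
by rewrite mulrCA [leRHS]mulrCA (ler_pM2l h0).
Qed.

Lemma Lam_near eps : 0 < eps ->
  exists f g, dirichlet_pair 0 1 f g /\ Pow 0 1 g < (Lam + eps) * Pow 0 1 f.
Proof.
move=> e0.
have hi : has_inf rayleigh.
  split; last by exists ((2 `^ p)^-1); exact: rayleigh_lbound.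
  have [f [g fg]] := dirichlet_pair_exists.
  by exists (Pow 0 1 g / Pow 0 1 f); exists f, g.
have [r [f [g [fg ->]]] h] := inf_adherent e0 hi.
exists f, g; split => //; have [_ _ _ Pf] := fg.
by rewrite -ltr_pdivrMr.
Qed.

(** Transports a near-minimiser of the Rayleigh quotient to [a, a + h]; it then serves in [picone]
    and as a bump in Weyl's upper bound. *)
Lemma dirichlet_pair_move f g a h : 0 < h -> dirichlet_pair 0 1 f g ->
  let f' := f \o aff h^-1 (- (a / h)) in
  let g' := fun t => h^-1 * g (aff h^-1 (- (a / h)) t) in
  [/\ dirichlet_pair a (a + h) f' g', Pow a (a + h) f' = h * Pow 0 1 f &
    h `^ p * Pow a (a + h) g' = h * Pow 0 1 g].
Proof.
move=> h0 [Wf f0 f1 Pf] f' g'.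
have hn0 : h != 0 by rewrite gt_eqF.
have hi0 : 0 < h^-1 by rewrite invr_gt0.
have ea : aff h^-1 (- (a / h)) a = 0 by rewrite /aff mulrC subrr.
have eb : aff h^-1 (- (a / h)) (a + h) = 1 by rewrite /aff; field.
have Wf' : W p (aff h^-1 (- (a / h)) a) (aff h^-1 (- (a / h)) (a + h)) f g by rewrite ea eb.
have fi := cts_Lp_itg (W_cts Wf').
have gi : itg (aff h^-1 (- (a / h)) a) (aff h^-1 (- (a / h)) (a + h)) (fun x => `|g x| `^ p).
  by case: Wf' => -[].
have WF := W_aff p1 hi0 Wf'.
have Ef := Pow_aff hi0 fi; have Eg := Pow_aff hi0 gi.
rewrite ea eb in Ef Eg.
have Pf' : Pow a (a + h) f' = h * Pow 0 1 f by rewrite Ef mulrA (divff hn0) mul1r.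
split; [split; last by rewrite Pf' mulr_gt0|exact: Pf'|].
- exact: WF.
- by rewrite /f' /= ea.
- by rewrite /f' /= eb.
rewrite /g' (Pow_scale _ (itg_aff hi0 gi)).
rewrite Eg (gtr0_norm hi0) mulrA -(powRM _ (ltW h0) (ltW hi0)) (divff hn0) powR1 mul1r.
by rewrite mulrA (divff hn0) mul1r.
Qed.

End DirichletConstant.

(** * Zeros on an edge: Picone's inequality and unique continuation *)

Section EdgeEigenfunction.
Context {R : realType} (p : R).
Hypothesis p1 : 1 < p.
Implicit Types (a b c d l x y lambda : R) (f g u w : R -> R).

Let p0 : 0 < p. Proof. exact: lt_trans p1. Qed.
Local Notation flux := (flux p).
Local Notation W := (W p).

(** What the weak equation on the graph says inside one edge: test functions vanish at both ends. *)
Definition edge_eigen l lambda u w :=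
  W 0 l u w /\ forall phi g, W 0 l phi g -> phi 0 = 0 -> phi l = 0 ->
    II 0 l (fun x => flux (w x) * g x) = lambda * II 0 l (fun x => flux (u x) * phi x).

Lemma II_support a b c d f : a <= c -> c <= d -> d <= b -> itg a b f ->
  (forall x, a < x < c -> f x = 0) -> (forall x, d < x < b -> f x = 0) ->
  II a b f = II c d f.
Proof.
move=> ac cd db fi f1 f2.
rewrite (II_split ac (le_trans cd db) fi) (II_split cd db); last exact: itg_sub fi.
rewrite (@eq_II _ a c _ (fun=> 0)); last exact: f1.
rewrite (@eq_II _ d b _ (fun=> 0)); last exact: f2.
by rewrite !II_cst// !mul0r add0r addr0.
Qed.

Lemma edge_eigen_local l lambda u w a b phi g : edge_eigen l lambda u w ->
  0 <= a -> a <= b -> b <= l -> W a b phi g -> phi a = 0 -> phi b = 0 ->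
  II a b (fun x => flux (w x) * g x) = lambda * II a b (fun x => flux (u x) * phi x).
Proof.
move=> [Wu H] a0 ab bl Wphi pa pb.
have WE := W_extend p1 a0 ab bl Wphi pa pb.
have [Gw _] := Wu; have Gu := cts_Lp p1 (W_cts Wu).
have := H _ _ WE.
set phi' := (fun x => if a <= x <= b then phi x else 0).
set g' := (fun x => if a < x < b then g x else 0).
have z0 : phi' 0 = 0.
  rewrite /phi'; case: ifPn => // /andP[a0' _].
  by rewrite -[RHS]pa; congr phi; apply/eqP; rewrite eq_le a0' a0.
have zl : phi' l = 0.
  rewrite /phi'; case: ifPn => // /andP[_ bl'].
  by rewrite -[RHS]pb; congr phi; apply/eqP; rewrite eq_le bl' bl.
move=> /(_ z0 zl).
have i1 : itg 0 l (fun x => flux (w x) * g' x) by apply: itg_flux => //; case: WE.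
have i2 : itg 0 l (fun x => flux (u x) * phi' x).
  by apply: itg_flux => //; apply: cts_Lp => //; exact: W_cts WE.
rewrite (II_support a0 ab bl i1); first last.
- by move=> x /andP[bx _]; rewrite /g' [x < b]ltNge (ltW bx) andbF mulr0.
- by move=> x /andP[_ xa]; rewrite /g' [a < x]ltNge (ltW xa) mulr0.
rewrite (II_support a0 ab bl i2); first last.
- by move=> x /andP[bx _]; rewrite /phi' [x <= b]leNgt bx andbF mulr0.
- by move=> x /andP[_ xa]; rewrite /phi' [a <= x]leNgt xa mulr0.
rewrite (@eq_II _ _ _ _ (fun x => flux (w x) * g x)); last first.
  by move=> x xab; rewrite /g' xab.
rewrite (@eq_II _ _ _ (fun x => flux (u x) * phi' x) (fun x => flux (u x) * phi x))//.
by move=> x /andP[ax xb]; rewrite /phi' !ltW.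
Qed.

(** Testing the equation on [a, b] with u itself shows that its Rayleigh quotient there is
    lambda. *)
Lemma nodal_gap l lambda u w a b x : edge_eigen l lambda u w ->
  0 <= a -> a < b -> b <= l -> u a = 0 -> u b = 0 -> a <= x <= b -> u x != 0 ->
  Lam p <= lambda * (b - a) `^ p.
Proof.
move=> E a0 ab bl ua ub xab ux.
have Wu : W a b u w by apply: W_sub E.1.
have := edge_eigen_local E a0 (ltW ab) bl Wu ua ub.
rewrite (@eq_II _ _ _ _ (fun x => `|w x| `^ p)); last by move=> t _; rewrite flux_mul.
rewrite (@eq_II _ _ _ (fun x => flux (u x) * u x) (fun x => `|u x| `^ p)); last first.
  by move=> t _; rewrite flux_mul.
rewrite -/(Pow p a b w) -/(Pow p a b u) => e.
have := Lam_le p1 Wu ab ua ub; rewrite e.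
have Pu : 0 < Pow p a b u by apply: (Pow_gt0 p1 (x := x)) => //; exact: W_cts Wu.
by rewrite mulrA ler_pM2r// mulrC.
Qed.

(** The bracket is the derivative of |f|^p u^(1-p). With X = |F| |V| / U the left-hand side is at
    most p X^(p-1) |G| - (p-1) X^p, and Young's inequality with exponents p and p / (p-1)
    concludes. *)
Lemma picone_pointwise (U F G V : R) : 0 < U ->
  flux V * (`|F| `^ p * ((1 - p) * U `^ (1 - p - 1) * V)
    + U `^ (1 - p) * (p * flux F * G)) <= `|G| `^ p.
Proof.
move=> U0; set X := `|F| * `|V| / U.
have X0 : 0 <= X by rewrite divr_ge0// ?mulr_ge0// ltW.
have E1 : flux V * (`|F| `^ p * ((1 - p) * U `^ (1 - p - 1) * V)) = - (p - 1) * X `^ p.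
  have -> : flux V * (`|F| `^ p * ((1 - p) * U `^ (1 - p - 1) * V))
     = - (p - 1) * ((flux V * V) * `|F| `^ p * U `^ (1 - p - 1)) by ring.
  rewrite flux_mul//; congr (_ * _).
  have -> : 1 - p - 1 = - p by ring.
  rewrite /X !powRM ?mulr_ge0 ?invr_ge0 ?(ltW U0)//.
  rewrite powRN -[U^-1]powR_inv1 ?(ltW U0)// -powRrM mulN1r powRN; ring.
have E2 : flux V * (U `^ (1 - p) * (p * flux F * G)) <= p * (X `^ (p - 1) * `|G|).
  apply: (le_trans (ler_norm _)); rewrite normrM norm_flux// normrM (normrM (p * flux F)) (normrM p) norm_flux// (gtr0_norm p0).
  have eU : U `^ (1 - p) = (U `^ (p - 1))^-1 by rewrite -powRN opprB.
  rewrite (ger0_norm (powR_ge0 _ _)) eU.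
  rewrite /X !powRM ?mulr_ge0 ?invr_ge0 ?(ltW U0)//.
  have -> : U^-1 `^ (p - 1) = (U `^ (p - 1))^-1.
    by rewrite -[U^-1]powR_inv1 ?(ltW U0)// -powRrM mulN1r powRN.
  rewrite le_eqVlt; apply/orP; left; apply/eqP; ring.
have q0 : 0 < p / (p - 1) by rewrite divr_gt0// subr_gt0.
have pn0 : p != 0 by rewrite gt_eqF.
have pm0 : p - 1 != 0 by rewrite subr_eq0 gt_eqF.
have pq : p^-1 + (p / (p - 1))^-1 = 1 by field; rewrite pn0 pm0.
have := conjugate_powR (normr_ge0 G) (powR_ge0 X (p - 1)) p0 q0 pq.
rewrite -powRrM (_ : (p - 1) * (p / (p - 1)) = p); last by field.
move=> Y0.
have : p * (`|G| * X `^ (p - 1)) <= p * (`|G| `^ p / p + X `^ p / (p / (p - 1))).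
  by rewrite ler_pM2l.
have -> : p * (`|G| `^ p / p + X `^ p / (p / (p - 1))) = `|G| `^ p + (p - 1) * X `^ p.
  by field; rewrite pn0 pm0.
move=> Y; rewrite mulrDr E1; move: E2 Y; rewrite [ `|G| * _]mulrC; lra.
Qed.

(** The test function is |f|^p u^(1-p) with f a near-minimiser for [Lam]; multiplied by [flux (u x)]
    it becomes |f|^p. Positivity of u up to the end points is what makes u^(1-p) a Sobolev
    function. *)
Lemma picone l lambda u w a b : edge_eigen l lambda u w ->
  0 <= a -> a < b -> b <= l -> (forall x, a <= x <= b -> 0 < u x) ->
  lambda * (b - a) `^ p <= Lam p.
Proof.
move=> E a0 ab bl upos; apply/ler_addgt0Pr => e e0.
have Wu : W a b u w by apply: W_sub E.1.
have [f0 [g0 [fg0 Pg0]]] := Lam_near p1 e0.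
have h0 : 0 < b - a by rewrite subr_gt0.
have := dirichlet_pair_move p1 a h0 fg0; rewrite [a + _]addrC subrK /=.
set f := _ \o _; set g := (fun t => _) => -[[Wf fa fb Pf] Ef Eg].
have Wphi := W_mul p1 (W_normp p1 Wf) (W_powR p1 (1 - p) Wu upos).
have p00 : (0 : R) `^ p = 0 by rewrite powR0 ?gt_eqF.
have := edge_eigen_local E a0 (ltW ab) bl Wphi.
rewrite fa fb normr0 p00 !mul0r => /(_ erefl erefl).
have flux_cancel x : a < x < b -> flux (u x) * (`|f x| `^ p * u x `^ (1 - p)) = `|f x| `^ p.
  clear -upos p1 => /andP[ax xb]; have ux : 0 < u x by rewrite upos// !ltW.
  rewrite flux_gt0// mulrCA -powRD; last by rewrite (gt_eqF ux) /= implybT.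
  by rewrite (_ : _ + _ = 0) ?powRr0 ?mulr1//; ring.
rewrite [in X in _ = _ * X](eq_II flux_cancel).
rewrite -/(Pow p a b f) => Epic.
have : lambda * Pow p a b f <= Pow p a b g.
  rewrite -Epic; apply: II_le.
  - by apply: (itg_flux p1); [case: Wu|case: Wphi].
  - by case: Wf => -[].
  move=> x /andP[ax xb]; have ux : 0 < u x by rewrite upos// !ltW.
  exact: picone_pointwise.
rewrite -(ler_pM2l (powR_gt0 p h0)) Eg Ef => h.
have Pf0 : 0 < Pow p 0 1 f0 by case: fg0.
rewrite -(ler_pM2r Pf0) -(ler_pM2l h0).
apply: le_trans (_ : (b - a) * Pow p 0 1 g0 <= _).
  by apply: le_trans h; rewrite le_eqVlt; apply/orP; left; apply/eqP; ring.
by rewrite (ler_pM2l h0) (ltW Pg0).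
Qed.

Lemma edge_eigenN l lambda u w : edge_eigen l lambda u w ->
  edge_eigen l lambda (fun x => - u x) (fun x => - w x).
Proof.
move=> [Wu H]; split.
  by apply: eq_W (W_lin p1 (-1) Wu (W_zero p 0 l)) => x _; rewrite mulN1r addr0.
move=> phi g Wphi z0 zl; have [Gw _] := Wu; have Gu := cts_Lp p1 (W_cts Wu).
have i1 : itg 0 l (fun x => flux (w x) * g x) by apply: itg_flux => //; case: Wphi.
have i2 : itg 0 l (fun x => flux (u x) * phi x).
  by apply: itg_flux => //; apply: cts_Lp => //; exact: W_cts Wphi.
rewrite (@eq_II _ _ _ _ (fun x => - (flux (w x) * g x))); last first.
  by move=> x _; rewrite fluxN mulNr.
rewrite (@eq_II _ _ _ (fun x => flux (- u x) * phi x) (fun x => - (flux (u x) * phi x))); last first.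
  by move=> x _; rewrite fluxN mulNr.
by rewrite !IIN// (H _ _ Wphi z0 zl) mulrN.
Qed.

Lemma sign_on_interval u a b : cts a b u -> (forall x, a <= x <= b -> u x != 0) ->
  (forall x, a <= x <= b -> 0 < u x) \/ (forall x, a <= x <= b -> 0 < - u x).
Proof.
move=> cu u0; have [ab|ba] := leP a b; last first.
  by left => x /andP[ax xb]; have := le_trans ax xb; rewrite leNgt ba.
have aab : a <= a <= b by rewrite lexx ab.
have noz x y : a <= x -> x <= y -> y <= b -> ~ (Num.min (u x) (u y) <= 0 <= Num.max (u x) (u y)).
  move=> ax xy yb h; have [z /andP[xz zy] uz] := cts_itv_image cu ax xy yb h.
  by have := u0 z; rewrite uz eqxx (le_trans ax xz) (le_trans zy yb) => /(_ isT).
have [ua|ua|ua] := ltgtP (u a) 0; last by move: (u0 a aab); rewrite ua eqxx.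
- right => x xab; rewrite oppr_gt0 ltNge; apply/negP => ux.
  have /andP[ax xb] := xab; apply: (noz a x) => //.
  by rewrite ge_min le_max (ltW ua) ux orbT.
- left => x xab; rewrite ltNge; apply/negP => ux.
  have /andP[ax xb] := xab; apply: (noz a x) => //.
  by rewrite ge_min le_max (ltW ua) ux orbT.
Qed.

Lemma oscillation l lambda u w a b : edge_eigen l lambda u w ->
  0 <= a -> a < b -> b <= l -> Lam p < lambda * (b - a) `^ p ->
  exists2 x, a <= x <= b & u x = 0.
Proof.
move=> E a0 ab bl L; apply: contrapT => noz.
have u0 x : a <= x <= b -> u x != 0.
  by move=> xab; apply/eqP => ux; apply: noz; exists x.
have cu : cts a b u by apply: cts_sub (W_cts E.1).
have [pos|neg] := sign_on_interval cu u0.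
  by have := picone E a0 ab bl pos; rewrite leNgt L.
by have := picone (edge_eigenN E) a0 ab bl neg; rewrite leNgt L.
Qed.


(* If [u] vanishes on [[c, d]] and then becomes positive, test with the function
   rising linearly to [1] on [[c, d]] and equal to [1 - u / M] up to the point
   [t] where [u] is maximal with value [M]: the left-hand side of the weak
   equation is nonpositive, the right-hand side nonnegative. *)
Lemma continuation_step l lambda u w c d delta t0 : edge_eigen l lambda u w ->
  0 <= lambda -> 0 <= c -> c < d -> (forall x, c <= x <= d -> u x = 0) ->
  0 < delta -> lambda * delta `^ p < Lam p -> d < t0 -> t0 <= d + delta -> t0 <= l ->
  u t0 = 0.
Proof.
move=> E la0 c0 cd u0 de0 dL dt0 t0de t0l.
wlog ut0 : u w E u0 / 0 < u t0.
  move=> H; have [ut|ut|//] := ltgtP (u t0) 0; last exact: (H u w).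
  apply/oppr_inj; rewrite oppr0; apply: (H (fun x => - u x) (fun x => - w x)).
  - exact: edge_eigenN.
  - by move=> x /u0 ->; rewrite oppr0.
  - by rewrite oppr_gt0.
exfalso.
have d0 : 0 <= d by apply: le_trans c0 (ltW cd).
have ud : u d = 0 by rewrite u0// lexx ltW.
have cu : cts d t0 u by apply: cts_sub (W_cts E.1).
(* A negative value would lie between two zeros, d and some z, at distance at most delta, against
   [nodal_gap]. *)
have upos x : d <= x <= t0 -> 0 <= u x.
  move=> /andP[dx xt]; rewrite leNgt; apply/negP => ux.
  have [|z /andP[xz zt] uz] := cts_itv_image cu dx xt (lexx _) (v := 0).
    by rewrite ge_min le_max (ltW ux) (ltW ut0) orbT.
  have dz : d < z.
    rewrite lt_neqAle (le_trans dx xz) andbT; apply/eqP => dz.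
    by move: ux; rewrite (_ : x = d) ?ud ?ltxx//; apply/eqP; rewrite eq_le dx andbT dz.
  have zl : z <= l by exact: le_trans zt t0l.
  have dxz : d <= x <= z by rewrite dx xz.
  have ux0 : u x != 0 by rewrite lt_eqF.
  have := nodal_gap E d0 dz zl ud uz dxz ux0.
  rewrite leNgt (le_lt_trans _ dL)// ler_wpM2l//.
  by apply: ler_powp => //; lra.
have [t tdt tM] := EVT_max (ltW dt0) cu.
move: tdt; rewrite in_itv /= => /andP[dt tt0].
have M0 : 0 < u t by apply: lt_le_trans ut0 _; apply: tM; rewrite in_itv /= lexx ltW.
have {dt} dt : d < t.
  by rewrite lt_neqAle dt andbT; apply/eqP => dE; move: M0; rewrite -dE ud ltxx.
have tl : t <= l by exact: le_trans tt0 t0l.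
have dc0 : 0 < d - c by rewrite subr_gt0.
pose phi x := if x <= d then (d - c)^-1 * x + - (c / (d - c)) else 1 - u x / u t.
pose g x := if x < d then (d - c)^-1 else - (w x / u t).
have W1 : W c d phi g.
  apply: eq_W (W_affine p c d (d - c)^-1 (- (c / (d - c)))) => x /andP[cx xd].
    by rewrite /phi xd.
  by rewrite /g xd.
have W2 : W d t phi g.
  have Wu : W d t u w by apply: W_sub E.1.
  apply: eq_W (W_lin p1 (- (u t)^-1) Wu (W_affine p d t 0 1)) => x /andP[dx xt].
    rewrite /phi; case: ifPn => xd; last by rewrite mul0r add0r mulNr addrC mulrC.
    have -> : x = d by apply/eqP; rewrite eq_le xd dx.
    by rewrite ud mulr0 mul0r !add0r; field; rewrite gt_eqF.
  by rewrite /g ltNge (ltW dx) /= addr0 mulNr mulrC.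
have Wphi := W_cat p1 (ltW cd) (ltW dt) W1 W2.
have phic : phi c = 0 by rewrite /phi (ltW cd); ring.
have phit : phi t = 0 by rewrite /phi leNgt dt /= divff ?subrr// gt_eqF.
have ct : c <= t by rewrite (le_trans (ltW cd))// ltW.
have := edge_eigen_local E c0 ct tl Wphi phic phit.
have Wu : W c t u w by apply: W_sub E.1.
have i1 : itg c t (fun x => flux (w x) * g x).
  by apply: itg_flux => //; [case: Wu|case: Wphi].
(* Although u is zero on [c, d], its derivative w vanishes there only almost everywhere. *)
have w0 : {ae (@lebesgue_measure R), forall x, c < x < d -> w x = 0}.
  have Wcd : W c d u w by exact: W_sub (lexx c) (ltW dt) Wu.
  apply: (W_unique Wcd).
  by apply: eq_W (W_zero p c d) => x // xcd; rewrite u0.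
have mw : measurable_fun `]c, d[ w by case: (W_sub (lexx c) (ltW dt) Wu) => -[].
have -> : II c t (fun x => flux (w x) * g x) = - (u t)^-1 * Pow p d t w.
  rewrite (II_split (ltW cd) (ltW dt) i1).
  have -> : II c d (fun x => flux (w x) * g x) = 0.
    rewrite (@II_ae _ _ _ _ (fun=> 0)) ?II_cst ?mul0r ?ltW//.
      by apply: itg_meas; exact: itg_sub (lexx c) (ltW dt) i1.
    apply: (@filterS _ _ (ae_filter_ringOfSetsType _)) w0 => x wx xcd.
    by rewrite wx// flux0 mul0r.
  rewrite add0r /Pow -IIZ; last by case: (W_sub (ltW cd) (lexx t) Wu) => -[].
  apply: eq_II => x /andP[dx xt]; rewrite /g ltNge (ltW dx) /= -flux_mul//; ring.
move=> e.
have I0 : 0 <= II c t (fun x => flux (u x) * phi x).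
  apply: II_ge0 => x /andP[cx xt]; have [xd|dx] := leP x d.
    have -> : u x = 0 by apply: u0; rewrite (ltW cx) xd.
    by rewrite flux0 mul0r.
  have ux : 0 <= u x by apply: upos; rewrite (ltW dx) (le_trans (ltW xt)).
  rewrite /phi [x <= d]leNgt dx /=; apply: mulr_ge0; first exact: flux_ge0.
  rewrite subr_ge0 ler_pdivrMr// mul1r; apply: tM.
  by rewrite in_itv /= (ltW dx) (le_trans (ltW xt)).
have Pw : Pow p d t w <= 0.
  have : 0 <= - (u t)^-1 * Pow p d t w by rewrite e mulr_ge0.
  by rewrite mulNr oppr_ge0 pmulr_rle0// invr_gt0.
have Wd : W d t u w by exact: W_sub (ltW cd) (lexx t) Wu.
have [[mwd wp] [wi uw]] := Wd.
have := ae_II0 wp (fun x _ => powR_ge0 _ _) Pw => wae.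
have : u t - u d = 0.
  rewrite (uw _ _ (lexx _) (ltW dt) (lexx _)).
  rewrite (@II_ae _ _ _ _ (fun=> 0)) ?II_cst ?mul0r ?ltW//.
  apply: (@filterS _ _ (ae_filter_ringOfSetsType _)) wae => x wx /wx.
  by move=> /powR_eq0_eq0/normr0P/eqP.
by rewrite ud subr0 => ut; move: M0; rewrite ut ltxx.
Qed.

Lemma gap_exists lambda : 0 <= lambda -> exists2 delta, 0 < delta & lambda * delta `^ p < Lam p.
Proof.
move=> la0; have L0 := Lam_gt0 p1.
have l1 : 0 < lambda + 1 by lra.
(* The shift by 1 covers lambda = 0; delta is chosen so that its p-th power is q / 2. *)
pose q := Lam p / (lambda + 1); have q0 : 0 < q by rewrite divr_gt0.
have qE : q * (lambda + 1) = Lam p by rewrite divfK ?gt_eqF.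
have q20 : 0 < q / 2 by rewrite divr_gt0.
exists ((q / 2) `^ p^-1); first by rewrite powR_gt0.
rewrite -powRrM mulVf ?gt_eqF// powRr1; last exact: ltW.
have : 0 <= lambda * q by rewrite mulr_ge0// ltW.
by rewrite -qE; lra.
Qed.

(** The length delta of a continuation step depends on lambda only, so finitely many steps reach
    l. *)
Lemma continuation_right l lambda u w c d : edge_eigen l lambda u w ->
  0 <= lambda -> 0 <= c -> c < d -> (forall x, c <= x <= d -> u x = 0) ->
  forall x, c <= x <= l -> u x = 0.
Proof.
move=> E la0 c0 cd u0 x /andP[cx xl].
have [de de0 deL] := gap_exists la0.
suff H (k : nat) y : c <= y -> y <= l -> y <= d + k%:R * de -> u y = 0.
  apply: (H (Num.truncn ((x - d) / de)).+1) => //.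
  by rewrite -lerBlDl -ler_pdivrMr// ltW// truncnS_gt.
elim: k y => [|k IH] y cy yl; first by rewrite mul0r addr0 => yd; rewrite u0// cy.
rewrite -[k.+1%:R]natr1 mulrDl mul1r => yk.
have [yd|dy] := leP y (d + k%:R * de); first exact: IH.
have kd : 0 <= k%:R * de by rewrite mulr_ge0// ltW.
apply: (continuation_step (c := c) (d := d + k%:R * de) E _ _ _ _ de0) => //; [lra| |lra].
by move=> z /andP[cz zd]; apply: IH => //; lra.
Qed.

(** Reversing the edge reduces continuation to the left to continuation to the right. *)
Lemma edge_eigen_flip l lambda u w : 0 <= l -> edge_eigen l lambda u w ->
  edge_eigen l lambda (u \o aff (-1) l) (fun t => -1 * w (aff (-1) l t)).
Proof.
move=> l0 [Wu H].
have n1 : (-1 : R) < 0 by rewrite oppr_lt0.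
have e0 : aff (-1) l 0 = l by rewrite /aff mulr0 add0r.
have el : aff (-1) l l = 0 by rewrite /aff; ring.
have flipW f g : W 0 l f g -> W 0 l (f \o aff (-1) l) (fun t => -1 * g (aff (-1) l t)).
  by move=> Wf; apply: W_affN => //; rewrite e0 el.
have flipI f : itg 0 l f -> II 0 l (f \o aff (-1) l) = II 0 l f.
  by move=> fi; have := @II_affN _ (-1) l 0 l f n1; rewrite e0 el => ->//; rewrite opprK mul1r.
have invol x : aff (-1) l (aff (-1) l x) = x by rewrite /aff; ring.
split; first exact: flipW.
move=> phi g Wphi z0 zl; have Wphi' := flipW _ _ Wphi.
have := H _ _ Wphi'; rewrite /= e0 el => /(_ zl z0).
rewrite -flipI; last by apply: itg_flux => //; [case: Wu|case: Wphi'].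
rewrite -[in X in _ = lambda * X]flipI; last first.
  by apply: itg_flux => //; apply: cts_Lp => //; [exact: W_cts Wu|exact: W_cts Wphi'].
rewrite (@eq_II _ _ _ _ (fun x => flux (-1 * w (aff (-1) l x)) * g x)); last first.
  by move=> x _; rewrite /= invol !mulN1r fluxN; ring.
by move=> ->; congr (_ * _); apply: eq_II => x _; rewrite /= invol.
Qed.

Lemma unique_continuation l lambda u w c d : edge_eigen l lambda u w ->
  0 <= lambda -> 0 <= c -> c < d -> d <= l -> (forall x, c <= x <= d -> u x = 0) ->
  forall x, 0 <= x <= l -> u x = 0.
Proof.
move=> E la0 c0 cd dl u0 x /andP[x0 xl].
have [cx|xc] := leP c x.
  by apply: (continuation_right E la0 c0 cd u0); rewrite cx.
have l0 : 0 <= l by lra.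
have := continuation_right (edge_eigen_flip l0 E) la0 (c := l - d) (d := l - c) _ _ _ (x := l - x).
rewrite /= /aff => H.
have -> : x = -1 * (l - x) + l by ring.
apply: H; [lra|lra| |lra].
by move=> y /andP[yd yc]; apply: u0; apply/andP; split; lra.
Qed.

End EdgeEigenfunction.

(** * From edges to the graph *)

Section GraphFunctions.
Local Open Scope quotient_scope.
Context {R : realType} (G : metric_graph R).
Implicit Types (e : edge G) (x t : R) (f : graph_space G -> R).

Lemma edge_interval_val e (y : edge_interval e) : 0 <= (\val y : R) <= len e.
Proof. by have := valP y; rewrite inE /= in_itv. Qed.

Lemma val_edge_insubd e x : 0 <= x <= len e ->
  \val (insubd (edge_origin e) x : edge_interval e) = x.
Proof. by move=> xl; apply: insubdK; rewrite inE /= in_itv. Qed.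

Lemma edge_surj (x : graph_space G) :
  exists e t, 0 <= t <= len e /\ x = edge_point e t.
Proof.
exists (projT1 (repr x)), (\val (projT2 (repr x))).
split; first exact: edge_interval_val.
rewrite /edge_point valKd -[LHS]reprK.
by case: (repr x).
Qed.

Definition edge_fun f e x : R := f (edge_point e x).

Lemma edge_fun_cts f e : continuous f -> cts 0 (len e) (edge_fun f e).
Proof.
move=> cf; apply/subspace_sigL_continuousP.
have -> : sigL `[0, len e] (edge_fun f e) =
    f \o (\pi_(graph_space G) : edge_union G -> graph_space G)
      \o existT (@edge_interval R G) e.
  by apply/funext => y; rewrite /edge_fun /edge_point /= valKd.
move=> y; apply: continuous_comp; first exact: existT_continuous.
apply: continuous_comp; first exact: pi_continuous.
exact: cf.
Qed.

Definition lift (F : edge G -> R -> R) (x : graph_space G) : R :=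
  F (projT1 (repr x)) (\val (projT2 (repr x))).

Definition vanishes_at_vertices (F : edge G -> R -> R) :=
  forall e, F e 0 = 0 /\ F e (len e) = 0.

Lemma lift_pi F (y : edge_union G) : vanishes_at_vertices F ->
  lift F (\pi_(graph_space G) y) = F (projT1 y) (\val (projT2 y)).
Proof.
move=> F0; rewrite /lift.
(* At a vertex the glue code no longer records the edge, but there every value is 0; so F factors
   through the code and the chosen representative does not matter. *)
pose Fc (c : vertex G + edge G * R) := if c is inr et then F et.1 et.2 else 0.
have FcE (z : edge_union G) : F (projT1 z) (\val (projT2 z)) = Fc (glue_code z).
  rewrite /glue_code; case: eqP => [->|_]; first by rewrite (F0 _).1.
  by case: eqP => [->|_] //; rewrite (F0 _).2.
rewrite !FcE; congr Fc; apply/eqP; rewrite -/(glue_rel _ _).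
have : \pi_(graph_space G) (repr (\pi_(graph_space G) y)) = \pi_(graph_space G) y by exact: reprK.
by move/eqmodP.
Qed.

Lemma lift_edge F e x : vanishes_at_vertices F -> 0 <= x <= len e ->
  lift F (edge_point e x) = F e x.
Proof. by move=> F0 xl; rewrite lift_pi//= val_edge_insubd. Qed.

Lemma lift_continuous F : vanishes_at_vertices F ->
  (forall e, cts 0 (len e) (F e)) -> continuous (lift F).
Proof.
move=> F0 cF; apply/quotient_continuous.
have -> : lift F \o (\pi_(graph_space G) : edge_union G -> graph_space G) =
   fun y : edge_union G => F (projT1 y) (\val (projT2 y)).
  by apply/funext => y /=; exact: lift_pi.
have := @sigT_continuous (edge G) (@edge_interval R G) _ (fun e y => F e (\val y)).
apply=> e; have /subspace_sigL_continuousP := cF e; exact.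
Qed.

Lemma graph_ext f g : (forall e x, 0 <= x <= len e -> f (edge_point e x) = g (edge_point e x)) ->
  f = g.
Proof. by move=> fg; apply/funext => x; have [e [t [tl ->]]] := edge_surj x; exact: fg. Qed.

End GraphFunctions.

Section GraphSobolev.
Context {R : realType} (G : metric_graph R) (p : R).
Hypothesis p1 : 1 < p.
Implicit Types (e : edge G) (x t : R) (f u : graph_space G -> R).
Local Notation mu := (@lebesgue_measure R).

Lemma weak_derivative_edge f e (g : R -> R) : continuous f ->
  weak_derivative p f e g <-> W p 0 (len e) (edge_fun f e) g.
Proof. by move=> cf; apply: weak_derivative_W => //; exact: edge_fun_cts. Qed.

Lemma sobolevP f : sobolev p f <->
  continuous f /\ forall e, exists g, W p 0 (len e) (edge_fun f e) g.
Proof.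
by split=> -[cf H]; split => // e; have [g Hg] := H e; exists g;
  apply/(weak_derivative_edge e g cf).
Qed.

Lemma sobolev_W f e : sobolev p f -> W p 0 (len e) (edge_fun f e) (wderiv p f e).
Proof.
move=> [cf H]; apply/(weak_derivative_edge e _ cf).
exact: xgetPex (H e).
Qed.

Lemma wderiv_ae f e g : sobolev p f -> W p 0 (len e) (edge_fun f e) g ->
  {ae mu, forall x, 0 < x < len e -> wderiv p f e x = g x}.
Proof. by move=> sf Wg; apply: W_unique Wg; exact: sobolev_W. Qed.

Lemma Pow_ae (a b : R) (g h : R -> R) : measurable_fun `]a, b[ g -> measurable_fun `]a, b[ h ->
  {ae mu, forall x, a < x < b -> g x = h x} -> Pow p a b g = Pow p a b h.
Proof.
move=> mg mh gh; apply: II_ae; [exact: measurable_normp|exact: measurable_normp|].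
by apply: (@filterS _ _ (ae_filter_ringOfSetsType mu)) gh => x gh /gh ->.
Qed.

Lemma integral_Pow (a b : R) (g : R -> R) : itg a b (fun x => `|g x| `^ p) ->
  (\int[mu]_(x in `]a, b[) (`|g x| `^ p)%:E = (Pow p a b g)%:E)%E.
Proof. by move=> gi; rewrite /Pow IIE /Rintegral fineK//; exact: integrable_fin_num. Qed.

Lemma lp_powE f : continuous f ->
  lp_pow p f = (\sum_e Pow p 0 (len e) (edge_fun f e))%:E.
Proof.
move=> cf; rewrite /lp_pow -sumEFin; apply: eq_bigr => e _.
by apply: integral_Pow; apply: cts_Lp_itg => //; exact: edge_fun_cts.
Qed.

(** Frees the energy from the chosen weak derivatives. *)
Lemma energyE f (g : edge G -> R -> R) : sobolev p f ->
  (forall e, W p 0 (len e) (edge_fun f e) (g e)) ->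
  energy p f = (\sum_e Pow p 0 (len e) (g e))%:E.
Proof.
move=> sf Wg; rewrite /energy -sumEFin; apply: eq_bigr => e _.
have [[mw wi] _] := sobolev_W e sf; have [[mg _] _] := Wg e.
rewrite (integral_Pow wi); congr (_%:E); apply: (Pow_ae mw mg).
exact: wderiv_ae.
Qed.

Lemma lift_sobolev (F g : edge G -> R -> R) : vanishes_at_vertices F ->
  (forall e, W p 0 (len e) (F e) (g e)) ->
  sobolev p (lift F) /\ forall e, W p 0 (len e) (edge_fun (lift F) e) (g e).
Proof.
move=> F0 WF.
have H e : W p 0 (len e) (edge_fun (lift F) e) (g e).
  by apply: eq_W (WF e) => // x xl; rewrite /edge_fun lift_edge.
split => //; apply/sobolevP; split; last by move=> e; exists (g e).
by apply: lift_continuous => // e; exact: W_cts (WF e).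
Qed.

(** A test function on one edge that vanishes at its ends is extended by zero to the other edges. *)
Lemma eigen_edge lambda u e : is_eigenfunction p lambda u ->
  edge_eigen p (len e) lambda (edge_fun u e) (wderiv p u e).
Proof.
move=> [su _ H]; split; first exact: sobolev_W.
move=> phi g Wphi z0 zl.
pose F e' := if e' == e then phi else (fun=> 0).
pose g' e' := if e' == e then g else (fun=> 0).
have F0 : vanishes_at_vertices F by move=> e'; rewrite /F; case: eqP => [->|_].
have WF e' : W p 0 (len e') (F e') (g' e').
  by rewrite /F /g'; case: eqP => [->//|_]; exact: W_zero.
have [sF WF'] := lift_sobolev F0 WF.
have := H _ sF.
have flux0 : flux p 0 = 0 by rewrite /flux mulr0.
have E1 e' : \int[mu]_(x in `]0, len e'[)
    (`|wderiv p u e' x| `^ (p - 2) * wderiv p u e' x * wderiv p (lift F) e' x)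
    = II 0 (len e') (fun x => flux p (wderiv p u e' x) * g' e' x).
  have Lu : Lp p 0 (len e') (wderiv p u e') by case: (sobolev_W e' su).
  have LF : Lp p 0 (len e') (wderiv p (lift F) e') by case: (sobolev_W e' sF).
  have Lg : Lp p 0 (len e') (g' e') by case: (WF e').
  rewrite -(IIE 0 (len e') (fun x => flux p (wderiv p u e' x) * wderiv p (lift F) e' x)).
  apply: II_ae; [exact: (itg_meas (itg_flux p1 Lu LF))|exact: (itg_meas (itg_flux p1 Lu Lg))|].
  have := wderiv_ae sF (WF' e').
  by apply: (@filterS _ _ (ae_filter_ringOfSetsType mu)) => x Hx /Hx ->.
have E2 e' : \int[mu]_(x in `]0, len e'[)
    (`|u (edge_point e' x)| `^ (p - 2) * u (edge_point e' x) * lift F (edge_point e' x))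
    = II 0 (len e') (fun x => flux p (edge_fun u e' x) * F e' x).
  by rewrite -IIE; apply: eq_II => x /andP[x0 xl]; rewrite lift_edge// !ltW.
under eq_bigr do rewrite E1; under [in RHS]eq_bigr do rewrite E2.
have len0 e' : 0 <= len e' by exact/ltW/len_gt0.
rewrite (bigD1 e)//= [in RHS](bigD1 e)//= /g' /F eqxx big1 ?[in RHS]big1 ?addr0//.
- by move=> e' /negbTE ->; rewrite (@eq_II _ _ _ _ (fun=> 0)) ?II_cst ?mul0r// => x _; rewrite mulr0.
- by move=> e' /negbTE ->; rewrite (@eq_II _ _ _ _ (fun=> 0)) ?II_cst ?mul0r// => x _; rewrite mulr0.
Qed.

End GraphSobolev.

(** * Counting nodal domains *)

Section FiniteCounting.
Variables (I : finType) (T : choiceType).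

Lemma card_fset_set_ge (A : set T) (f : I -> T) : finite_set A -> injective f ->
  (forall i, A (f i)) -> (#|I| <= #|` fset_set A|)%N.
Proof.
move=> fA fi Af; rewrite cardE -(size_map f).
apply: uniq_leq_size; first by rewrite map_inj_uniq// enum_uniq.
by move=> _ /mapP[i _ ->]; rewrite in_fset_set// inE.
Qed.

Lemma card_fset_set_le (A : set T) (f : I -> T) : (forall x, A x -> exists i, x = f i) ->
  finite_set A /\ (#|` fset_set A| <= #|I|)%N.
Proof.
move=> Af; have fA : finite_set A.
  apply: (@sub_finite_set _ _ [set` map f (enum I)]); last exact: finite_seq.
  by move=> x /Af[i ->] /=; apply/mapP; exists i; rewrite ?mem_enum.
split => //; rewrite cardE -(size_map f); apply: uniq_leq_size; first exact: fset_uniq.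
move=> x; rewrite in_fset_set// inE => /Af[i ->]; by apply/mapP; exists i; rewrite ?mem_enum.
Qed.

End FiniteCounting.

Section Components.
Local Open Scope quotient_scope.
Context {R : realType} (G : metric_graph R).
Implicit Types (u v : graph_space G -> R) (e : edge G).

(** Within the component the open condition v <> 0 and the closed condition v = u describe the same
    nonempty set, so connectedness makes it the whole component. With v a truncation of u this
    separates nodal domains. *)
Lemma component_closure_eq u v x : continuous u -> continuous v ->
  (forall y, v y = u y \/ v y = 0) -> v x != 0 ->
  closure (connected_component [set y | u y != 0] x) `<=` [set y | v y = u y].
Proof.
move=> cu cv uv vx.
set N := [set y | u y != 0]; set C := connected_component N x.
have ux : u x != 0 by case: (uv x) => E; [rewrite -E|rewrite E eqxx in vx].
have Cx : C x by exact: connected_component_refl.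
have CN : C `<=` N by exact: connected_component_sub.
have openv : open [set y | v y != 0].
  by apply: (@open_comp _ _ v [set r | r != 0]) => [y _|]; [exact: cv|exact: open_neq].
have closeduv : closed [set y | v y = u y].
  rewrite (_ : [set y | v y = u y] = (fun y => v y - u y) @^-1` [set 0]).
    apply: closed_comp => [y _|]; last exact: closed_eq.
    by apply: (@continuousB _ _ _ v u); [exact: cv|exact: cu].
  by apply/seteqP; split => y /=; [move=> ->; rewrite subrr|move/eqP; rewrite subr_eq0 => /eqP].
have E : C `&` [set y | v y != 0] = C.
  apply: (@component_connected _ N x).
  - by exists x.
  - by exists [set y | v y != 0].
  - exists [set y | v y = u y] => //; apply/seteqP; split => y [Cy /= Hy]; split => //=.
      by case: (uv y) => // vy; rewrite vy eqxx in Hy.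
    by rewrite Hy; exact: CN.
rewrite -/C => y; have /closure_id -> := closeduv; apply: closure_subset => {}y Cy.
by move: Cy; rewrite -E => -[_ /= vy]; case: (uv y) => // vy0; rewrite vy0 eqxx in vy.
Qed.

Lemma edge_point_within e a b : 0 <= a -> b <= len e ->
  {within `[a, b], continuous (@edge_point R G e)}.
Proof.
move=> a0 bl.
apply: (@continuous_subspaceW _ _ _ `[0, len e]%classic).
  move=> x /=; rewrite !in_itv /= => /andP[ax xb].
  by rewrite (le_trans a0 ax) (le_trans xb bl).
apply/subspace_sigL_continuousP.
have -> : sigL `[0, len e] (edge_point e) =
    (\pi_(graph_space G) : edge_union G -> graph_space G)
      \o existT (@edge_interval R G) e.
  by apply/funext => y; rewrite /edge_point /= valKd.
by move=> y; apply: continuous_comp; [exact: existT_continuous|exact: pi_continuous].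
Qed.

Lemma same_component u e a b : 0 <= a -> a <= b -> b <= len e ->
  (forall x, a <= x <= b -> u (edge_point e x) != 0) ->
  connected_component [set y | u y != 0] (edge_point e a) =
  connected_component [set y | u y != 0] (edge_point e b).
Proof.
move=> a0 ab bl ue; apply: same_connected_component.
have aab : `[a, b]%classic a by rewrite /= in_itv /= lexx.
have bab : `[a, b]%classic b by rewrite /= in_itv /= lexx andbT.
apply: (@connected_component_max _ _ (edge_point e @` `[a, b])).
- by apply: imageP; exact: aab.
- by move=> y [x]; rewrite /= in_itv /= => xab <-; exact: ue.
- apply: connected_continuous_connected; last exact: edge_point_within.
  exact: segment_connected.
- by apply: imageP; exact: bab.
Qed.

End Components.

Section NodalCount.
Context {R : realType} (G : metric_graph R) (p : R).
Hypothesis p1 : 1 < p.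
Variables (lambda : R) (u : graph_space G -> R).
Hypothesis la0 : 0 < lambda.
Hypothesis eig : is_eigenfunction p lambda u.

Let p0 : 0 < p. Proof. exact: lt_trans p1. Qed.

Definition active_edges : {set edge G} :=
  [set e : edge G | `[< exists2 x, 0 <= x <= len e & u (edge_point e x) != 0 >]]%SET.

Lemma active_edgesP e : reflect (exists2 x, 0 <= x <= len e & u (edge_point e x) != 0)
  (e \in active_edges).
Proof. by rewrite inE; exact: asboolP. Qed.

Lemma active_edges_neq0 : active_edges != finset.set0.
Proof.
have [_ [x ux] _] := eig; have [e [t [tl xE]]] := edge_surj x.
by apply/finset.set0Pn; exists e; apply/active_edgesP; exists t; rewrite -?xE.
Qed.

Let cu : continuous u. Proof. by have [[]] := eig. Qed.

Let N := [set y | u y != 0].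

(** By [nodal_gap] a cell of length S cannot contain zeros on both sides of a point where u is
    nonzero. Such a point is therefore joined to an end of its cell without meeting a zero, and
    every nodal domain contains a grid point. Finiteness is stated too because [nodal_count] would
    be 0 on an infinite set. *)
Lemma nodal_upper S : 0 < S -> lambda * S `^ p < Lam p ->
  finite_set (nodal_domains u) /\
  (nodal_count u <= \sum_(e in active_edges) (Num.truncn (len e / S)).+2)%N.
Proof.
move=> S0 LS.
(* The grid has the indices 0 to [Num.truncn (len e / S) + 1]; the last cell may stick out and is
   cut off at [len e] in [y]. *)
pose k e := if e \in active_edges then (Num.truncn (len e / S)).+2 else 0%N.
pose I := {e : edge G & 'I_(k e)}.
pose y (i : I) := edge_point (tag i) (Num.min ((tagged i)%:R * S) (len (tag i))).
have H D : nodal_domains u D -> exists i : I, D = closure (connected_component N (y i)).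
  move=> [x ux <-]; have [e [t [/andP[t0 tl] xE]]] := edge_surj x.
  have ut : edge_fun u e t != 0 by rewrite /edge_fun -xE.
  have E := eigen_edge p1 e eig.
  have ea : e \in active_edges by apply/active_edgesP; exists t; rewrite ?t0.
  pose j := Num.truncn (t / S).
  have /andP[jt tj] : j%:R <= t / S < j.+1%:R by apply: truncn_itv; rewrite divr_ge0// ltW.
  rewrite ler_pdivlMr// in jt; rewrite ltr_pdivrMr// in tj.
  have jk : (j.+1 < k e)%N.
    rewrite /k ea !ltnS le_truncn// ler_pM2r ?invr_gt0//.
  have jk' : (j < k e)%N by exact: ltnW.
  have yE i (ik : (i < k e)%N) :
    y (existT _ e (Ordinal ik)) = edge_point e (Num.min (i%:R * S) (len e)) by [].
  pose a := j%:R * S; pose b := Num.min (j.+1%:R * S) (len e).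
  have a0 : 0 <= a by rewrite mulr_ge0// ltW.
  have tb : t <= b by rewrite le_min (ltW tj).
  have bl : b <= len e by rewrite ge_min lexx orbT.
  have [ha|] := pselect (forall x, a <= x <= t -> u (edge_point e x) != 0).
    exists (existT _ e (Ordinal jk')); rewrite yE min_l ?(le_trans jt)// xE.
    by congr (closure _); apply/esym/same_component.
  have [hb _|] := pselect (forall x, t <= x <= b -> u (edge_point e x) != 0).
    exists (existT _ e (Ordinal jk)); rewrite yE xE.
    by congr (closure _); apply: same_component.
  move=> /existsNP[z2 /not_implyP[/andP[tz z2b] /negP/negPn/eqP uz2]].
  move=> /existsNP[z1 /not_implyP[/andP[az z1t] /negP/negPn/eqP uz1]].
  exfalso.
  have z1t' : z1 < t.
    rewrite lt_neqAle z1t andbT; apply/eqP => zt; by move: ut; rewrite -zt /edge_fun uz1 eqxx.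
  have tz' : t < z2.
    rewrite lt_neqAle tz andbT; apply/eqP => zt; by move: ut; rewrite zt /edge_fun uz2 eqxx.
  have z12 : z1 < z2 by exact: lt_trans tz'.
  have := nodal_gap p1 E (le_trans a0 az) z12 (le_trans z2b bl) uz1 uz2 _ ut.
  rewrite (ltW z1t') (ltW tz') => /(_ isT); rewrite leNgt => /negP; apply.
  apply: le_lt_trans LS; rewrite ler_pM2l//; apply: ler_powp => //; first lra.
  have : b <= a + S by rewrite /b ge_min -natr1 mulrDl mul1r lexx.
  by rewrite /a in az *; lra.
have [fD cD] := card_fset_set_le H.
split => //; apply: leq_trans cD _; rewrite card_tagged sumnE big_map big_enum /=.
rewrite [leqRHS]big_mkcond /=; apply: leq_sum => e _.
by rewrite card_ord.
Qed.


(** [oscillation] puts a zero z j between j S and j S + S1, and S1 < S makes these zeros strictly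
    increasing. By unique continuation u is nonzero somewhere between neighbours. With m zeros there
    are m - 1 gaps, hence the condition on [j.+1]. *)
Lemma edge_cells S1 S e : 0 < S1 -> S1 < S -> Lam p < lambda * S1 `^ p ->
  e \in active_edges ->
  exists z t : nat -> R, forall j, (j.+1 < Num.truncn (len e / S))%N ->
    [/\ 0 <= z j /\ z j.+1 <= len e, z j < t j < z j.+1,
        edge_fun u e (z j) = 0 /\ edge_fun u e (z j.+1) = 0,
        edge_fun u e (t j) != 0 &
        forall i, (i < j)%N -> z i.+1 <= z j].
Proof.
move=> S10 S1S LS /active_edgesP[x0 x0l ux0].
have S0 : 0 < S by exact: lt_trans S1S.
have E := eigen_edge p1 e eig.
set m := Num.truncn (len e / S).
have mS : m%:R * S <= len e.
  by rewrite -ler_pdivlMr// truncn_le// divr_ge0// ltW// len_gt0.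
have /choice[z Hz] : forall j, exists r : R, (j < m)%N ->
    j%:R * S <= r <= j%:R * S + S1 /\ edge_fun u e r = 0.
  move=> j; have [jm|jm] := boolP (j < m)%N; last by exists 0.
  have jS : j.+1%:R * S <= len e by apply: le_trans mS; rewrite ler_pM2r// ler_nat.
  rewrite -natr1 mulrDl mul1r in jS.
  have j0 : 0 <= j%:R * S by rewrite mulr_ge0// ltW.
  have [||||x xz uz] := @oscillation _ _ p1 _ _ _ _ (j%:R * S) (j%:R * S + S1) E.
  - exact: j0.
  - by rewrite ltrDl.
  - lra.
  - by rewrite addrAC subrr add0r.
  by exists x.
have zz j : (j.+1 < m)%N -> z j < z j.+1.
  move=> jm; have [/andP[_ h1] _] := Hz j (ltnW jm); have [/andP[h2 _] _] := Hz _ jm.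
  by rewrite -natr1 mulrDl mul1r in h2; lra.
have zrange j : (j < m)%N -> 0 <= z j /\ z j <= len e.
  move=> jm; have [/andP[h1 h2] _] := Hz j jm; split.
    by apply: le_trans h1; rewrite mulr_ge0// ltW.
  have : j.+1%:R * S <= len e by apply: le_trans mS; rewrite ler_pM2r// ler_nat.
  by rewrite -natr1 mulrDl mul1r; lra.
have /choice[t Ht] : forall j, exists r : R, (j.+1 < m)%N ->
    z j < r < z j.+1 /\ edge_fun u e r != 0.
  move=> j; have [jm|jm] := boolP (j.+1 < m)%N; last by exists 0.
  have [z0 _] := zrange j (ltnW jm); have [_ zl] := zrange _ jm.
  apply: contrapT => /forallNP no.
  have u0 x : z j <= x <= z j.+1 -> edge_fun u e x = 0.
    move=> /andP[zx xz]; have [<-|zx'] := eqVneq (z j) x; first by case: (Hz j (ltnW jm)).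
    have [->|xz'] := eqVneq x (z j.+1); first by case: (Hz j.+1 jm).
    apply/eqP; apply: contrapT => /negP ux; apply: (no x) => _; split => //.
    by rewrite !lt_neqAle zx' zx xz' xz.
  have := unique_continuation p1 E (ltW la0) z0 (zz j jm) zl u0 x0l.
  by move/eqP; rewrite (negbTE ux0).
exists z, t => j jm; have [tj utj] := Ht j jm.
split => //.
- by split; [case: (zrange j (ltnW jm))|case: (zrange _ jm)].
- by split; [case: (Hz j (ltnW jm))|case: (Hz _ jm)].
move=> i ij; elim: j ij jm {tj utj} => [//|j IH]; rewrite ltnS leq_eqVlt => /predU1P[->//|ij] jm.
by apply: le_trans (IH ij (ltnW jm)) _; apply/ltW/zz; exact: ltnW.
Qed.

(** Replacing u by 0 outside one gap between zeros leaves a continuous function [v i], equal to u or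
    0 everywhere, nonzero at [q i] and zero at the other [q i']. By [component_closure_eq] the
    closure of the component of [q i] then misses every other [q i'], so different gaps give
    different nodal domains. *)
Lemma nodal_lower S1 S : 0 < S1 -> S1 < S -> Lam p < lambda * S1 `^ p ->
  finite_set (nodal_domains u) ->
  (\sum_(e in active_edges) (Num.truncn (len e / S)).-1 <= nodal_count u)%N.
Proof.
move=> S10 S1S LS fD.
have /choice[zt Hzt] : forall e, exists zt : (nat -> R) * (nat -> R), e \in active_edges ->
   forall j, (j.+1 < Num.truncn (len e / S))%N ->
    [/\ 0 <= zt.1 j /\ zt.1 j.+1 <= len e, zt.1 j < zt.2 j < zt.1 j.+1,
        edge_fun u e (zt.1 j) = 0 /\ edge_fun u e (zt.1 j.+1) = 0,
        edge_fun u e (zt.2 j) != 0 &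
        forall i, (i < j)%N -> zt.1 i.+1 <= zt.1 j].
  move=> e; have [ea|ea] := boolP (e \in active_edges); last first.
    by exists (fun=> 0, fun=> 0).
  by have [z [t H]] := edge_cells S10 S1S LS ea; exists (z, t).
pose k e := if e \in active_edges then (Num.truncn (len e / S)).-1 else 0%N.
pose I := {e : edge G & 'I_(k e)}.
have Ik (i : I) : tag i \in active_edges /\ ((tagged i).+1 < Num.truncn (len (tag i) / S))%N.
  case: i => e j; have : (nat_of_ord j < k e)%N by exact: ltn_ord.
  rewrite /=; move: (nat_of_ord j) => {}j; rewrite /k; case: ifP => // ea h; split => //.
  by move: h; case: (Num.truncn _).
pose zl (i : I) := (zt (tag i)).1 (tagged i).
pose zr (i : I) := (zt (tag i)).1 (tagged i).+1.
pose tt (i : I) := (zt (tag i)).2 (tagged i).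
have Hi (i : I) := Hzt _ (Ik i).1 _ (Ik i).2.
have tl (i : I) : 0 <= tt i <= len (tag i).
  have [[z0 zl'] /andP[zt' tz'] _ _ _] := Hi i.
  by rewrite (le_trans z0 (ltW zt')) (le_trans (ltW tz') zl').
pose F (i : I) e x := if e == tag i then if zl i <= x <= zr i then edge_fun u (tag i) x else 0 else 0.
have FW (i : I) e : exists g, W p 0 (len e) (F i e) g.
  rewrite /F; case: (eqVneq e (tag i)) => [->|_]; last by exists (fun=> 0); exact: W_zero.
  have [[z0 zl'] /andP[zt' tz'] [uz uz'] _ _] := Hi i.
  have [Wu _] := eigen_edge p1 (tag i) eig.
  have zlr : zl i <= zr i by rewrite ltW// (lt_trans zt' tz').
  eexists; apply: (W_extend p1 z0 zlr zl' _ uz uz').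
  exact: W_sub z0 zl' Wu.
have F0 (i : I) : vanishes_at_vertices (F i).
  move=> e; rewrite /F; case: eqP => [->|_//].
  have [[z0 zl'] /andP[zt' tz'] [uz uz'] _ _] := Hi i.
  split.
    case: ifP => // /andP[z0' _]; rewrite -[RHS]uz; congr (edge_fun u _ _).
    by apply/eqP; rewrite eq_le z0 z0'.
  case: ifP => // /andP[_ zl'']; rewrite -[RHS]uz'; congr (edge_fun u _ _).
  by apply/eqP; rewrite eq_le zl' zl''.
pose v i := lift (F i).
have cv i : continuous (v i).
  by apply: lift_continuous => // e; have [g Wg] := FW i e; exact: W_cts Wg.
have uv i y : v i y = u y \/ v i y = 0.
  have [e [t [tle ->]]] := edge_surj y; rewrite /v lift_edge// /F.
  by case: eqP => [->|_]; [case: ifP => _; [left|right]|right].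
pose q (i : I) := edge_point (tag i) (tt i).
have uq i : u (q i) != 0 by have [_ _ _] := Hi i.
have vq i : v i (q i) != 0.
  have [_ /andP[zt' tz'] _ ut _] := Hi i.
  by rewrite /v /q lift_edge// /F eqxx /zl /zr (ltW zt') (ltW tz').
have vq' i i' : i != i' -> v i (q i') = 0.
  move=> ii; rewrite /v /q lift_edge// /F; case: eqP => // ee; case: ifP => // zz.
  exfalso; move/eqP: ii; apply.
  have [_ /andP[h1 h2] _ _ mono] := Hi i.
  have [_ /andP[h1' h2'] _ _ mono'] := Hi i'.
  case: i i' ee zz h1 h2 mono h1' h2' mono' => [e j] [e' j'] /= ee.
  subst e; rewrite /zl /zr /tt /= => zz h1 h2 mono h1' h2' mono'.
  congr (existT _ _ _); apply/val_inj => /=; apply/eqP; rewrite eqn_leq; apply/andP; split.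
    rewrite leqNgt; apply/negP => /mono A; case/andP: zz => zz _.
    by have := le_trans A zz; rewrite leNgt h2'.
  rewrite leqNgt; apply/negP => /mono' A; case/andP: zz => _ zz.
  by have := le_trans zz A; rewrite leNgt h1'.
pose f (i : I) := closure (connected_component N (q i)).
have finj : injective f.
  move=> i i' ff; apply/eqP/negPn/negP => ii.
  have : f i (q i') by rewrite ff; apply: subset_closure; apply: connected_component_refl; exact: uq.
  move=> /(component_closure_eq cu (cv i) (uv i) (vq i)) /=.
  by rewrite vq'// => /esym/eqP; rewrite (negbTE (uq i')).
have := card_fset_set_ge fD finj (fun i => ex_intro2 _ _ (q i) (uq i) erefl).
apply: leq_trans; rewrite card_tagged sumnE big_map big_enum /=.
rewrite [leqLHS]big_mkcond /=; apply: leq_sum => e _.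
by rewrite card_ord.
Qed.

End NodalCount.

(** * Weyl bounds *)

Section PointwiseBound.
Context {R : realType} (p : R).
Hypothesis p1 : 1 < p.
Implicit Types (f g : R -> R).

Let p0 : 0 < p. Proof. exact: lt_trans p1. Qed.

(** Stands in for Hölder's inequality: an L^1 norm is traded for a small constant and a multiple of
    the integral of the p-th power. *)
Lemma norm_le_powp (e t : R) : 0 < e -> `|t| <= e + e `^ (1 - p) * `|t| `^ p.
Proof.
move=> e0; have [te|et] := leP `|t| e.
  by rewrite (le_trans te)// lerDl mulr_ge0// powR_ge0.
apply: (@le_trans _ _ (e `^ (1 - p) * `|t| `^ p)); last by rewrite lerDr ltW.
have t0 : 0 < `|t| by exact: lt_trans et.
rewrite -(@mulr_powRB1 _ `|t| p)// mulrCA ler_peMr//.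
rewrite -opprB powRN ler_pdivlMl ?powR_gt0// mulr1.
by apply: ge0_ler_powR; rewrite ?nnegrE ?subr_ge0 ?ltW.
Qed.

Lemma II_norm_le_Pow a b f e : 0 < e -> a <= b -> Lp p a b f ->
  II a b (fun x => `|f x|) <= e * (b - a) + e `^ (1 - p) * Pow p a b f.
Proof.
move=> e0 ab [mf fp].
have -> : e * (b - a) + e `^ (1 - p) * Pow p a b f =
    II a b (fun x => e + e `^ (1 - p) * `|f x| `^ p).
  rewrite IID; [|exact: itg_cst|exact: itgZ].
  by rewrite II_cst// IIZ.
apply: II_le.
- by apply: itg_norm; apply: (Lp_itg p1).
- by apply: itgD; [exact: itg_cst|exact: itgZ].
- by move=> x _; exact: norm_le_powp.
Qed.

(** |f x| is at most the mean of |f| plus the L^1 norm of g. The parameter e makes the first term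
    small before the Sobolev norm has to be. *)
Lemma pointwise_bound l f g e x : 0 < l -> 0 < e -> W p 0 l f g -> 0 <= x <= l ->
  `|f x| <= e * (1 + l) + e `^ (1 - p) * (Pow p 0 l f / l + Pow p 0 l g).
Proof.
move=> l0 e0 Wf /andP[x0 xl]; have [Gg [gi fg]] := Wf.
have Lf := cts_Lp p1 (W_cts Wf); have fi := Lp_itg p1 Lf.
set J := II 0 l (fun x => `|g x|).
have step y : 0 <= y <= l -> `|f x| <= `|f y| + J.
  move=> /andP[y0 yl].
  suff : `|f x - f y| <= J.
    by have := ler_normD (f y) (f x - f y); rewrite (addrC (f y)) subrK; lra.
  wlog xy : x y x0 xl y0 yl / x <= y.
    by move=> H; have [xy|/ltW yx] := leP x y; [exact: H|rewrite distrC; exact: H].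
  rewrite distrC fg//; have gxy : itg x y g by exact: itg_sub gi.
  apply: (le_trans (II_norm gxy)); rewrite /J.
  have gyl : itg x l (fun x => `|g x|) by apply: itg_sub (itg_norm gi).
  rewrite (II_split x0 xl (itg_norm gi)) (II_split xy yl gyl).
  have h1 : 0 <= II 0 x (fun x => `|g x|) by apply: II_ge0.
  have h2 : 0 <= II y l (fun x => `|g x|) by apply: II_ge0.
  lra.
have avg : l * `|f x| <= II 0 l (fun x => `|f x|) + l * J.
  have -> : l * `|f x| = II 0 l (fun=> `|f x|) by rewrite II_cst ?ltW// subr0 mulrC.
  have -> : II 0 l (fun x => `|f x|) + l * J = II 0 l (fun x => `|f x| + J).
    by rewrite IID; [rewrite II_cst ?ltW// subr0 (mulrC J)|exact: itg_norm|exact: itg_cst].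
  apply: II_le; [exact: itg_cst|by apply: itgD; [exact: itg_norm|exact: itg_cst]|].
  by move=> y /andP[y0 yl]; apply: step; rewrite !ltW.
have h1 := II_norm_le_Pow e0 (ltW l0) Lf; have h2 := II_norm_le_Pow e0 (ltW l0) Gg.
rewrite subr0 in h1 h2; rewrite -(ler_pM2l l0); apply: (le_trans avg).
apply: (le_trans (lerD h1 (_ : _ <= l * (e * l + e `^ (1 - p) * Pow p 0 l g)))).
  by rewrite ler_pM2l.
rewrite le_eqVlt; apply/orP; left; apply/eqP.
move: (e `^ (1 - p)) (Pow p 0 l f) (Pow p 0 l g) => y F D; field.
by rewrite gt_eqF.
Qed.

(** [Lam_le] on each of the m cells, summed up. *)
Lemma edge_energy_lower l h (m : nat) f g : 0 < l -> (0 < m)%N -> l / m%:R <= h ->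
  W p 0 l f g -> (forall i : nat, (i <= m)%N -> f (i%:R * (l / m%:R)) = 0) ->
  Lam p * Pow p 0 l f <= h `^ p * Pow p 0 l g.
Proof.
move=> l0 m0 lh Wf f0; set d := l / m%:R in lh f0 *.
have d0 : 0 < d by rewrite divr_gt0// ltr0n.
have md : m%:R * d = l by rewrite mulrC divfK// pnatr_eq0 -lt0n.
suff H (i : nat) : (i <= m)%N ->
    Lam p * Pow p 0 (i%:R * d) f <= h `^ p * Pow p 0 (i%:R * d) g.
  by have := H m (leqnn _); rewrite md.
elim: i => [|i IH] im.
  by rewrite mul0r /Pow !II_geq// !mulr0.
have {}IH := IH (ltnW im).
have i0 : 0 <= i%:R * d by rewrite mulr_ge0// ltW.
have il : i.+1%:R * d <= l by rewrite -md ler_pM2r// ler_nat.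
have e : i.+1%:R * d = i%:R * d + d by rewrite -natr1 mulrDl mul1r.
have idid : i%:R * d < i.+1%:R * d by rewrite e ltrDl.
have Wi : W p (i%:R * d) (i.+1%:R * d) f g by apply: W_sub Wf.
have := Lam_le p1 Wi idid (f0 _ (ltnW im)) (f0 _ im).
have -> : i.+1%:R * d - i%:R * d = d by rewrite e addrAC subrr add0r.
move=> L.
have W0 : W p 0 (i.+1%:R * d) f g by apply: W_sub Wf.
have fi := cts_Lp_itg p1 (W_cts W0).
have [[_ gi] _] := W0.
rewrite /Pow (II_split i0 (ltW idid) fi) (II_split i0 (ltW idid) gi) !mulrDr; apply: lerD; first exact: IH.
apply: (le_trans L); apply: ler_wpM2r; first exact: Pow_ge0.
by apply: ler_powp => //; exact: ltW.
Qed.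

End PointwiseBound.

(** * Lower bound on the eigenvalues, by point evaluations *)

Section WeylLower.
Context {R : realType} (G : metric_graph R) (p : R).
Hypothesis p1 : 1 < p.
Implicit Types (f d : graph_space G -> R) (e : edge G).

Let p0 : 0 < p. Proof. exact: lt_trans p1. Qed.

Lemma min_length_gt0 : 0 < min_length G.
Proof. exact: len_gt0. Qed.

Lemma min_length_le e : min_length G <= len e.
Proof. by rewrite /min_length; case: arg_minP => // i _; apply. Qed.

Lemma len_le_total e : len e <= total_length G.
Proof. by rewrite /total_length (bigD1 e)//= lerDl sumr_ge0// => e' _; exact/ltW/len_gt0. Qed.

Lemma total_length_gt0 : 0 < total_length G.
Proof. by apply: lt_le_trans (len_le_total (some_edge G)); exact: len_gt0. Qed.

Lemma sobolev_norm_lt d delta : sobolev p d -> 0 < delta ->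
  (sobolev_norm p d < delta%:E)%E <->
  \sum_e Pow p 0 (len e) (edge_fun d e) + \sum_e Pow p 0 (len e) (wderiv p d e) < delta `^ p.
Proof.
move=> sd de0; rewrite /sobolev_norm (lp_powE p1 sd.1).
rewrite (energyE p1 sd (fun e => sobolev_W p1 e sd)) -EFinD poweR_EFin lte_fin.
set s := _ + _; have s0 : 0 <= s by rewrite addr_ge0// sumr_ge0// => e _; exact: Pow_ge0.
split=> h.
  have := gt0_ltr_powR p0; move=> /(_ (s `^ p^-1) delta).
  rewrite !nnegrE powR_ge0 (ltW de0) => /(_ isT isT h).
  by rewrite -powRrM mulVf ?gt_eqF// powRr1.
have pi0 : 0 < p^-1 by rewrite invr_gt0.
have := gt0_ltr_powR pi0; move=> /(_ s (delta `^ p)).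
rewrite !nnegrE powR_ge0 s0 => /(_ isT isT h).
by rewrite -powRrM mulfV ?gt_eqF// powRr1// ltW.
Qed.

Lemma sobolev_point eps : 0 < eps -> exists2 delta : R, 0 < delta &
  forall d, sobolev p d -> (sobolev_norm p d < delta%:E)%E -> forall x, `|d x| < eps.
Proof.
move=> e0; have e4 : eps / 4 + eps / 4 < eps by lra.
have L0 := total_length_gt0; have m0 := min_length_gt0.
(* With e' the first term of [pointwise_bound] is at most eps / 4, and taking eps / (4 K) for the
   p-th power of delta does the same for the second. *)
pose e' := eps / (4 * (1 + total_length G)).
have e'0 : 0 < e' by rewrite divr_gt0// mulr_gt0//; lra.
pose K := e' `^ (1 - p) * (1 + (min_length G)^-1).
have K0 : 0 < K by rewrite mulr_gt0 ?powR_gt0// addr_gt0// invr_gt0.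
exists ((eps / (4 * K)) `^ p^-1); first by rewrite powR_gt0// divr_gt0// mulr_gt0.
move=> d sd; rewrite sobolev_norm_lt//; last by rewrite powR_gt0// divr_gt0// mulr_gt0.
rewrite -powRrM mulVf ?gt_eqF// powRr1; last by rewrite divr_ge0// ltW// mulr_gt0.
move=> dn x; have [e [t [tl ->]]] := edge_surj x.
have Wd := sobolev_W p1 e sd; have l0 := len_gt0 e.
apply: le_lt_trans (pointwise_bound p1 l0 e'0 Wd tl) _.
set D := eps / (4 * K) in dn.
have sge0 (F : edge G -> R -> R) e1 : Pow p 0 (len e1) (F e1) <= \sum_e Pow p 0 (len e) (F e).
  by rewrite (bigD1 e1)//= lerDl sumr_ge0// => e2 _; exact: Pow_ge0.
have A1 : Pow p 0 (len e) (edge_fun d e) <= D.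
  apply: (le_trans (sge0 (edge_fun d) e)); apply: le_trans (ltW dn).
  by rewrite lerDl sumr_ge0// => e2 _; exact: Pow_ge0.
have A2 : Pow p 0 (len e) (wderiv p d e) <= D.
  apply: (le_trans (sge0 (wderiv p d) e)); apply: le_trans (ltW dn).
  by rewrite lerDr sumr_ge0// => e2 _; exact: Pow_ge0.
have D0 : 0 < D by rewrite divr_gt0// mulr_gt0.
have B1 : e' * (1 + len e) <= eps / 4.
  have -> : eps / 4 = e' * (1 + total_length G) by rewrite /e' invfM mulrA divfK// lt0r_neq0// addr_gt0.
  by rewrite ler_pM2l// lerD2l len_le_total.
have B2 : e' `^ (1 - p) * (Pow p 0 (len e) (edge_fun d e) / len e + Pow p 0 (len e) (wderiv p d e))
   <= K * D.
  rewrite /K -mulrA ler_pM2l ?powR_gt0// addrC mulrDl mul1r lerD// mulrC.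
  apply: ler_pM; [by rewrite invr_ge0 ltW|exact: Pow_ge0| |exact: A1].
  by rewrite lef_pV2 ?posrE// min_length_le.
have KD : K * D = eps / 4 by rewrite /D; clearbody K; field; rewrite gt_eqF.
by apply: (le_lt_trans (lerD B1 B2)); rewrite KD.
Qed.

Lemma sobolevB f g : sobolev p f -> sobolev p g -> sobolev p (f - g).
Proof.
move=> sf sg; apply/sobolevP => //; split.
  by move=> x; apply: continuousB; [exact: sf.1|exact: sg.1].
move=> e; have W1 := sobolev_W p1 e sf; have W2 := sobolev_W p1 e sg.
exists (fun x => -1 * wderiv p g e x + wderiv p f e x).
apply: eq_W (W_lin p1 (-1) W2 W1) => x _ //.
by rewrite /edge_fun mulN1r addrC.
Qed.

Lemma sum_coord_continuous (n : nat) (phi : R -> R) : continuous phi ->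
  continuous (fun v : 'rV[R]_n => \sum_(i < n) phi (v 0 i)).
Proof.
move=> cphi; apply: continuous_big => [|i _]; first exact: add_continuous.
move=> v; apply: (@continuous_comp _ _ _ (fun v : 'rV[R]_n => v 0 i) phi).
  exact: coord_continuous.
exact: cphi.
Qed.

Lemma genus_le_of_zero_free C (N : nat) (ev : (graph_space G -> R) -> 'rV[R]_N) :
  (forall f, C f -> ev (- f) = - ev f) -> (forall f, C f -> ev f != 0) ->
  (forall f, C f -> forall eps : R, 0 < eps -> exists2 delta : R, 0 < delta &
     forall g, C g -> (sobolev_norm p (g - f)%R < delta%:E)%E -> `|ev g - ev f| < eps) ->
  (genus p C <= N%:R%:E)%E.
Proof.
move=> evN ev0 evc; apply: ereal_inf_lbound.
exists N => //; rewrite /=.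
pose sq (v : 'rV[R]_N) := \sum_(i < N) v 0 i ^+ 2.
pose nrm (v : 'rV[R]_N) := (Num.sqrt (sq v))^-1 *: v.
have sq_gt0 v : v != 0 -> 0 < sq v.
  move=> v0; rewrite lt_neqAle sumr_ge0 ?andbT; last by move=> i _; exact: sqr_ge0.
  apply: contra v0 => /eqP/esym; rewrite /sq => /eqP; rewrite psumr_eq0; last first.
    by move=> i _; exact: sqr_ge0.
  move=> /allP sv; apply/eqP/rowP => i; rewrite mxE; apply/eqP.
  by have := sv i; rewrite mem_index_enum sqrf_eq0 => /(_ isT).
have csq : continuous sq by apply: (sum_coord_continuous (phi := fun x => x ^+ 2)); exact: exprn_continuous.
have cnrm v : v != 0 -> {for v, continuous nrm}.
  move=> v0; apply: (@cvgZ _ _ _ (nbhs v) _ (fun v => (Num.sqrt (sq v))^-1) id).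
    apply: cvgV; first by rewrite sqrtr_eq0 -ltNge sq_gt0.
    apply: (@continuous_comp _ _ _ sq Num.sqrt); first exact: csq.
    exact: sqrt_continuous.
  exact: cvg_id.
exists (nrm \o ev); split => [f Cf|f Cf|f Cf eps e0] /=.
- rewrite /unit_sphere /nrm /=.
  under eq_bigr do rewrite mxE exprMn.
  rewrite -mulr_sumr -/(sq (ev f)) exprVn sqr_sqrtr ?mulVf// ?gt_eqF ?sq_gt0 ?ev0//.
  by rewrite ltW// sq_gt0// ev0.
- rewrite evN// /nrm scalerN; congr (- (_^-1 *: _)); congr Num.sqrt.
  by apply: eq_bigr => i _; rewrite mxE sqrrN.
have /cvgrPdist_lt/(_ _ e0) := cnrm _ (ev0 f Cf).
rewrite nearE => /nbhs_ballP[r r0 Hr]; have [de de0 H] := evc f Cf r r0.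
exists de => // g Cg gf; rewrite distrC; apply: Hr.
by rewrite -ball_normE /ball_ /= distrC; exact: H.
Qed.

(** A set whose genus exceeds the number of sample points contains a function vanishing at all of
    them, and [edge_energy_lower] bounds its energy from below on every edge. *)
Lemma weyl_lower (n : nat) (lambda h : R) : 0 < h ->
  variational_eigenvalue G p n = lambda%:E ->
  (\sum_(e : edge G) (Num.truncn (len e / h)).+2 < n)%N ->
  Lam p <= lambda * h `^ p.
Proof.
move=> h0 lE Nn.
(* [m e] cells of length at most h, hence [(m e).+1] sample points, the ends of the edge
   included. *)
pose m e := (Num.truncn (len e / h)).+1.
pose I := {e : edge G & 'I_((m e).+1)}.
have cI : (#|{: I}| < n)%N.
  rewrite card_tagged sumnE big_map big_enum /=.
  by rewrite (eq_bigr (fun e => (m e).+1)) => [//|e _]; rewrite card_ord.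
pose pt (i : I) : graph_space G := edge_point (tag i) ((tagged i)%:R * (len (tag i) / (m (tag i))%:R)).
pose ev f : 'rV[R]_#|{: I}| := \row_j f (pt (enum_val j)).
rewrite -ler_pdivrMr ?powR_gt0// -lee_fin -lE.
apply: le_ereal_inf_tmp => _ [C [CS clC symC C0 gC] <-].
have [f [Cf ef]] : exists f, C f /\ ev f = 0.
  apply: contrapT => /forallNP noz.
  have : (genus p C <= #|{: I}|%:R%:E)%E.
    apply: (genus_le_of_zero_free (ev := ev)).
    - by move=> f Cf; apply/rowP => j; rewrite !mxE.
    - by move=> f Cf; apply/eqP => ef; apply: (noz f).
    move=> f Cf eps e0; have [de de0 H] := sobolev_point e0.
    exists de => // g Cg gf.
    have sgf : sobolev p (g - f) by apply: sobolevB; [case: (CS _ Cg)|case: (CS _ Cf)].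
    suff : mx_norm (ev g - ev f) < eps by [].
    rewrite mx_normrE; apply/bigmax_ltP; split => // -[i j] _ /=.
    by have := H _ sgf gf (pt (enum_val j)); rewrite !mxE.
  by move/(le_trans gC); rewrite lee_fin ler_nat leqNgt cI.
have [sf lf] := CS _ Cf.
apply: le_trans (ereal_sup_ubound _); last by exists f.
rewrite (energyE p1 sf (fun e => sobolev_W p1 e sf)) lee_fin ler_pdivrMr ?powR_gt0//.
have L1 : \sum_e Pow p 0 (len e) (edge_fun f e) = 1.
  by move: lf; rewrite /= (lp_powE p1 sf.1) => -[].
rewrite -[leLHS]mulr1 -L1 mulr_sumr mulr_suml; apply: ler_sum => e _.
rewrite [leRHS]mulrC; apply: (@edge_energy_lower _ p p1 (len e) h (m e)) => //.
- exact: len_gt0.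
- rewrite /m ler_pdivrMr ?ltr0n// mulrC -ler_pdivrMr// ltW//; exact: truncnS_gt.
- exact: sobolev_W.
move=> i im; have im' : (i < (m e).+1)%N by [].
have := congr1 (fun v : 'rV[R]__ => v 0 (enum_rank (existT _ e (Ordinal im') : I))) ef.
by rewrite !mxE enum_rankK.
Qed.

End WeylLower.

(** * Upper bound on the eigenvalues, by disjoint bumps *)

Section WeylUpper.
Context {R : realType} (G : metric_graph R) (p : R).
Hypothesis p1 : 1 < p.
Implicit Types (f : graph_space G -> R) (e : edge G).

Let p0 : 0 < p. Proof. exact: lt_trans p1. Qed.

Lemma W_sum (I : finType) (P : pred I) a b (c : I -> R) (F D : I -> R -> R) :
  (forall i, P i -> W p a b (F i) (D i)) ->
  W p a b (fun x => \sum_(i | P i) c i * F i x) (fun x => \sum_(i | P i) c i * D i x).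
Proof.
move=> WF; rewrite /index_enum; elim: (Finite.enum I) => [|i s IH].
  by apply: eq_W (W_zero p a b) => x _; rewrite big_nil.
have [Pi|Pi] := boolP (P i); last first.
  by apply: eq_W IH => x _; rewrite big_cons (negbTE Pi).
by apply: eq_W (W_lin p1 (c i) (WF i Pi) IH) => x _; rewrite big_cons Pi.
Qed.

Lemma disjoint_sum_powp (I : finType) (P : pred I) (v : I -> R) :
  (forall i j, i != j -> v i * v j = 0) ->
  `|\sum_(i | P i) v i| `^ p = \sum_(i | P i) `|v i| `^ p.
Proof.
move=> vd; have p00 : (0 : R) `^ p = 0 by rewrite powR0// gt_eqF.
have [[i Pi vi]|no] := pselect (exists2 i, P i & v i != 0); last first.
  have v0 i : P i -> v i = 0.
    by move=> Pi; apply/eqP/negPn/negP => vi; apply: no; exists i.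
  by rewrite !big1 ?normr0// => i Pi; rewrite v0// normr0.
have vj j : j != i -> v j = 0.
  move=> ji; have /eqP := vd _ _ ji; rewrite mulf_eq0 (negbTE vi) orbF => /eqP; exact.
rewrite (bigD1 i)//= [in RHS](bigD1 i)//= !big1 ?addr0//.
  by move=> j /andP[_ ji]; rewrite vj// normr0.
by move=> j /andP[_ ji]; rewrite vj.
Qed.

Lemma Pow_sum (I : finType) (P : pred I) a b (c : I -> R) (F : I -> R -> R) :
  (forall i, P i -> Lp p a b (F i)) ->
  (forall i j x, P i -> P j -> i != j -> F i x * F j x = 0) ->
  Pow p a b (fun x => \sum_(i | P i) c i * F i x) =
  \sum_(i | P i) `|c i| `^ p * Pow p a b (F i).
Proof.
move=> LF Fd.
have E x : `|\sum_(i | P i) c i * F i x| `^ p = \sum_(i | P i) `|c i| `^ p * `|F i x| `^ p.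
  rewrite (eq_bigr (fun i => if P i then c i * F i x else 0)); last by move=> i ->.
  rewrite disjoint_sum_powp; first by apply: eq_bigr => i ->; rewrite normrM powRM.
  move=> i j ij; case: ifPn => Pi; last by rewrite mul0r.
  case: ifPn => Pj; last by rewrite mulr0.
  by rewrite mulrACA Fd// mulr0.
rewrite /Pow (@eq_II _ _ _ _ _ (fun x _ => E x)).
rewrite /index_enum; elim: (Finite.enum I) => [|i s IH].
  rewrite big_nil (@eq_II _ _ _ _ (fun=> 0)); last by move=> x _; rewrite big_nil.
  have [ab|ba] := leP a b; first by rewrite II_cst// mul0r.
  by rewrite II_geq// ltW.
have [Pi|Pi] := boolP (P i); last first.
  rewrite big_cons (negbTE Pi) -IH; apply: eq_II => x _.
  by rewrite big_cons (negbTE Pi).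
have sumi (t : seq I) : itg a b (fun x => \sum_(i <- t | P i) `|c i| `^ p * `|F i x| `^ p).
  elim: t => [|j t IHt].
    by apply: eq_itg (itg_cst a b 0) => x _; rewrite big_nil.
  have [Pj|Pj] := boolP (P j); last first.
    by apply: eq_itg IHt => x _; rewrite big_cons (negbTE Pj).
  apply: (eq_itg (f := fun x => `|c j| `^ p * `|F j x| `^ p +
      \sum_(i <- t | P i) `|c i| `^ p * `|F i x| `^ p)).
    by move=> x _; rewrite big_cons Pj.
  by apply: itgD => //; apply: itgZ; case: (LF j Pj).
rewrite big_cons Pi -IH -IIZ; last by case: (LF i Pi).
rewrite -IID; [|by apply: itgZ; case: (LF i Pi)|exact: sumi].
by apply: eq_II => x _; rewrite big_cons Pi.
Qed.

Section Bumps.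
Variables (h : R) (f0 g0 : R -> R).
Hypothesis h0 : 0 < h.
Hypothesis fg0 : dirichlet_pair p 0 1 f0 g0.

Let B := Pow p 0 1 f0.
Let B' := Pow p 0 1 g0.

Definition bump_index := {e : edge G & 'I_(Num.truncn (len e / h))}.

Implicit Types i j : bump_index.

Definition bump_start i : R := (tagged i)%:R * h.

Definition bump i x : R :=
  if bump_start i <= x <= bump_start i + h
  then (f0 \o aff h^-1 (- (bump_start i / h))) x else 0.

Definition bump_deriv i x : R :=
  if bump_start i < x < bump_start i + h
  then h^-1 * g0 (aff h^-1 (- (bump_start i / h)) x) else 0.

Lemma bump_range i : 0 <= bump_start i /\ bump_start i + h <= len (tag i).
Proof.
case: i => e j; rewrite /bump_start /=; split; first by rewrite mulr_ge0// ltW.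
have -> : j%:R * h + h = j.+1%:R * h by rewrite -natr1 mulrDl mul1r.
rewrite -ler_pdivlMr//; apply: (@le_trans _ _ (Num.truncn (len e / h))%:R).
  by rewrite ler_nat.
by rewrite truncn_le// divr_ge0// ltW// len_gt0.
Qed.

Lemma bump_W i : W p 0 (len (tag i)) (bump i) (bump_deriv i).
Proof.
have [a0 al] := bump_range i.
have [[Wf fa fb _] _ _] := dirichlet_pair_move p1 (bump_start i) h0 fg0.
by apply: W_extend => //; rewrite lerDl ltW.
Qed.

Lemma bump_ends i : bump i 0 = 0 /\ bump i (len (tag i)) = 0.
Proof.
have [a0 al] := bump_range i.
have [[Wf fa fb _] _ _] := dirichlet_pair_move p1 (bump_start i) h0 fg0.
rewrite /bump; split; case: ifPn => // /andP[h1 h2].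
  by rewrite -[RHS]fa; congr (_ _); apply/eqP; rewrite eq_le a0 h1.
by rewrite -[RHS]fb; congr (_ _); apply/eqP; rewrite eq_le h2 al.
Qed.

Lemma bump_supp i x : bump i x != 0 -> bump_start i < x < bump_start i + h.
Proof.
have [[_ fa fb _] _ _] := dirichlet_pair_move p1 (bump_start i) h0 fg0.
rewrite /bump; case: ifPn => [/andP[h1 h2] fx|_]; last by rewrite eqxx.
rewrite !lt_neqAle h1 h2 !andbT; apply/andP; split; apply: contra fx => /eqP E.
  by rewrite -E fa.
by rewrite E fb.
Qed.

Lemma bump_overlap i j x : tag i = tag j -> bump_start i < x < bump_start i + h ->
  bump_start j < x < bump_start j + h -> i = j.
Proof.
case: i j => e i [e' j] /= E; subst e'; rewrite /bump_start /= => /andP[i1 i2] /andP[j1 j2].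
congr (existT _ _ _); apply/val_inj => /=.
have lt_S (a b : nat) : a%:R * h < x -> x < b%:R * h + h -> (a < b.+1)%N.
  move=> ax xb; rewrite -(@ltr_nat R) -(ltr_pM2r h0) -natr1 mulrDl mul1r.
  exact: lt_trans ax xb.
by apply/eqP; rewrite eqn_leq; apply/andP; split; rewrite -ltnS; exact: lt_S.
Qed.

Lemma bump_disjoint i j x : tag i = tag j -> i != j -> bump i x * bump j x = 0.
Proof.
move=> E ij; apply/eqP; rewrite mulf_eq0 -[X in X || _]negbK -[X in _ || X]negbK -negb_and.
apply/negP => /andP[bi bj]; move/eqP: ij; apply.
exact: bump_overlap E (bump_supp bi) (bump_supp bj).
Qed.

Lemma bump_deriv_disjoint i j x : tag i = tag j -> i != j ->
  bump_deriv i x * bump_deriv j x = 0.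
Proof.
move=> E ij; rewrite /bump_deriv; case: ifPn => bi; last by rewrite mul0r.
case: ifPn => bj; last by rewrite mulr0.
by move/eqP: ij; case; exact: bump_overlap E bi bj.
Qed.

Lemma bump_Pow i : Pow p 0 (len (tag i)) (bump i) = h * B.
Proof.
have [a0 al] := bump_range i.
have [_ move_f _] := dirichlet_pair_move p1 (bump_start i) h0 fg0.
have p00 : (0 : R) `^ p = 0 by rewrite powR0// gt_eqF.
apply: etrans move_f.
apply: (etrans (@II_support R 0 (len (tag i)) (bump_start i) (bump_start i + h)
  (fun x => `|bump i x| `^ p) a0 _ al _ _ _)).
- by rewrite lerDl ltW.
- exact: (cts_Lp_itg p1 (W_cts (bump_W i))).
- by move=> x /andP[_ xa]; rewrite /bump [_ <= x]leNgt xa /= normr0.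
- by move=> x /andP[ax _]; rewrite /bump [x <= _]leNgt ax andbF normr0.
- by apply: eq_II => x /andP[x1 x2]; rewrite /bump !ltW.
Qed.

Lemma bump_deriv_Pow i : h `^ p * Pow p 0 (len (tag i)) (bump_deriv i) = h * B'.
Proof.
have [a0 al] := bump_range i.
have [_ _ move_g] := dirichlet_pair_move p1 (bump_start i) h0 fg0.
have p00 : (0 : R) `^ p = 0 by rewrite powR0// gt_eqF.
apply: etrans move_g; apply: (congr1 (fun y => h `^ p * y)).
apply: (etrans (@II_support R 0 (len (tag i)) (bump_start i) (bump_start i + h)
  (fun x => `|bump_deriv i x| `^ p) a0 _ al _ _ _)).
- by rewrite lerDl ltW.
- by case: (bump_W i) => -[].
- by move=> x /andP[_ xa]; rewrite /bump_deriv [_ < x]ltNge (ltW xa) /= normr0.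
- by move=> x /andP[ax _]; rewrite /bump_deriv [x < _]ltNge (ltW ax) andbF normr0.
- by apply: eq_II => x xx; rewrite /bump_deriv xx.
Qed.

Definition combo (c : bump_index -> R) : graph_space G -> R :=
  lift (fun e x => \sum_(i | tag i == e) c i * bump i x).

Lemma combo_vanishes c :
  vanishes_at_vertices (fun e x => \sum_(i : bump_index | tag i == e) c i * bump i x).
Proof.
move=> e; split; rewrite big1// => i /eqP ie; have [b0 bl] := bump_ends i.
  by rewrite b0 mulr0.
by rewrite -ie bl mulr0.
Qed.

Lemma combo_W c e : W p 0 (len e) (fun x => \sum_(i : bump_index | tag i == e) c i * bump i x)
  (fun x => \sum_(i : bump_index | tag i == e) c i * bump_deriv i x).
Proof. by apply: W_sum => i /eqP <-; exact: bump_W. Qed.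

Lemma combo_edge c e x : 0 <= x <= len e ->
  combo c (edge_point e x) = \sum_(i : bump_index | tag i == e) c i * bump i x.
Proof. by move=> xl; rewrite /combo lift_edge//; exact: combo_vanishes. Qed.

Lemma combo_sobolev c : sobolev p (combo c).
Proof. by have [] := lift_sobolev p1 (combo_vanishes c) (combo_W c). Qed.

Let edge_sum (c : bump_index -> R) (q : R) :
  \sum_e \sum_(i : bump_index | tag i == e) `|c i| `^ p * q = q * \sum_i `|c i| `^ p.
Proof.
rewrite mulr_sumr [RHS](partition_big (fun i => tag i) xpredT)//=.
by apply: eq_bigr => e _; apply: eq_bigr => i _; rewrite mulrC.
Qed.

Lemma combo_lp c : lp_pow p (combo c) = (h * B * \sum_i `|c i| `^ p)%:E.
Proof.
rewrite (lp_powE p1 (combo_sobolev c).1) -edge_sum; congr (_%:E).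
apply: eq_bigr => e _.
transitivity (Pow p 0 (len e) (fun x => \sum_(i : bump_index | tag i == e) c i * bump i x)).
  by apply: eq_II => x /andP[x0 xl]; rewrite /edge_fun combo_edge// !ltW.
rewrite Pow_sum; first by apply: eq_bigr => i /eqP <-; rewrite bump_Pow.
  by move=> i /eqP <-; apply: cts_Lp => //; exact: W_cts (bump_W i).
by move=> i j x /eqP ie /eqP je ij; apply: bump_disjoint => //; rewrite ie je.
Qed.

Lemma combo_energy c : energy p (combo c) = (h * B' / h `^ p * \sum_i `|c i| `^ p)%:E.
Proof.
have [_ WF] := lift_sobolev p1 (combo_vanishes c) (combo_W c).
rewrite (energyE p1 (combo_sobolev c) WF) -edge_sum; congr (_%:E).
apply: eq_bigr => e _; rewrite Pow_sum.
- apply: eq_bigr => i /eqP <-; rewrite -(bump_deriv_Pow i) mulrAC divff ?mul1r//.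
  by rewrite gt_eqF// powR_gt0.
- by move=> i /eqP <-; case: (bump_W i) => -[].
by move=> i j x /eqP ie /eqP je ij; apply: bump_deriv_disjoint => //; rewrite ie je.
Qed.

Lemma comboB c c' : combo c - combo c' = combo (fun i => c i - c' i).
Proof.
apply: graph_ext => e x xl.
rewrite -[LHS]/(combo c (edge_point e x) - combo c' (edge_point e x)) !combo_edge//.
by rewrite -sumrB; apply: eq_bigr => i _; rewrite mulrBl.
Qed.

Lemma comboN c : - combo c = combo (fun i => - c i).
Proof.
apply: graph_ext => e x xl.
rewrite -[LHS]/(- combo c (edge_point e x)) !combo_edge//.
by rewrite -sumrN; apply: eq_bigr => i _; rewrite mulNr.
Qed.

(** At a point where bump i is nonzero all others vanish, so the value of a combination there gives
    back its coefficient c i. *)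
Lemma bump_peak i : exists x, [/\ 0 <= x <= len (tag i), bump i x != 0 &
  forall c, combo c (edge_point (tag i) x) = c i * bump i x].
Proof.
have [x xl bx] : exists2 x, 0 < x < len (tag i) & bump i x != 0.
  apply: contrapT => no.
  have : 0 < Pow p 0 (len (tag i)) (bump i).
    by rewrite bump_Pow mulr_gt0//; case: fg0.
  rewrite /Pow (@eq_II _ _ _ _ (fun=> 0)) ?II_cst ?mul0r ?ltxx// ?ltW ?len_gt0//.
  move=> x xl; have -> : bump i x = 0 by apply/eqP/negPn/negP => bx; apply: no; exists x.
  by rewrite normr0 powR0// gt_eqF.
have xl' : 0 <= x <= len (tag i) by case/andP: xl => /ltW-> /ltW->.
exists x; split => // c; rewrite combo_edge// (bigD1 i)//= big1 ?addr0// => j /andP[/eqP ji jni].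
have /eqP := bump_disjoint x ji jni; rewrite mulf_eq0 (negbTE bx) orbF => /eqP ->.
by rewrite mulr0.
Qed.


Let N := #|{: bump_index}|.
Let sump (v : 'rV[R]_N) : R := \sum_(j < N) `|v 0 j| `^ p.
Let coef (v : 'rV[R]_N) (i : bump_index) : R := v 0 (enum_rank i).
Let row_of (c : bump_index -> R) : 'rV[R]_N := \row_j c (enum_val j).

Let B0 : 0 < B. Proof. by case: fg0. Qed.
Let K0 : 0 < h * B. Proof. exact: mulr_gt0. Qed.

Let coefK c : coef (row_of c) = c.
Proof. by apply/funext => i; rewrite /coef mxE enum_rankK. Qed.

Let sum_coef v : \sum_i `|coef v i| `^ p = sump v.
Proof.
rewrite /sump (reindex (@enum_val _ (mem {: bump_index}))) /=; last first.
  by exists enum_rank => i _; rewrite ?enum_rankK ?enum_valK.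
by apply: eq_bigr => j _; rewrite /coef enum_valK.
Qed.

Let sump_continuous : continuous sump.
Proof.
apply: (@sum_coord_continuous _ _ (fun x => `|x| `^ p)) => x.
have : derivable (fun y : R => `|y| `^ p) x 1 by case: (is_derive_normp p1 x).
by move=> /derivable1_diffP/differentiable_continuous.
Qed.

Let sump_gt0 v : v != 0 -> 0 < sump v.
Proof.
move=> v0; rewrite lt_neqAle sumr_ge0 ?andbT; last by move=> i _; exact: powR_ge0.
apply: contra v0 => /eqP/esym/eqP; rewrite /sump psumr_eq0; last by move=> i _; exact: powR_ge0.
move=> /allP sv; apply/eqP/rowP => i; rewrite mxE; apply/eqP.
by have := sv i; rewrite mem_index_enum powR_eq0 normr_eq0 => /(_ isT)/andP[].
Qed.

(** The L^p unit sphere in the span of the bumps, by [combo_lp]. *)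
Definition combo_sphere : set (graph_space G -> R) :=
  [set f | exists2 c, h * B * \sum_i `|c i| `^ p = 1 & f = combo c].

(** Sobolev convergence is uniform by [sobolev_point]. Reading coefficients off at the peaks shows
    that those of the approximants converge, f is the combination with the limit coefficients, and
    the normalisation passes to the limit by continuity. *)
Lemma combo_sphere_closed : closed_in_sobolev p combo_sphere.
Proof.
move=> f sf Hf.
have /choice[x Hx] : forall i, exists x, [/\ 0 <= x <= len (tag i), bump i x != 0 &
  forall c, combo c (edge_point (tag i) x) = c i * bump i x] := bump_peak.
(* Dominates the reciprocal of every peak value, and 1 as well, so that eta / M controls both the
   coefficients and the values. *)
pose M := 1 + \sum_i `|bump i (x i)|^-1.
have sM0 : 0 <= \sum_i `|bump i (x i)|^-1 by apply: sumr_ge0 => i _; rewrite invr_ge0.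
have M0 : 0 < M by rewrite /M; lra.
have biM i : `|bump i (x i)|^-1 <= M.
  have rest : 0 <= \sum_(j | j != i) `|bump j (x j)|^-1.
    by apply: sumr_ge0 => j _; rewrite invr_ge0.
  rewrite /M (bigD1 i)//=; lra.
pose c i := f (edge_point (tag i) (x i)) / bump i (x i).
have approx eta : 0 < eta -> exists c' : bump_index -> R,
    [/\ h * B * \sum_i `|c' i| `^ p = 1, (forall i, `|c' i - c i| < eta) &
     forall y, `|f y - combo c' y| < eta].
  move=> eta0; have e0 : 0 < eta / M by rewrite divr_gt0.
  have [de de0 H] := sobolev_point G p1 e0.
  have [_ [c' c'1 ->] gf] := Hf de de0; exists c'; split => //.
    move=> i; have [xl bx bc] := Hx i.
    have := H _ (sobolevB p1 (combo_sobolev c') sf) gf (edge_point (tag i) (x i)).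
    rewrite -[X in `|X| < _]/(combo c' (edge_point (tag i) (x i)) - f (edge_point (tag i) (x i))).
    rewrite bc => hh.
    have -> : c' i - c i = (c' i * bump i (x i) - f (edge_point (tag i) (x i))) / bump i (x i).
      by rewrite /c mulrBl mulfK.
    rewrite normrM normfV; apply: (@lt_le_trans _ _ (eta / M * `|bump i (x i)|^-1)).
      by rewrite ltr_pM2r// invr_gt0 normr_gt0.
    by rewrite mulrAC ler_pdivrMr// ler_wpM2l// (ltW eta0).
  move=> y; rewrite distrC.
  apply: lt_le_trans (H _ (sobolevB p1 (combo_sobolev c') sf) gf y) _.
  by rewrite ler_pdivrMr// -[X in X <= _]mulr1 ler_pM2l// lerDl.
have fc : f = combo c.
  apply: graph_ext => e t tl; apply/eqP; rewrite -subr_eq0 -normr_le0 leNgt; apply/negP => s0.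
  set s := `|_| in s0.
  pose S := \sum_(i : bump_index | tag i == e) `|bump i t|.
  have S0 : 0 <= S by apply: sumr_ge0.
  (* With this eta the two errors, eta and eta S, add up to s / 2, less than s. *)
  have eta0 : 0 < s / (2 * (1 + S)) by rewrite divr_gt0// mulr_gt0//; lra.
  have [c' [_ cc fc']] := approx _ eta0.
  have h1 := fc' (edge_point e t).
  have h2 : `|combo c' (edge_point e t) - combo c (edge_point e t)| <= s / (2 * (1 + S)) * S.
    rewrite !combo_edge// -sumrB /S mulr_sumr.
    apply: (le_trans (ler_norm_sum _ _ _)); apply: ler_sum => i _.
    by rewrite -mulrBl normrM ler_wpM2r// ltW.
  have : s <= `|f (edge_point e t) - combo c' (edge_point e t)| +
      `|combo c' (edge_point e t) - combo c (edge_point e t)|.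
    rewrite /s; apply: le_trans (ler_normD _ _).
    by rewrite addrA subrK.
  have : s / (2 * (1 + S)) + s / (2 * (1 + S)) * S = s / 2 by field; lra.
  lra.
exists c => //; apply/eqP; apply: contrapT => /negP ne.
rewrite -{1}(coefK c) sum_coef in ne.
have e0 : 0 < `|sump (row_of c) - (h * B)^-1|.
  rewrite normr_gt0 subr_eq0; apply: contra ne => /eqP ->.
  by rewrite divff// gt_eqF.
have /cvgrPdist_lt/(_ _ e0) := sump_continuous (x := row_of c).
rewrite nearE => /nbhs_ballP[r r0 Hr].
have [c' [c'1 cc _]] := approx r r0.
have : `|sump (row_of c) - sump (row_of c')| < `|sump (row_of c) - (h * B)^-1|.
  apply: Hr; rewrite -ball_normE /ball_ /= -[X in X < _]/(mx_norm _) mx_normrE.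
  by apply/bigmax_ltP; split => // -[i j] _ /=; rewrite !mxE distrC.
have -> : sump (row_of c') = (h * B)^-1.
  apply: (mulfI (lt0r_neq0 K0)); rewrite divff ?gt_eqF//.
  by move: c'1; rewrite -{1}(coefK c') sum_coef.
by rewrite ltxx.
Qed.

(** The sup-norm sphere of R^N is carried by a radial rescaling onto [combo_sphere], oddly and
    continuously. Composed with a map to a sphere of fewer than N coordinates, it would contradict
    [borsuk_ulam], since that map has no zero. *)
Lemma combo_sphere_genus : (N%:R%:E <= genus p combo_sphere)%E.
Proof.
apply: le_ereal_inf_tmp => _ [k [hm [hsph hodd hcts]] <-].
rewrite lee_fin ler_nat leqNgt; apply/negP => kN.
(* The factor that brings v to h B times the sum of |v_j|^p equal to 1. *)
pose kap (v : 'rV[R]_N) := (h * B * sump v) `^ (- p^-1).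
pose sv v := kap v *: v.
have norm_neq0 (v : 'rV[R]_N) : `|v| = 1 -> v != 0.
  by move=> v1; rewrite -normr_eq0 v1 oner_eq0.
have sump_sv v : v != 0 -> h * B * sump (sv v) = 1.
  move=> v0; have Ks : 0 < h * B * sump v by rewrite mulr_gt0// sump_gt0.
  have -> : sump (sv v) = kap v `^ p * sump v.
    rewrite /sump mulr_sumr; apply: eq_bigr => j _; rewrite /sv mxE normrM powRM//.
    by rewrite (ger0_norm (powR_ge0 _ _)).
  rewrite /kap -powRrM mulNr mulVf ?gt_eqF// powR_inv1 ?ltW//.
  by rewrite mulrCA mulVf ?gt_eqF.
pose E v := combo (coef (sv v)).
have EC v : `|v| = 1 -> combo_sphere (E v).
  by move=> v1; exists (coef (sv v)) => //; rewrite sum_coef sump_sv// norm_neq0.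
have kapN v : kap (- v) = kap v.
  rewrite /kap; have -> // : sump (- v) = sump v.
  by apply: eq_bigr => j _; rewrite mxE normrN.
have svN v : sv (- v) = - sv v by rewrite /sv kapN scalerN.
have EN v : E (- v) = - E v.
  by rewrite /E comboN svN; congr combo; apply/funext => i; rewrite /coef mxE.
have csv v : v != 0 -> {for v, continuous sv}.
  move=> v0; apply: (@cvgZ _ _ _ (nbhs v) _ kap id); last exact: cvg_id.
  apply: (@continuous_comp _ _ _ (fun v => h * B * sump v) (fun r => r `^ (- p^-1))).
    apply: (@continuousM _ _ (cst (h * B)) sump); first exact: cst_continuous.
    exact: sump_continuous.
  have : derivable (fun r : R => r `^ (- p^-1)) (h * B * sump v) 1.
    by apply: derivable_powR; rewrite in_itv /= andbT mulr_gt0// sump_gt0.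
  by move=> /derivable1_diffP/differentiable_continuous.
have [v v1|x x1|v v1 Hv] := @borsuk_ulam R N k (fun v => hm (E v)) kN.
- by rewrite EN hodd//; exact: EC.
- move=> eps e0; have [de de0 H] := hcts _ (EC x x1) eps e0.
  pose K2 := h * B + h * B' / h `^ p.
  pose diff y := K2 * sump (sv y - sv x).
  have cdiff : {for x, continuous diff}.
    apply: (@continuousM _ _ (cst K2) (fun y => sump (sv y - sv x))); first exact: cst_continuous.
    apply: (@continuous_comp _ _ _ (fun y => sv y - sv x) sump); last exact: sump_continuous.
    apply: (@continuousB _ _ _ sv (cst (sv x))); last exact: cst_continuous.
    by apply: csv; exact: norm_neq0.
  have dx : diff x = 0.
    rewrite /diff subrr /sump big1 ?mulr0// => j _.
    by rewrite mxE normr0 powR0// gt_eqF.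
  have dp0 : 0 < de `^ p by rewrite powR_gt0.
  have /cvgrPdist_lt/(_ _ dp0) := cdiff; rewrite dx nearE => /nbhs_ballP[r r0 Hr].
  exists r => // y y1 yx; apply: H; first exact: EC.
  have := Hr y; rewrite -ball_normE /ball_ /= distrC => /(_ yx).
  rewrite sub0r normrN => hd; have {hd} : diff y < de `^ p by apply: le_lt_trans hd; exact: ler_norm.
  rewrite /E comboB /sobolev_norm combo_lp combo_energy -EFinD -mulrDl poweR_EFin lte_fin.
  have -> : \sum_i `|coef (sv y) i - coef (sv x) i| `^ p = sump (sv y - sv x).
    by rewrite -sum_coef; apply: eq_bigr => i _; rewrite /coef !mxE.
  rewrite -/K2 -/(diff y) => hd.
  have K20 : 0 <= K2.
    apply: addr_ge0; first exact: ltW.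
    by apply: divr_ge0; [apply: mulr_ge0 (ltW h0) (Pow_ge0 _ _ _ _)|exact: powR_ge0].
  have d0 : 0 <= diff y by rewrite mulr_ge0// sumr_ge0// => j _; exact: powR_ge0.
  have pi0 : 0 < p^-1 by rewrite invr_gt0.
  have := gt0_ltr_powR pi0; move=> /(_ (diff y) (de `^ p)).
  rewrite !nnegrE powR_ge0 d0 => /(_ isT isT hd).
  by rewrite -powRrM mulfV ?gt_eqF// powRr1// ltW.
have := hsph _ (EC v v1); rewrite Hv /unit_sphere /= big1 => [/esym/eqP|i _].
  by rewrite oner_eq0.
by rewrite mxE expr0n.
Qed.

End Bumps.

(** All elements of [combo_sphere] have the same energy, the Rayleigh quotient of the near-minimiser
    divided by h^p, which is below (Lam + eps) / h^p. *)
Lemma weyl_upper (n : nat) (lambda h : R) : 0 < h -> (0 < n)%N ->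
  variational_eigenvalue G p n = lambda%:E ->
  (n <= \sum_(e : edge G) Num.truncn (len e / h))%N ->
  lambda * h `^ p <= Lam p.
Proof.
move=> h0 n0 lE nN; apply/ler_addgt0Pr => eps e0.
have [f0 [g0 [fg0 fgL]]] := Lam_near p1 e0.
have Pf : 0 < Pow p 0 1 f0 by case: fg0.
have hp0 : 0 < h `^ p by rewrite powR_gt0.
have cardN : #|{: bump_index h}| = (\sum_(e : edge G) Num.truncn (len e / h))%N.
  by rewrite card_tagged sumnE big_map big_enum /=; apply: eq_bigr => e _; rewrite card_ord.
rewrite -ler_pdivlMr// -lee_fin -lE.
apply: ge_ereal_inf; exists (ereal_sup [set energy p f | f in combo_sphere h f0]).
  exists (combo_sphere h f0) => //; split.
  - move=> _ [c c1 ->]; split; first exact: (combo_sobolev h0 fg0).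
    by rewrite /= (combo_lp h0 fg0) c1.
  - exact: combo_sphere_closed fg0.
  - move=> f [c c1 fc]; rewrite fc; exists (fun i => - c i); last exact: (comboN h0 fg0).
    by under eq_bigr do rewrite normrN.
  - have i0 : (0 < #|{: bump_index h}|)%N by rewrite cardN (leq_trans n0).
    pose i1 : bump_index h := enum_val (Ordinal i0).
    pose s := (h * Pow p 0 1 f0) `^ (- p^-1).
    exists (combo f0 (fun i : bump_index h => if i == i1 then s else 0)), (fun i => if i == i1 then s else 0) => //.
    rewrite (bigD1 i1)//= eqxx big1 ?addr0 => [|i /negbTE ->]; last first.
      by rewrite normr0 powR0// gt_eqF.
    have Ks : 0 < h * Pow p 0 1 f0 by rewrite mulr_gt0.
    rewrite (ger0_norm (powR_ge0 _ _)) /s -powRrM mulNr mulVf ?gt_eqF// powR_inv1 ?ltW//.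
    by rewrite divff// gt_eqF.
  - apply: le_trans (combo_sphere_genus h0 fg0); by rewrite lee_fin ler_nat cardN.
apply: ge_ereal_sup => _ [_ [c c1 ->] <-].
rewrite (combo_energy h0 fg0) lee_fin.
have -> : \sum_i `|c i| `^ p = (h * Pow p 0 1 f0)^-1.
  by apply: (mulfI (lt0r_neq0 (mulr_gt0 h0 Pf))); rewrite c1 divff// gt_eqF// mulr_gt0.
rewrite (_ : _ * _ = Pow p 0 1 g0 / Pow p 0 1 f0 / h `^ p); last first.
  move: (Pow p 0 1 g0) (Pow p 0 1 f0) (h `^ p) Pf hp0 => x y z y0 z0.
  by field; rewrite !gt_eqF.
by rewrite ler_pM2r ?invr_gt0// ler_pdivrMr// ltW.
Qed.

End WeylUpper.

(** * Accumulation points *)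

Lemma le_limn_einf (R : realType) (a : nat -> R) (l : R) :
  (forall eps, 0 < eps -> exists N, forall n, (N <= n)%N -> l - eps <= a n) ->
  (l%:E <= limn_einf (fun n => (a n)%:E))%E.
Proof.
move=> la; apply/lee_subgt0Pr => eps /la[N aN].
have lim_ext : limn (einfs (fun n => (a n)%:E)) = ereal_sup (range (einfs (fun n => (a n)%:E))).
  by apply/cvg_lim => //; exact: cvg_einfs_sup.
rewrite limn_einf_lim lim_ext.
apply: le_trans (ereal_sup_ubound (ex_intro2 _ _ N I erefl)).
by apply: le_ereal_inf_tmp => _ [n Nn <-]; rewrite -EFinB lee_fin; exact: aN.
Qed.

Lemma ge_limn_esup (R : realType) (a : nat -> R) (l : R) :
  (forall eps, 0 < eps -> exists N, forall n, (N <= n)%N -> a n <= l + eps) ->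
  (limn_esup (fun n => (a n)%:E) <= l%:E)%E.
Proof.
move=> la; apply/lee_addgt0Pr => eps /la[N aN].
have lim_ext : limn (esups (fun n => (a n)%:E)) = ereal_inf (range (esups (fun n => (a n)%:E))).
  by apply/cvg_lim => //; exact: cvg_esups_inf.
rewrite limn_esup_lim lim_ext.
apply: le_trans (ereal_inf_lbound (ex_intro2 _ _ N I erefl)) _.
by apply: ge_ereal_sup => _ [n Nn <-]; rewrite -EFinD lee_fin; exact: aN.
Qed.

(** A point x that is none of the finitely many values r y, for y in Q, keeps a positive distance d
    from them, while the sequence comes within d / 2 of these values. *)
Lemma acc_finite_family (R : realType) (T : finType) (Q : set T) (r : T -> R)
    (t : nat -> T) (a : nat -> R) : (forall n, (0 < n)%N -> Q (t n)) ->
  (forall eps, 0 < eps -> exists N, forall n, (N <= n)%N -> `|a n - r (t n)| < eps) ->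
  acc a `<=` [set r x | x in Q].
Proof.
move=> Qt ar x [s smono ax]; apply: contrapT => xr.
have s_ge n : (n <= s n)%N.
  by elim: n => // n IH; apply: leq_ltn_trans IH (smono _ _ (ltnSn n)).
pose d := \big[Order.min/1]_(y : T | `[< Q y >]) `|r y - x|.
have d0 : 0 < d.
  apply/bigmin_gtP; split => // y /asboolP Qy; rewrite normr_gt0 subr_eq0.
  by apply/eqP => ryx; apply: xr; exists y.
have d20 : 0 < d / 2 by rewrite divr_gt0.
have [N1 aN1] := ar _ d20.
have /cvgrPdist_lt/(_ _ d20)[N2 _ aN2] := ax.
pose m := (maxn N1 N2).+1.
have h1 : `|a (s m) - r (t (s m))| < d / 2.
  by apply: aN1; apply: leq_trans (s_ge m); rewrite /m leqW// leq_maxl.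
have h2 : `|x - a (s m)| < d / 2 by apply: aN2; rewrite /= /m leqW// leq_maxr.
have h3 : d <= `|r (t (s m)) - x|.
  by apply: bigmin_le_cond; apply/asboolP/Qt; apply: leq_trans (s_ge m).
have := ler_normD (r (t (s m)) - a (s m)) (a (s m) - x).
rewrite addrA subrK distrC in h1 *; rewrite distrC in h2; lra.
Qed.

Section Counting.
Variables (R : realType) (G : metric_graph R).
Local Notation cardE := (#|edge G|%:R : R).

Lemma sum_truncn_upper (P : pred (edge G)) (S : R) : 0 < S ->
  (\sum_(e : edge G | P e) (Num.truncn (len e / S)).+2)%:R <=
    (\sum_(e | P e) len e) / S + 2 * cardE.
Proof.
move=> S0; rewrite natr_sum mulr_suml.
have -> : 2 * cardE = \sum_(e : edge G) 2 by rewrite sumr_const mulr_natr.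
apply: (@le_trans _ _ (\sum_(e | P e) (len e / S + 2))).
  apply: ler_sum => e _; rewrite -addn2 natrD lerD2r.
  by rewrite truncn_le// divr_ge0// ltW// len_gt0.
rewrite big_split lerD2l /= [leRHS](bigID P)/= lerDl.
by apply: sumr_ge0 => e _; lra.
Qed.

Lemma sum_truncn_lower (P : pred (edge G)) (S : R) : 0 < S ->
  (\sum_(e | P e) len e) / S - cardE <= (\sum_(e : edge G | P e) Num.truncn (len e / S))%:R.
Proof.
move=> S0; rewrite natr_sum mulr_suml lerBlDr.
have -> : cardE = \sum_(e : edge G) 1 by rewrite sumr_const.
apply: (@le_trans _ _ (\sum_(e | P e) ((Num.truncn (len e / S))%:R + 1))).
  by apply: ler_sum => e _; rewrite -[X in _ + X]/(1%:R) -natrD addn1 ltW// truncnS_gt.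
rewrite big_split lerD2l /= [leRHS](bigID P)/= lerDl.
by apply: sumr_ge0 => e _; lra.
Qed.

Lemma sum_pred_truncn_lower (P : pred (edge G)) (S : R) : 0 < S ->
  (\sum_(e | P e) len e) / S - 2 * cardE <=
    (\sum_(e : edge G | P e) (Num.truncn (len e / S)).-1)%:R.
Proof.
move=> S0; rewrite natr_sum mulr_suml lerBlDr.
have -> : 2 * cardE = \sum_(e : edge G) 2 by rewrite sumr_const mulr_natr.
apply: (@le_trans _ _ (\sum_(e | P e) ((Num.truncn (len e / S)).-1%:R + 2))).
  apply: ler_sum => e _; apply: (@le_trans _ _ ((Num.truncn (len e / S)).+1%:R)).
    by rewrite ltW// truncnS_gt.
  by rewrite -natrD ler_nat addn2 ltnS; case: (Num.truncn _).
rewrite big_split lerD2l /= [leRHS](bigID P)/= lerDl.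
by apply: sumr_ge0 => e _; lra.
Qed.

End Counting.

(** Moves a strict inequality at T to a slightly smaller h, where the comparison lemmas hold; the
    witness is the midpoint of x / m and T. *)
Lemma ratio_lt_witness (R : realType) (x m T : R) :
  0 < x -> 0 < T -> x / T < m -> exists2 h, 0 < h < T & x / h < m.
Proof.
move=> x0 T0 xm; have m0 : 0 < m by apply: lt_trans xm; rewrite divr_gt0.
have hT : x / m < T by rewrite ltr_pdivrMr// mulrC -ltr_pdivrMr.
have h0 : 0 < x / m by rewrite divr_gt0.
exists ((x / m + T) / 2); first by lra.
rewrite ltr_pdivrMr; last by lra.
by rewrite mulrC -ltr_pdivrMr//; lra.
Qed.

Lemma ratio_gt_witness (R : realType) (x m T : R) :
  0 < m -> 0 < T -> m < x / T -> exists2 h, T < h & m < x / h.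
Proof.
move=> m0 T0 xm.
have hT : T < x / m by rewrite ltr_pdivlMr// mulrC -ltr_pdivlMr.
exists ((x / m + T) / 2); first by lra.
rewrite ltr_pdivlMr; last by lra.
by rewrite mulrC -ltr_pdivlMr//; lra.
Qed.

(** * Weyl's law combined with the nodal count *)

Section Asymptotics.
Variables (R : realType) (G : metric_graph R) (p : R).
Hypothesis p1 : 1 < p.
Local Notation cardE := (#|edge G|%:R : R).

(** n lies between |G| / T - [cardE] and |G| / T + 2 [cardE], and the nodal count is within 2
    [cardE] of a / T. As r = a / |G| is at most 1, the errors add up to at most 4 [cardE]. *)
Lemma nodal_count_estimate (n : nat) (lambda : R) (u : graph_space G -> R) :
  variational_eigenvalue G p n = lambda%:E -> is_eigenfunction p lambda u ->
  2 * cardE + 1 < n%:R ->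
  `|(nodal_count u)%:R - n%:R * ((\sum_(e in active_edges u) len e) / total_length G)|
    <= 4 * cardE.
Proof.
move=> vl eig nbig.
have p0 : 0 < p := lt_trans ltr01 p1.
have L0 := total_length_gt0 G; have Lp0 := Lam_gt0 p1.
have E1 : 1 <= cardE by rewrite ler1n edge_gt0.
have n0 : (0 < n)%N by rewrite -(ltr_nat R); lra.
have lower h : 0 < h -> total_length G / h + 2 * cardE < n%:R -> Lam p <= lambda * h `^ p.
  move=> h0 hn; apply: (weyl_lower p1 h0 vl); rewrite -(ltr_nat R).
  exact: le_lt_trans (sum_truncn_upper xpredT h0) hn.
(* [lower] at h = [total_length G] asks for 1 + 2 [cardE] < n, which is [nbig]. *)
have la0 : 0 < lambda.
  have := lower _ L0; rewrite divff ?gt_eqF// addrC => /(_ nbig) h.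
  have pw : 0 < total_length G `^ p by rewrite powR_gt0.
  by rewrite -(pmulr_lgt0 _ pw); apply: lt_le_trans h.
pose T := (Lam p / lambda) `^ (p^-1).
have T0 : 0 < T by rewrite powR_gt0 ?divr_gt0.
have TL : lambda * T `^ p = Lam p.
  rewrite /T -powRrM mulVf ?gt_eqF// powRr1 ?divr_ge0 ?ltW//.
  by rewrite mulrC divfK ?gt_eqF.
have below h : 0 < h -> h < T -> lambda * h `^ p < Lam p.
  move=> h0 hT; rewrite -TL ltr_pM2l//.
  by apply: gt0_ltr_powR => //; rewrite nnegrE ltW.
have above h : T < h -> Lam p < lambda * h `^ p.
  move=> hT; have h0 := lt_trans T0 hT; rewrite -TL ltr_pM2l//.
  by apply: gt0_ltr_powR => //; rewrite nnegrE ltW.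
have n_le : n%:R <= total_length G / T + 2 * cardE.
  rewrite leNgt; apply/negP => H.
  have [|h /andP[h0 hT] hm] := ratio_lt_witness (m := n%:R - 2 * cardE) L0 T0; first by lra.
  have : Lam p <= lambda * h `^ p by apply: lower => //; lra.
  by rewrite leNgt below.
have n_ge : total_length G / T - cardE <= n%:R.
  rewrite leNgt; apply/negP => H.
  have [||h hT hm] := @ratio_gt_witness _ (total_length G) (n%:R + cardE) T _ T0; [by lra|by lra|].
  have h0 := lt_trans T0 hT.
  have : lambda * h `^ p <= Lam p.
    apply: (weyl_upper p1 h0 n0 vl); rewrite -(ler_nat R).
    apply: le_trans (sum_truncn_lower xpredT h0).
    rewrite -[\sum_(e | xpredT e) len e]/(total_length G); lra.
  by rewrite leNgt above.
set A := active_edges u; set a := \sum_(e in A) len e.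
have [e0 e0A] : exists e, e \in A by apply/set0Pn; exact: active_edges_neq0 eig.
have a0 : 0 < a.
  rewrite /a (bigD1 e0)//= ltr_wpDr ?len_gt0// sumr_ge0// => e _.
  exact: ltW (len_gt0 e).
have aL : a <= total_length G.
  rewrite /total_length [leRHS](bigID (fun e => e \in A))/= lerDl sumr_ge0// => e _.
  exact: ltW (len_gt0 e).
(* [nodal_lower] asks for finiteness, and any length below T provides it. *)
have nu_fin : finite_set (nodal_domains u).
  have T20 : 0 < T / 2 by lra.
  by have [] := nodal_upper p1 la0 eig T20 (below _ T20 ltac:(lra)).
have nu_le : (nodal_count u)%:R <= a / T + 2 * cardE.
  rewrite leNgt; apply/negP => H.
  have [|h /andP[h0 hT] hm] := ratio_lt_witness (m := (nodal_count u)%:R - 2 * cardE) a0 T0.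
    by lra.
  have [_] := nodal_upper p1 la0 eig h0 (below _ h0 hT).
  rewrite -(ler_nat R) => /le_trans/(_ (sum_truncn_upper _ h0)).
  rewrite -/A -[\sum_(e | _) len e]/a; lra.
have nu_ge : a / T - 2 * cardE <= (nodal_count u)%:R.
  rewrite leNgt; apply/negP => H.
  have nu0 : 0 <= (nodal_count u)%:R :> R by [].
  have [||h hT hm] := @ratio_gt_witness _ a ((nodal_count u)%:R + 2 * cardE) T _ T0.
  - by lra.
  - by lra.
  have S10 : 0 < (T + h) / 2 by lra.
  have S1h : (T + h) / 2 < h by lra.
  have TS1 : T < (T + h) / 2 by lra.
  have := nodal_lower p1 la0 eig S10 S1h (above _ TS1) nu_fin.
  rewrite -(ler_nat R) => /(le_trans (sum_pred_truncn_lower _ (lt_trans S10 S1h))).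
  rewrite -/A -[\sum_(e | _) len e]/a; lra.
set r := a / total_length G.
have r0 : 0 <= r by rewrite divr_ge0// ltW.
have r1 : r <= 1 by rewrite ler_pdivrMr// mul1r.
have raT : a / T = r * (total_length G / T).
  by rewrite /r mulrA divfK// gt_eqF.
have : r * n%:R <= r * (total_length G / T + 2 * cardE) by rewrite ler_wpM2l.
have : r * (total_length G / T - cardE) <= r * n%:R by rewrite ler_wpM2l.
have : r * cardE <= 1 * cardE by rewrite ler_wpM2r//; lra.
rewrite ler_norml (mulrC n%:R); rewrite raT in nu_le nu_ge; move: nu_le nu_ge.
move: (total_length G / T) (nodal_count u)%:R n%:R => x y z.
by move=> ? ? ? ? ?; apply/andP; split; nra.
Qed.

End Asymptotics.

Theorem theorem5p2 (R : realType) (G : metric_graph R) (p : R) (hp : 1 < p)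
  (psi : nat -> graph_space G -> R)
  (hpsi : forall n : nat, (0 < n)%N ->
     exists2 lambda : R,
       variational_eigenvalue G p n = lambda%:E &
       is_eigenfunction p lambda (psi n)) :
  let a := fun n : nat => (nodal_count (psi n))%:R / n%:R : R in
  [/\ acc a `<=`
        [set (\sum_(e in E0) len e) / total_length G
          | E0 in [set E0 : {set edge G} | E0 != finset.set0]],
      finite_set (acc a),
      0 < min_length G / total_length G &
      [/\ ((min_length G / total_length G)%:E
            <= limn_einf (fun n : nat => (a n)%:E))%E,
          (limn_einf (fun n : nat => (a n)%:E)
            <= limn_esup (fun n : nat => (a n)%:E))%E &
          (limn_esup (fun n : nat => (a n)%:E) <= 1)%E]].
Proof.
move=> a.
have L0 := total_length_gt0 G.
pose r (A : {set edge G}) := (\sum_(e in A) len e) / total_length G.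
pose t n := active_edges (psi n).
have t_neq0 n : (0 < n)%N -> t n != finset.set0.
  by move=> /hpsi[lambda _]; exact: active_edges_neq0.
have E1 : 1 <= #|edge G|%:R :> R by rewrite ler1n edge_gt0.
have a_near eps : 0 < eps ->
    exists N, forall n, (N <= n)%N -> (0 < n)%N /\ `|a n - r (t n)| < eps.
  move=> eps0; pose b := 4 * #|edge G|%:R / eps.
  have b0 : 0 < b by rewrite divr_gt0//; lra.
  (* The term b makes 4 [#|edge G|] / n less than eps, the rest is the threshold of
     [nodal_count_estimate]. *)
  exists (Num.truncn (b + (2 * #|edge G|%:R + 1))).+1 => n Nn.
  have bn : b + (2 * #|edge G|%:R + 1) < n%:R.
    by apply: lt_le_trans (truncnS_gt _) _; rewrite ler_nat.
  have nR : 0 < n%:R :> R by lra.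
  have n0 : (0 < n)%N by rewrite -(ltr_nat R).
  split=> //; have [lambda vl eig] := hpsi n n0.
  have est : `|(nodal_count (psi n))%:R - n%:R * r (t n)| <= 4 * #|edge G|%:R.
    by apply: nodal_count_estimate vl eig _; lra.
  have -> : a n - r (t n) = ((nodal_count (psi n))%:R - n%:R * r (t n)) / n%:R.
    by rewrite mulrBl mulrAC divff ?mul1r// gt_eqF.
  rewrite normrM normfV (gtr0_norm nR) ltr_pdivrMr//; apply: le_lt_trans est _.
  by rewrite [ltRHS]mulrC -ltr_pdivrMr// -/b; lra.
have acc_sub : acc a `<=` [set r A | A in [set A : {set edge G} | A != finset.set0]].
  apply: (acc_finite_family (t := t)) => // eps /a_near[N aN].
  by exists N => n /aN[].
have r_ge A : A != finset.set0 -> min_length G / total_length G <= r A.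
  move=> /set0Pn[e eA]; rewrite /r ler_pM2r ?invr_gt0// (bigD1 e)//=.
  apply: le_trans (min_length_le e) _; rewrite lerDl.
  by apply: sumr_ge0 => ? _; exact: ltW (len_gt0 _).
have r_le A : r A <= 1.
  rewrite /r ler_pdivrMr// mul1r /total_length [leRHS](bigID (fun e => e \in A))/= lerDl.
  by apply: sumr_ge0 => ? _; exact: ltW (len_gt0 _).
split => //.
- by apply: (sub_finite_set acc_sub); apply: finite_image; exact: finite_finset.
- by rewrite divr_gt0// min_length_gt0.
split; last 1 first.
- apply: ge_limn_esup => eps /a_near[N aN]; exists N => n /aN[_].
  by rewrite ltr_norml => /andP[_]; have := r_le (t n); lra.
- apply: le_limn_einf => eps /a_near[N aN]; exists N => n /aN[n0].
  by rewrite ltr_norml => /andP[+ _]; have := r_ge _ (t_neq0 n n0); lra.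
- exact: limn_einf_sup.
Qed.
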